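(* Let $X$ be a nondegenerate dendrite containing no points of infinite order, and let $\Gamma$ be a finite index subgroup of $SL_n(\mathbb{Z})$ with $n\geq 3$. Then for any action of $\Gamma$ on $X$ by homeomorphisms, there exists a $\Gamma$-invariant nondegenerate subdendrite $Y\subset X$ such that the subsystem $(Y,\Gamma|Y)$ is almost finite and the first point map $r:X\to Y$ is a contractible extension.
   Context: A dendrite is a locally connected continuum (compact connected metrizable space) containing no simple closed curve; it is nondegenerate if it has more than one point. The order of a point $x$ of a dendrite $X$ is the cardinality of the set of connected components of $X\setminus\{x\}$. For a subdendrite $Y$ of a dendrite $X$ and $x\in X$, there is a unique $r(x)\in Y$ with $[x,r(x)]\cap Y=\{r(x)\}$, where $[a,b]$ denotes the unique (possibly degenerate) arc in $X$ joining $a$ and $b$; the map $r:X\to Y$ is the first point map. An action of a group $G$ on a space is finite if the image of $G$ in the homeomorphism group is finite. Given actions $(X_i,G)$, $i=0,1,2,\dots$, on compact metric spaces with equivariant continuous surjections $\phi_i:X_{i+1}\to X_i$, the inverse limit is $\{(x_0,x_1,\dots)\in\prod_i X_i:\phi_i(x_{i+1})=x_i\ \forall i\}$ with the diagonal action $g(x_0,x_1,\dots)=(gx_0,gx_1,\dots)$. An action $(Y,G)$ is almost finite if it is topologically conjugate (via an equivariant homeomorphism) to such an inverse limit in which every $(X_i,G)$ is a finite action. An equivariant continuous surjection $\phi:(X,G)\to(Y,G)$ is a contractible extension if for each $y\in Y$ there is a sequence $g_1,g_2,\dots\in G$ with $\mathrm{diam}(g_i\phi^{-1}(y))\to 0$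 as $i\to\infty$. *)

(* Defs.v *)
From HB Require Import structures.
From mathcomp Require Import all_boot all_order all_algebra.
From mathcomp Require Import all_classical all_reals all_analysis.
Set Implicit Arguments. Unset Strict Implicit. Unset Printing Implicit Defensive.
Import Order.TTheory GRing.Theory Num.Theory.
Import numFieldTopology.Exports.
Local Open Scope classical_set_scope.
Local Open Scope ring_scope.

Section Dendrites.
Variables (R : realType) (X : metricType R).

Definition circle : set (R * R) := [set p | p.1 ^+ 2 + p.2 ^+ 2 = 1].

(** A contains a simple closed curve: a subset of A homeomorphic to S^1.
    (A continuous injection of the compact S^1 into the Hausdorff X is a
    homeomorphism onto its image.) *)
Definition has_simple_closed_curve (A : set X) : Prop :=
  exists f : R * R -> X,
    {within circle, continuous f} /\ {in circle &, injective f} /\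
    f @` circle `<=` A.

Definition locally_connected_set (A : set X) : Prop :=
  forall x, A x -> forall U : set X, open U -> U x ->
    exists V : set X, [/\ open V, V x, V `&` A `<=` U & connected (V `&` A)].

Definition is_dendrite (A : set X) : Prop :=
  [/\ A !=set0, compact A, connected A, locally_connected_set A
    & ~ has_simple_closed_curve A].

Definition nondeg (A : set X) : Prop :=
  exists a b, [/\ A a, A b & a <> b].

Definition finite_order (x : X) : Prop :=
  finite_set [set connected_component (~` [set x]) y | y in ~` [set x]].

Definition is_arc (a b : X) (A : set X) : Prop :=
  (a = b /\ A = [set a]) \/
  (a <> b /\ exists f : R -> X,
     [/\ {within `[0, 1], continuous f}, {in `[0, 1] &, injective f},
         f 0 = a, f 1 = b & A = f @` `[0, 1]]).

Definition first_point (Y : set X) (x y : X) : Prop :=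
  Y y /\ exists A, is_arc x y A /\ A `&` Y = [set y].

End Dendrites.

Definition SLZ (n : nat) : set 'M[int]_n := [set A | \det A = 1].
Arguments SLZ n : clear implicits.

Definition is_subgroup_SLZ (n : nat) (G : set 'M[int]_n) : Prop :=
  [/\ G `<=` SLZ n, G 1%:M,
      (forall a b, G a -> G b -> G (a *m b)) &
      (forall a, G a -> G (invmx a))].

Definition finite_index_subgroup_SLZ (n : nat) (G : set 'M[int]_n) : Prop :=
  @is_subgroup_SLZ n G /\
  exists s : seq 'M[int]_n, (forall g, g \in s -> SLZ n g) /\
    forall h, SLZ n h -> exists2 g, g \in s & exists2 c, G c & h = g *m c.

Definition is_action (n : nat) (G : set 'M[int]_n) (T : topologicalType)
  (a : 'M[int]_n -> T -> T) : Prop :=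
  [/\ (forall g, G g -> continuous (a g)),
      (forall g, G g -> exists2 ginv : T -> T, continuous ginv &
          cancel (a g) ginv /\ cancel ginv (a g)),
      (forall x, a 1%:M x = x) &
      (forall g h x, G g -> G h -> a (g *m h) x = a g (a h x))].

Definition finite_action (n : nat) (G : set 'M[int]_n) (T : Type)
  (a : 'M[int]_n -> T -> T) : Prop := finite_set (a @` G).

Section Dynamics.
Variables (R : realType) (X : metricType R) (n : nat) (G : set 'M[int]_n)
  (act : 'M[int]_n -> X -> X).

Definition G_invariant (Y : set X) : Prop := forall g y, G g -> Y y -> Y (act g y).

Definition almost_finite (Y : set X) : Prop :=
  exists (Z : nat -> metricType R) (a : forall i, 'M[int]_n -> Z i -> Z i)
         (phi : forall i, Z i.+1 -> Z i),
  [/\ (forall i, compact [set: Z i]),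
      (forall i, is_action G (a i) /\ finite_action G (a i)),
      (forall i, continuous (phi i) /\ (forall w : Z i, exists v, phi i v = w)),
      (forall i g z, G g -> phi i (a i.+1 g z) = a i g (phi i z)) &
   let L : set (prod_topology (fun i => Z i : topologicalType)) := [set z | forall i, phi i (z i.+1) = z i] in
   exists (h : X -> prod_topology (fun i => Z i : topologicalType)) (k : (prod_topology (fun i => Z i : topologicalType)) -> X),
     [/\ {within Y, continuous h}, {within L, continuous k},
         (forall y, Y y -> L (h y) /\ k (h y) = y),
         (forall z, L z -> Y (k z) /\ h (k z) = z) &
         (forall g y, G g -> Y y -> h (act g y) = (fun i => a i g (h y i)))]].

Definition contractible_extension (Y : set X) (phi : X -> X) : Prop :=
  [/\ continuous phi, phi @` setT = Y,
      (forall g x, G g -> phi (act g x) = act g (phi x)) &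
      forall y, Y y -> exists u : nat -> 'M[int]_n, (forall i, G (u i)) /\
        forall e : R, 0 < e -> \forall i \near \oo,
          forall p q, (act (u i) @` (phi @^-1` [set y])) p ->
                      (act (u i) @` (phi @^-1` [set y])) q -> mdist p q <= e].

End Dynamics.

(* Main.v *)
(** In a dendrite any two points span a unique arc [seg a b], three points have a
    median, and a root [o] induces a tree order. Choose K such that every conjugate
    of an elementary matrix e_ij(K c) lies in the group, and let T_k be the closed
    convex set of points fixed by all conjugates of the e_ij(k), K | k.

    Some T_k is nonempty. Commuting homeomorphisms have, up to squares, common fixed
    points, which provides three points, each fixed by two of three families of
    elementary matrices. As e_ij and e_jl generate Heisenberg groups, in which
    commutators are quadratically distorted, the median of the three points is fixed
    by all three families, hence by all e_ij(k c) for some k, and so it lies in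
    T_(k^2): by Tits, the e_ij(k c) generate every conjugate of the e_ij(k^2 c).

    If y lies in T_k and x <> y, finite order of y makes a multiple of the e_ij map a
    small point z of ]y, x] into [y, x]; distortion again (Witte's argument on orders)
    forces all of them to fix z. Thus for Y the closure of the union F of the T_k, the
    first point map has trivial fibres over F. A point of Y outside F has an infinite
    orbit, while only finitely many fibres have diameter at least e, so its fibre can
    be contracted. SL_n acts on each T_k through a finite quotient (Dietzmann), and
    the first point maps onto T_(k i!) converge uniformly to the identity of Y, which
    is therefore their inverse limit. *)
Require Import Defs.
From HB Require Import structures.
From mathcomp Require Import all_boot all_order all_algebra.
From mathcomp Require Import all_classical all_reals all_analysis.
From mathcomp Require Import zify ring lra.
Set Implicit Arguments.
Unset Strict Implicit.
Unset Printing Implicit Defensive.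
Import Order.TTheory GRing.Theory Num.Theory.
Import numFieldTopology.Exports.
Local Open Scope classical_set_scope.
Local Open Scope ring_scope.

(** * Metric continua and arcs *)

Section Metric.
Context {R : realType} {X : metricType R}.
Implicit Types (x y z : X) (U V W K : set X).

(** Arcs are no part of the definition of a dendrite: their existence is drawn from local
    connectedness, their uniqueness from the absence of circles. Fixed point sets of homeomorphisms
    are in general not connected, and a commuting homeomorphism may swap two of their points. Common
    fixed points are therefore sought in sets closed under medians, at the price of squares. This is
    one reason why k has to grow during the proof; commutators, Tits generation and periods are
    others. The T_k increase with divisibility, and F, their union, need not be closed. Distortion
    compares speeds: a word of length 4n in two one-parameter groups is a power of their commutator
    with exponent proportional to n^2. If each letter moves a point by boundedly many steps of the
    commutator along an arc, the word moves it by O(n) steps, so the point is fixed. The three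
    points come from the hexagon of roots of SL_3, in cyclic order 12, 13, 23, 21, 31, 32. Each
    point is fixed, up to multiples, by three consecutive roots, starting at 12, 23 and 31; so any
    two points share one of the roots 12, 23, 31, whose commutators yield all others. *)

Lemma mdist_lt_eq x y : (forall e : R, 0 < e -> mdist x y <= e) -> x = y.
Proof.
move=> h; apply: mdist_positivity; apply/eqP; rewrite eq_le mdist_ge0 andbT.
apply/ler_addgt0Pl => e e0; rewrite addr0; exact: h.
Qed.

Lemma nbhs_mdistE x U : nbhs x U <-> exists2 e : R, 0 < e & forall y, mdist x y < e -> U y.
Proof.
split=> [|[e e0 h]].
  move/nbhs_ballP => [e /= e0 h]; exists e => // y xy; apply: h.
  by rewrite ballEmdist.
by apply/nbhs_ballP; exists e => //= y; rewrite ballEmdist; exact: h.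
Qed.

Lemma open_mdistP U : open U <->
  forall x, U x -> exists2 e : R, 0 < e & forall y, mdist x y < e -> U y.
Proof.
rewrite openE; split=> h x Ux; first by apply/nbhs_mdistE; exact: h.
by rewrite /interior; apply/nbhs_mdistE; exact: h.
Qed.

Lemma closure_mdistP U x : closure U x <->
  forall e : R, 0 < e -> exists2 y, U y & mdist x y < e.
Proof.
split=> [h e e0|h B /nbhs_mdistE[e e0 eB]].
  have /h[y [Uy xy]] : nbhs x [set y | mdist x y < e].
    by apply/nbhs_mdistE; exists e.
  by exists y.
by have [y Uy xy] := h e e0; exists y; split => //; exact: eB.
Qed.

Lemma closed_mdistP U : closed U <->
  forall x, (forall e : R, 0 < e -> exists2 y, U y & mdist x y < e) -> U x.
Proof.
rewrite closure_id; split=> [Uc x /closure_mdistP|h]; first by rewrite -Uc.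
apply/seteqP; split; first exact: subset_closure.
by move=> x /closure_mdistP; exact: h.
Qed.

Lemma open_dist_lt x (e : R) : open [set y | mdist x y < e].
Proof.
apply/open_mdistP => y /= xy; exists (e - mdist x y); first by rewrite subr_gt0.
by move=> z yz; rewrite (le_lt_trans (metric_triangle x y z))// -ltrBrDl.
Qed.

Lemma compact_seq_cluster K (u : nat -> X) : compact K -> (forall n, K (u n)) ->
  exists2 p, K p & forall (e : R) N, 0 < e -> exists2 n, (N <= n)%N & mdist p (u n) < e.
Proof.
move=> cK Ku; have FK : (u n @[n --> \oo]) K by apply: (@nearW _ \oo) => n; exact: Ku.
have [p [Kp cp]] := cK _ _ FK.
exists p => // e N e0.
have := cp [set y | exists2 n, (N <= n)%N & y = u n] [set y | mdist p y < e].
case.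
- by exists N => // n /= Nn; exists n.
- by apply/nbhs_mdistE; exists e.
- by move=> _ [[n Nn ->] h]; exists n.
Qed.

(** Without a finite cover, the sets of points missed by finitely many [P x] generate a proper
    filter on [K]; at a cluster point [p] the list [[:: p]] gives a contradiction. *)
Lemma compact_subcover K (P : X -> set X) : compact K ->
  (forall x, K x -> open (P x) /\ P x x) ->
  exists s : seq X, (forall x, x \in s -> K x) /\
    forall y, K y -> exists2 x, x \in s & P x y.
Proof.
move=> cK h; apply: contrapT => nocov.
pose D := [set s : seq X | forall x, x \in s -> K x].
pose B (s : seq X) := K `&` [set y | forall x, x \in s -> ~ P x y].
have FF : ProperFilter (filter_from D B).
  apply: filter_from_proper => [|s Ds].
    apply: filter_from_filter; first by exists [::].
    move=> s t Ds Dt; exists (s ++ t) => [x|y [Ky h']].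
      by rewrite mem_cat => /orP[/Ds|/Dt].
    by split; split => // x xs; apply: h'; rewrite mem_cat xs ?orbT.
  apply: contrapT => B0; apply: nocov; exists s; split => // y Ky.
  apply: contrapT => nP; apply: B0; exists y; split => // x xs Pxy.
  by apply: nP; exists x.
have [|p [Kp cp]] := cK _ FF; first by exists [::] => // y [].
have [oP Pp] := h p Kp.
have := cp (B [:: p]) (P p); case.
- by exists [:: p] => // x; rewrite inE => /eqP->.
- exact: open_nbhs_nbhs.
- by move=> y [[_ /(_ p)]]; rewrite inE eqxx => /(_ isT).
Qed.

End Metric.

Section Continuity.
Context {R : realType} {X Y : metricType R}.

Lemma continuous_mdistP (f : X -> Y) : continuous f <->
  forall x (e : R), 0 < e -> exists2 d : R, 0 < d &
    forall y, mdist x y < d -> mdist (f x) (f y) < e.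
Proof.
split=> [cf x e e0|h x A /nbhs_mdistE[e e0 eA]].
  have /(cf x) : nbhs (f x) [set y | mdist (f x) y < e].
    by apply/nbhs_mdistE; exists e.
  by move/nbhs_mdistE.
have [d d0 hd] := h x e e0; apply/nbhs_mdistE; exists d => // y xy.
by apply: eA; exact: hd.
Qed.

Lemma within_mdistP (A : set X) (f : X -> Y) : {within A, continuous f} <->
  forall x (e : R), A x -> 0 < e -> exists2 d : R, 0 < d &
    forall y, A y -> mdist x y < d -> mdist (f x) (f y) < e.
Proof.
split=> [/subspace_continuousP cf x e Ax e0|h].
  have /(cf x Ax) : nbhs (f x) [set y | mdist (f x) y < e].
    by apply/nbhs_mdistE; exists e.
  move/nbhs_mdistE => [d d0 hd]; exists d => // y Ay xy; exact: hd.
apply/subspace_continuousP => x Ax B /nbhs_mdistE[e e0 eB].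
have [d d0 hd] := h x e Ax e0; apply/nbhs_mdistE; exists d => // y xy Ay.
by apply: eB; exact: hd.
Qed.

End Continuity.

Section RealContinuity.
Context {R : realType} {X : metricType R}.

Lemma continuous_realP (f : R -> X) : continuous f <->
  forall x (e : R), 0 < e -> exists2 d : R, 0 < d &
    forall y, `|y - x| < d -> mdist (f x) (f y) < e.
Proof. exact: (@continuous_mdistP R R^o). Qed.

Lemma within_realP (A : set R) (f : R -> X) : {within A, continuous f} <->
  forall x (e : R), A x -> 0 < e -> exists2 d : R, 0 < d &
    forall y, A y -> `|y - x| < d -> mdist (f x) (f y) < e.
Proof. exact: (@within_mdistP R R^o). Qed.

End RealContinuity.

(** * Path connectedness of connected open sets *)

Section Paths.
Context {R : realType} {X : metricType R}.
Hypothesis Xcompact : compact [set: X].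
Hypothesis Xlc : locally_connected_set [set: X].
Implicit Types (x y z : X) (U V W : set X) (e : R).

Definition small_in (e : R) U W :=
  [/\ open W, connected W, closure W `<=` U & forall p q, W p -> W q -> mdist p q < e].

Lemma small_nbhs x U e : open U -> U x -> 0 < e -> exists2 W, small_in e U W & W x.
Proof.
move=> oU Ux e0.
have [d d0 dU] := (open_mdistP U).1 oU x Ux.
pose r := Num.min (d / 2) (e / 2).
have r0 : 0 < r by rewrite lt_min !divr_gt0.
have [|V [oV Vx VU cV]] := @Xlc x I _ (open_dist_lt x r); first by rewrite /= mdistxx.
rewrite setIT in VU cV; exists V => //; split => //.
  move=> y /closure_mdistP/(_ (d / 2))[|z Vz yz]; first by rewrite divr_gt0.
  apply: dU; rewrite (le_lt_trans (metric_triangle x z y))//.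
  rewrite [ltRHS]splitr ltrD 1?[mdist z y]metric_sym//.
  by rewrite (lt_le_trans (VU _ Vz))// ge_min lexx.
move=> p q Vp Vq; rewrite (le_lt_trans (metric_triangle p x q))//.
by rewrite [ltRHS]splitr ltrD 1?[mdist p x]metric_sym// (lt_le_trans (VU _ _))// ge_min lexx orbT.
Qed.

Definition chain e U x y (c : nat * (nat -> X) * (nat -> set X)) :=
  let: (k, z, W) := c in
  [/\ (0 < k)%N, z 0%N = x, z k = y &
    forall i, (i < k)%N -> [/\ small_in e U (W i), W i (z i) & W i (z i.+1)]].

Lemma chain_snoc e U x y y' c W : chain e U x y c -> small_in e U W -> W y -> W y' ->
  exists c', chain e U x y' c'.
Proof.
case: c => [[k z] Ws] [k0 z0 zk h] sW Wy Wy'.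
exists (k.+1, (fun i => if (i <= k)%N then z i else y'),
  (fun i => if (i < k)%N then Ws i else W)); split => //; first by rewrite ltnn.
move=> i; rewrite ltnS (leq_eqVlt i) => /predU1P[->|ik].
  by rewrite eqxx !ltnn zk.
by rewrite ik orbT; exact: h.
Qed.

(** The points of [U] reached by chains from [x] form a set open and closed in [U]: a small link
    around a point of its closure contains a reached point and so adds one step. *)
Lemma chain_exists e U x y : open U -> connected U -> 0 < e -> U x -> U y ->
  exists c, chain e U x y c.
Proof.
move=> oU cU e0 Ux Uy.
pose B := [set y | U y /\ exists c, chain e U x y c].
have WU W : small_in e U W -> W `<=` U.
  by move=> [_ _ h _] z Wz; apply: h; exact: subset_closure.
suff BU : B = U by move: Uy; rewrite -{1}BU => -[].
apply: cU.
- exists x; split => //; have [W sW Wx] := small_nbhs oU Ux e0.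
  by exists (1%N, (fun=> x), (fun=> W)).
- exists B; last by apply/esym/setIidPr => z [].
  apply/open_mdistP => z [Uz [c Pc]].
  have [W sW Wz] := small_nbhs oU Uz e0.
  have [oW _ _ _] := sW; have [d d0 dW] := (open_mdistP W).1 oW z Wz.
  exists d => // t /dW Wt; split; first exact: WU Wt.
  exact: chain_snoc Pc sW Wz Wt.
exists (closure B); first exact: closed_closure.
apply/seteqP; split=> [z Bz|z [Uz Bz]].
  by split; [case: Bz|exact: subset_closure].
have [W sW Wz] := small_nbhs oU Uz e0.
have [oW _ _ _] := sW; have [d d0 dW] := (open_mdistP W).1 oW z Wz.
have /closure_mdistP/(_ d d0)[t [Ut [c Pc]] /dW Wt] := Bz.
by split => //; exact: chain_snoc Pc sW Wt Wz.
Qed.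

(* A state is (start, end, region): a path from start to end has to be drawn
   inside the region. *)
Local Notation state := (X * X * set X)%type.

Definition good (S : state) := [/\ open S.2, connected S.2, S.2 S.1.1 & S.2 S.1.2].

Definition eps (n : nat) : R := n.+1%:R^-1.

Lemma eps_gt0 n : 0 < eps n. Proof. by rewrite invr_gt0. Qed.

Lemma eps_small e : 0 < e -> exists n, eps n < e.
Proof.
move=> e0; exists (Num.truncn e^-1); rewrite /eps invf_plt ?posrE//.
exact: truncnS_gt.
Qed.

Definition refine (n : nat) (S : state) : nat * (nat -> X) * (nat -> set X) :=
  xget (0%N, (fun=> S.1.1), (fun=> S.2)) (chain (eps n) S.2 S.1.1 S.1.2).

Definition num n S := (refine n S).1.1.

Definition child n S (i : nat) : state :=
  ((refine n S).1.2 i, (refine n S).1.2 i.+1, (refine n S).2 i).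

(** The unit interval is cut into [num n S] equal cells, one for each link; the minimum puts t = 1
    into the last cell. *)
Definition idx n S (t : R) := minn (Num.truncn ((num n S)%:R * t)) (num n S).-1.

Definition rest n S (t : R) (i : nat) : R := (num n S)%:R * t - i%:R.

Lemma refineP n S : good S -> chain (eps n) S.2 S.1.1 S.1.2 (refine n S).
Proof.
case=> oS cS Sx Sy; have [c hc] := chain_exists oS cS (eps_gt0 n) Sx Sy.
by apply: xgetPex; exists c.
Qed.

Lemma num_gt0 n S : good S -> (0 < num n S)%N.
Proof. by move/(refineP n); rewrite /num; case: (refine n S) => [[? ?] ?] []. Qed.

Lemma childP n S i : good S -> (i < num n S)%N ->
  [/\ good (child n S i), closure (child n S i).2 `<=` S.2 &
    forall p q, (child n S i).2 p -> (child n S i).2 q -> mdist p q < eps n].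
Proof.
move/(refineP n); rewrite /num /child.
by case: (refine n S) => [[k z] W] [_ _ _ h] /= /h[[? ? ? ?] ? ?].
Qed.

Lemma child_l n S : good S -> (child n S 0).1.1 = S.1.1.
Proof. by move/(refineP n); rewrite /child; case: (refine n S) => [[? ?] ?] []. Qed.

Lemma child_r n S : good S -> (child n S (num n S).-1).1.2 = S.1.2.
Proof.
move=> gS; have := num_gt0 n gS; move: gS => /(refineP n); rewrite /child /num.
by case: (refine n S) => [[k z] W] [/= _ _ zk _] k0; rewrite prednK.
Qed.

Lemma idx_lt n S t : good S -> (idx n S t < num n S)%N.
Proof. by move/(num_gt0 n) => k0; rewrite /idx gtn_min orbC ltn_predL k0. Qed.

(* [run m n S t] descends [m] levels into ever finer chains, each time entering
   the link whose parameter interval contains [t]; the path at time [t] is the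
   unique point in the closures of all the regions met. *)
Fixpoint run m n S (t : R) : state :=
  if m is m'.+1 then run m' n.+1 (child n S (idx n S t)) (rest n S t (idx n S t))
  else S.

Lemma run_good m n S t : good S -> good (run m n S t).
Proof.
elim: m n S t => //= m IH n S t gS; apply: IH.
by have [] := childP gS (idx_lt n t gS).
Qed.

Lemma run_nested m n S t : good S -> closure (run m.+1 n S t).2 `<=` (run m n S t).2.
Proof.
elim: m n S t => [|m IH] n S t gS; have [gc ? _] := childP gS (idx_lt n t gS); first by [].
exact: (IH n.+1).
Qed.

Lemma run_sub m j n S t : good S -> (run (m + j) n S t).2 `<=` (run m n S t).2.
Proof.
move=> gS; elim: j => [|j IH]; first by rewrite addn0.
rewrite addnS => p hp; apply: IH; apply: run_nested => //; exact: subset_closure.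
Qed.

Lemma run_diam m n S t p q : good S ->
  (run m.+1 n S t).2 p -> (run m.+1 n S t).2 q -> mdist p q < eps (n + m).
Proof.
elim: m n S t => [|m IH] n S t gS; have [gc _ d] := childP gS (idx_lt n t gS).
  by rewrite addn0; exact: d.
rewrite addnS -addSn; exact: (IH n.+1).
Qed.

Definition lies n S t : set X := [set p | forall m, closure (run m n S t).2 p].

(** The start points of the nested regions cluster, by compactness, in the closure of each of
    them. *)
Lemma lies_exists n S t : good S -> lies n S t !=set0.
Proof.
move=> gS; pose u m := (run m n S t).1.1.
have [p _ hp] := compact_seq_cluster Xcompact (fun m => I : [set: X] (u m)).
exists p => m; apply/closure_mdistP => e /(hp e m)[j mj pj].
exists (u j) => //; rewrite /u; have /esym -> := subnKC mj.
by apply: (@run_sub m (j - m) n S t gS); have [] := run_good (m + (j - m)) n t gS.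
Qed.

Lemma eps_le m n : (m <= n)%N -> eps n <= eps m.
Proof. by move=> mn; rewrite /eps lef_pV2 ?posrE// ler_nat. Qed.

Lemma lies_unique n S t p q : good S -> lies n S t p -> lies n S t q -> p = q.
Proof.
move=> gS hp hq; apply: mdist_lt_eq => e /eps_small[m me].
rewrite ltW// (lt_le_trans (run_diam (m := m) gS (run_nested gS (hp _)) (run_nested gS (hq _))))//.
by rewrite (le_trans _ (ltW me))// eps_le// leq_addl.
Qed.

Definition cpath n S t : X := xget S.1.1 (lies n S t).

Lemma cpathP n S t : good S -> lies n S t (cpath n S t).
Proof. by move=> /(lies_exists n t) [p hp]; apply: xgetPex; exists p. Qed.

Lemma cpath_child n S t : good S ->
  cpath n S t = cpath n.+1 (child n S (idx n S t)) (rest n S t (idx n S t)).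
Proof.
move=> gS; have [gc _ _] := childP gS (idx_lt n t gS).
apply: (lies_unique (n := n.+1) (t := rest n S t (idx n S t)) gc); last exact: cpathP.
by move=> m; have h := @cpathP n S t gS; exact: (h m.+1).
Qed.

Lemma cpath_in n S t : good S -> S.2 (cpath n S t).
Proof. by move=> gS; have h := @cpathP n S t gS; exact: (run_nested gS (h 1%N)). Qed.

Lemma run_l m n S : good S -> (run m n S 0).1.1 = S.1.1.
Proof.
elim: m n S => //= m IH n S gS; rewrite /rest mulr0.
have -> : idx n S 0 = 0%N by rewrite /idx mulr0 truncn0 min0n.
have [gc _ _] := childP gS (num_gt0 n gS).
by rewrite subr0 IH// child_l.
Qed.

Lemma cpath0 n S : good S -> cpath n S 0 = S.1.1.
Proof.
move=> gS; apply: (lies_unique gS (@cpathP n S 0 gS)) => m; apply: subset_closure.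
by rewrite -(run_l m n gS); have [] := run_good m n 0 gS.
Qed.

Lemma idx1 n S : good S -> idx n S 1 = (num n S).-1.
Proof. by move=> gS; rewrite /idx mulr1 natrK; apply/minn_idPr; rewrite leq_pred. Qed.

Lemma run_r m n S : good S -> (run m n S 1).1.2 = S.1.2.
Proof.
elim: m n S => //= m IH n S gS; have k0 := num_gt0 n gS.
rewrite /rest mulr1 idx1//.
have -> : (num n S)%:R - (num n S).-1%:R = 1 :> R.
  by rewrite -{1}(prednK k0) -natr1 addrAC subrr add0r.
have k1 : ((num n S).-1 < num n S)%N by rewrite ltn_predL.
have [gc _ _] := childP gS k1.
by rewrite IH// child_r.
Qed.

Lemma cpath1 n S : good S -> cpath n S 1 = S.1.2.
Proof.
move=> gS; apply: (lies_unique gS (@cpathP n S 1 gS)) => m; apply: subset_closure.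
by rewrite -(run_r m n gS); have [] := run_good m n 1 gS.
Qed.

Lemma idxE n S t i : (i < num n S)%N ->
  i%:R <= (num n S)%:R * t < i.+1%:R -> idx n S t = i.
Proof.
move=> ik h; rewrite /idx (truncn_def h); apply/minn_idPl.
by rewrite -ltnS prednK// (leq_ltn_trans _ ik).
Qed.

(** Cells may be taken closed: at a common end point the two links give the same value, the vertex
    of the chain that they share. *)
Lemma cpath_cell n S t i : good S -> (i < num n S)%N ->
  i%:R <= (num n S)%:R * t <= i.+1%:R ->
  cpath n S t = cpath n.+1 (child n S i) (rest n S t i).
Proof.
move=> gS ik /andP[h1]; have k0 := num_gt0 n gS.
rewrite le_eqVlt => /predU1P[h2|h2]; last first.
  by rewrite (cpath_child n t gS) (@idxE _ _ _ i)// h1.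
have [gc _ _] := childP gS ik.
have -> : rest n S t i = 1 by rewrite /rest h2 -natr1 addrAC subrr add0r.
rewrite (cpath1 _ gc); move: ik; rewrite leq_eqVlt => /predU1P[ek|ik].
  have -> : t = 1.
    by apply: (@mulfI _ (num n S)%:R); rewrite ?pnatr_eq0 -?lt0n// mulr1 h2 ek.
  by rewrite (cpath1 n gS) -(child_r n gS) -ek.
have [gc' _ _] := childP gS ik.
rewrite (cpath_child n t gS) (@idxE _ _ _ i.+1)//; last by rewrite h2 lexx ltr_nat /=.
by rewrite /rest h2 subrr (cpath0 _ gc').
Qed.

(** Each side is treated separately, because at the end of a cell the two sides run in different
    links. Parameters slightly larger than [t] share its link down to depth [j.+1], where distances
    are below [eps (n + j)]. *)
Lemma cpath_right j n S t : good S -> 0 <= t < 1 -> exists2 d : R, 0 < d &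
  forall s, t <= s < t + d -> mdist (cpath n S t) (cpath n S s) < eps (n + j).
Proof.
elim: j n S t => [|j IH] n S t gS /andP[t0 t1].
all: have k0 := num_gt0 n gS; have kt0 : 0 <= (num n S)%:R * t by rewrite mulr_ge0.
all: have kp : 0 < (num n S)%:R :> R by rewrite ltr0n.
all: pose i := Num.truncn ((num n S)%:R * t).
all: have /andP[h1 h2] : i%:R <= (num n S)%:R * t < i.+1%:R := truncn_itv kt0.
all: have ik : (i < num n S)%N.
1,3: by rewrite -(ltr_nat R) (le_lt_trans h1)// gtr_pMr.
all: have [gc _ dc] := childP gS ik.
all: pose d := i.+1%:R / (num n S)%:R - t.
all: have d0 : 0 < d.
1,3: by rewrite subr_gt0 ltr_pdivlMr// mulrC.
all: have H s : t <= s < t + d -> cpath n S s = cpath n.+1 (child n S i) (rest n S s i).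
1,3: move=> /andP[ts]; rewrite addrC subrK ltr_pdivlMr// => sd; apply: cpath_cell => //;
  by rewrite mulrC in sd; rewrite (ltW sd) andbT (le_trans h1)// ler_pM2l.
all: have Ht : t <= t < t + d by rewrite lexx ltrDl.
  exists d => // s st; rewrite addn0 (H t)// (H s)//; apply: dc; exact: cpath_in.
have [|d' d'0 hd'] := IH n.+1 (child n S i) (rest n S t i) gc.
  by rewrite /rest subr_ge0 h1 ltrBlDl natr1.
exists (Num.min d (d' / (num n S)%:R)); first by rewrite lt_min d0 divr_gt0.
move=> s /andP[ts sm]; have [sd sd'] : s < t + d /\ s < t + d' / (num n S)%:R.
  by move: sm; rewrite -ltrBlDl lt_min => /andP[]; rewrite !ltrBlDl.
rewrite (H t)// (H s) ?ts//; rewrite addnS -addSn; apply: hd'.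
have q1 : (num n S)%:R * t <= (num n S)%:R * s by rewrite ler_pM2l.
move: sd'; rewrite -ltrBlDl ltr_pdivlMr// /rest => q2; lra.
Qed.

Lemma cpath_left j n S t : good S -> 0 < t <= 1 -> exists2 d : R, 0 < d &
  forall s, t - d < s <= t -> mdist (cpath n S t) (cpath n S s) < eps (n + j).
Proof.
elim: j n S t => [|j IH] n S t gS /andP[t0 t1].
all: have k0 := num_gt0 n gS; have kt0 : 0 < (num n S)%:R * t by rewrite mulr_gt0// ltr0n.
all: have kp : 0 < (num n S)%:R :> R by rewrite ltr0n.
(* Cells are now open on the left, so a grid point belongs to the cell that ends there. *)
all: have [i ik /andP[h1 h2]] : exists2 i, (i < num n S)%N & i%:R < (num n S)%:R * t <= i.+1%:R.
1,3: have /andP[g1 g2] := truncn_itv (ltW kt0); set m := Num.truncn _ in g1 g2;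
  have mk : (m <= num n S)%N by [rewrite -(ler_nat R) (le_trans g1)// ler_piMr];
  move: g1; rewrite le_eqVlt => /predU1P[g1|g1];
  [have m0 : (0 < m)%N by [rewrite -(ltr_nat R) g1]; exists m.-1;
    [by rewrite prednK|by rewrite prednK// -g1 lexx andbT ltr_nat ltn_predL]|
   exists m; [by rewrite -(ltr_nat R) (lt_le_trans g1)// ler_piMr|by rewrite g1 ltW]].
all: have [gc _ dc] := childP gS ik.
all: pose d := t - i%:R / (num n S)%:R.
all: have d0 : 0 < d.
1,3: by rewrite subr_gt0 ltr_pdivrMr// mulrC.
all: have H s : t - d < s <= t -> cpath n S s = cpath n.+1 (child n S i) (rest n S s i).
1,3: move=> /andP[]; rewrite subKr ltr_pdivrMr// => sd ts; apply: cpath_cell => //;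
  by rewrite mulrC in sd; rewrite (ltW sd) (le_trans _ h2)// ler_pM2l.
all: have Ht : t - d < t <= t by rewrite lexx ltrBlDr ltrDl d0.
  exists d => // s st; rewrite addn0 (H t)// (H s)//; apply: dc; exact: cpath_in.
have [|d' d'0 hd'] := IH n.+1 (child n S i) (rest n S t i) gc.
  by rewrite /rest subr_gt0 h1 lerBlDl natr1.
exists (Num.min d (d' / (num n S)%:R)); first by rewrite lt_min d0 divr_gt0.
move=> s /andP[sm ts]; have [sd sd'] : t - d < s /\ t - d' / (num n S)%:R < s.
  by move: sm; rewrite ltrBlDr -ltrBlDl lt_min => /andP[g1 g2]; split; lra.
rewrite (H t)// (H s) ?ts ?sd//; rewrite addnS -addSn; apply: hd'.
have q1 : (num n S)%:R * s <= (num n S)%:R * t by rewrite ler_pM2l.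
move: sd'; rewrite ltrBlDr -ltrBlDl ltr_pdivlMr// /rest => q2; lra.
Qed.

Lemma path_exists U x y : open U -> connected U -> U x -> U y ->
  exists f : R -> X, [/\ continuous f, f 0 = x, f 1 = y & forall t, 0 <= t <= 1 -> U (f t)].
Proof.
move=> oU cU Ux Uy; pose S : state := (x, y, U).
have gS : good S by [].
(* Clamping the parameter extends the path to a continuous map on all of [R], the form used for
   paths and arcs from here on. *)
pose cl (t : R) := Num.max 0 (Num.min t 1).
have cl01 t : 0 <= cl t <= 1 by rewrite /cl le_max lexx ge_max ler01 ge_min lexx orbT.
have clid t : 0 <= t <= 1 -> cl t = t.
  by move=> /andP[t0 t1]; rewrite /cl (min_idPl _)//; apply/max_idPr.
exists (cpath 0 S \o cl); split; last first.
- by move=> t _; exact: (cpath_in 0 _ gS).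
- by rewrite /= clid ?lexx ?ler01// (cpath1 0 gS).
- by rewrite /= clid ?lexx ?ler01// (cpath0 0 gS).
apply/continuous_realP => t e /eps_small[j je] /=.
have clle s s' : s <= s' -> cl s <= cl s' <= cl s + (s' - s).
  rewrite /cl /Order.max /Order.min => ss'.
  by case: (ltP s 1) => ?; case: (ltP s' 1) => ?; rewrite ?ltr01;
     case: (ltP 0 s) => ?; case: (ltP 0 s') => ?; apply/andP; split; lra.
have [d1 d10 h1] : exists2 d : R, 0 < d & forall s, t <= s < t + d ->
    mdist (cpath 0 S (cl t)) (cpath 0 S (cl s)) < e.
  have [tt|tt] := ltP (cl t) 1; last first.
    exists 1 => // s /andP[ts _]; have := clle _ _ ts; have := cl01 s => h1 h2.
    have -> : cl s = cl t by apply/eqP; rewrite eq_le; apply/andP; split; lra.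
    by rewrite mdistxx; apply: lt_trans je; exact: eps_gt0.
  have [|d d0 hd] := @cpath_right j 0 S (cl t) gS.
    by rewrite tt andbT; have /andP[] := cl01 t.
  exists d => // s /andP[ts sd]; apply: lt_trans je; apply: hd.
  by have := clle _ _ ts => /andP[? ?]; apply/andP; split; lra.
have [d2 d20 h2] : exists2 d : R, 0 < d & forall s, t - d < s <= t ->
    mdist (cpath 0 S (cl t)) (cpath 0 S (cl s)) < e.
  have [tt|tt] := ltP 0 (cl t); last first.
    exists 1 => // s /andP[_ ts]; have := clle _ _ ts; have := cl01 s => h2 h3.
    have -> : cl s = cl t by apply/eqP; rewrite eq_le; apply/andP; split; lra.
    by rewrite mdistxx; apply: lt_trans je; exact: eps_gt0.
  have [|d d0 hd] := @cpath_left j 0 S (cl t) gS.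
    by rewrite tt /=; have /andP[] := cl01 t.
  exists d => // s /andP[ds ts]; apply: lt_trans je; apply: hd.
  by have := clle _ _ ts => /andP[? ?]; apply/andP; split; lra.
exists (Num.min d1 d2); first by rewrite lt_min d10.
move=> s; rewrite lt_min !ltr_norml => /andP[/andP[a b] /andP[c d]].
have [ts|ts] := leP t s; [apply: h1|apply: h2]; apply/andP; split; lra.
Qed.

End Paths.

(** * Extracting an arc from a path *)

Section RealSets.
Context {R : realType}.
Implicit Types (A U : set R).

Lemma closed_max A (x y : R) : closed A -> A x -> x <= y ->
  exists m, [/\ A m, x <= m, m <= y & forall u, A u -> u <= y -> u <= m].
Proof.
move=> cA Ax xy; pose E := [set u | A u /\ u <= y].
have ubE : has_ubound E by exists y => u [].
have Ex : E x by [].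
have h u : E u -> u <= sup E by move=> Eu; exact: ub_le_sup.
exists (sup E); split.
- apply: ((@closed_mdistP R R^o A).1 cA (sup E)) => e e0.
  have [u [Au uy] hu] := sup_adherent e0 (conj (ex_intro _ x Ex) ubE).
  exists u => //; rewrite /mdist /= distrC ger0_norm ?subr_ge0 ?h//.
  by rewrite ltrBlDr -ltrBlDl.
- exact: h.
- by apply: ge_sup; [exists x|move=> u []].
- by move=> u Au uy; apply: h.
Qed.

Lemma closed_min A (x y : R) : closed A -> A x -> y <= x ->
  exists m, [/\ A m, m <= x, y <= m & forall u, A u -> y <= u -> m <= u].
Proof.
move=> cA Ax yx; have [|||m [Am m1 m2 hm]] := @closed_max (-%R @^-1` A) (- x) (- y).
- by apply: closed_comp => // u _; exact: opp_continuous.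
- by rewrite /= opprK.
- by rewrite lerN2.
exists (- m); split => //; [by rewrite lerNl|by rewrite lerNr|].
by move=> u Au yu; rewrite lerNl; apply: hm; rewrite ?lerN2//= opprK.
Qed.

(** By compactness finitely many members cover the segment, and the largest of these contains the
    others. *)
Lemma chain_segment (F : set (set R)) (s t : R) : s <= t ->
  (forall U, F U -> open U) -> total_on F subset ->
  (forall u, s <= u <= t -> exists2 U, F U & U u) ->
  exists2 U, F U & forall u, s <= u <= t -> U u.
Proof.
move=> st oF tF cF.
pose P u := xget set0 [set U | F U /\ U u].
have hP u : s <= u <= t -> F (P u) /\ P u u.
  by move=> /cF[U FU Uu]; apply: (@xgetPex _ set0 [set U | F U /\ U u]); exists U.
have [|r [rK rcov]] := @compact_subcover R R^o `[s, t] P (@segment_compact R s t).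
  by move=> u; rewrite /= in_itv /= => /hP[FU Uu]; split => //; exact: oF.
have {rcov} rcov u : s <= u <= t -> exists2 x, x \in r & P x u.
  by move=> ut; apply: rcov; rewrite /= in_itv.
have rF x : x \in r -> F (P x) by move=> /rK; rewrite /= in_itv /= => /hP[].
have [U FU rU] : exists2 U, F U & forall x, x \in r -> P x `<=` U.
  have [x0 x0r _] := rcov s (introT andP (conj (lexx s) st)).
  have F0 := rF _ x0r; clear x0r rcov rK.
  elim: r rF => [_|y r IH rF]; first by exists (P x0).
  have Fy : F (P y) by apply: rF; rewrite inE eqxx.
  have [|U FU rU] := IH; first by move=> x xr; apply: rF; rewrite inE xr orbT.
  have [yU|Uy] := tF _ _ Fy FU.
    by exists U => // x; rewrite inE => /predU1P[->//|/rU].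
  exists (P y) => // x; rewrite inE => /predU1P[->//|/rU xU].
  exact: subset_trans xU Uy.
by exists U => // u /rcov[x /rU xU /xU].
Qed.

End RealSets.

Section Collapse.
Context {R : realType} {X : metricType R}.
Variable f : R -> X.
Hypothesis fc : continuous f.

(* Excising from [0, 1] a maximal open set all of whose gaps have end points with
   equal images leaves a closed set on which [f] identifies only the end points
   of gaps. *)
Definition collapsible (U : set R) :=
  [/\ open U, ~ U 0, ~ U 1 & forall s t : R, 0 <= s -> s < t -> t <= 1 -> ~ U s -> ~ U t ->
      (forall u : R, s < u < t -> U u) -> f s = f t].

(** Let ]s, t[ be a gap of the union. A single member covers [s + r, t - r]; its gap around this
    segment has end points within [r] of [s] and [t], with equal images. Then [r] tends to 0. *)
Lemma collapsible_bigcup (F : set (set R)) : F `<=` collapsible ->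
  total_on F subset -> collapsible (\bigcup_(U in F) U).
Proof.
move=> Fc tF; split.
- by apply: bigcup_open => U /Fc[].
- by move=> [U /Fc[]].
- by move=> [U /Fc[]].
move=> s t s0 st t1 ns nt cov; apply: mdist_lt_eq => e e0.
have e2 : 0 < e / 2 by rewrite divr_gt0.
have [d d0 hd] := (continuous_realP f).1 fc s _ e2.
have [d' d'0 hd'] := (continuous_realP f).1 fc t _ e2.
pose r := Num.min (Num.min d d') (t - s) / 3.
have r0 : 0 < r by rewrite divr_gt0// !lt_min d0 d'0 subr_gt0.
have [rd rd' rt] : [/\ r * 3 <= d, r * 3 <= d' & r * 3 <= t - s].
  by rewrite /r divfK//; split; rewrite !ge_min lexx ?orbT.
have [|||U FU hU] := @chain_segment R F (s + r) (t - r) _ _ tF.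
- lra.
- by move=> U /Fc[].
- move=> u ut; have [|U FU Uu] := cov u; last by exists U.
  apply/andP; lra.
have [oU _ _ gU] := Fc _ FU.
have nUs : ~ U s by move=> Us; apply: ns; exists U.
have nUt : ~ U t by move=> Ut; apply: nt; exists U.
have cU : closed (~` U) by exact: open_closedC.
have [|m [nm sm mr hm]] := closed_max cU nUs (_ : s <= s + r); first lra.
have [|m' [nm' mt' mr' hm']] := closed_min cU nUt (_ : t - r <= t); first lra.
have fm : f m = f m'.
  apply: gU => //; [lra|lra|lra|] => u /andP[mu um].
  apply: contrapT => nu; have [us|us] := leP u (s + r).
    by have := hm u nu us; lra.
  have [ut|ut] := leP (t - r) u; first by have := hm' u nu ut; lra.
  by apply: nu; apply: hU; apply/andP; split; lra.
rewrite (le_trans (metric_triangle _ (f m) _))// [leRHS]splitr lerD//.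
  by apply/ltW/hd; rewrite ger0_norm; lra.
rewrite fm metric_sym; apply/ltW/hd'; rewrite ler0_norm; lra.
Qed.

(** If [f s = f t] with [s] and [t] outside a maximal [U], adding ]s, t[ keeps it collapsible: the
    only new gap is ]s, t[ itself. *)
Lemma collapsible_max : exists2 U, collapsible U & forall s t : R,
  0 <= s -> s < t -> t <= 1 -> ~ U s -> ~ U t -> f s = f t -> forall u : R, s < u < t -> U u.
Proof.
have [U [cU mU]] := Zorn_bigcup collapsible_bigcup.
exists U => // s t s0 st t1 ns nt fst u ut; apply: contrapT => nu.
have [oU U0 U1 gU] := cU.
apply: (mU (U `|` [set v | s < v < t])).
  split; first by move=> v; left.
  by move=> h; apply: nu; apply: h; right.
split.
- apply: openU => //.
  rewrite (_ : [set v | s < v < t] = [set` `]s, t[]); first exact: interval_open.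
  by apply/seteqP; split=> v; rewrite /= in_itv.
- by case=> //= /andP[]; lra.
- by case=> //= /andP[]; lra.
move=> s1 t1' s10 st1 t11 /not_orP[ns1 is1] /not_orP[nt1 it1] h.
have [h'|] := pselect (forall v, s1 < v < t1' -> U v); first exact: gU.
move=> /existsNP[v /not_implyP[/andP[v1 v2] nv]].
have [|//|/andP[v3 v4]] := h v; first by rewrite v1.
have e1 : s1 = s.
  apply/eqP; rewrite eq_le; apply/andP; split; rewrite leNgt; apply/negP => ss.
    by apply: is1; apply/andP; split; lra.
  by have [||/andP[]] := h s => //; [apply/andP; split; lra|rewrite ltxx].
have e2 : t1' = t.
  apply/eqP; rewrite eq_le; apply/andP; split; rewrite leNgt; apply/negP => ss.
    by have [||/andP[]] := h t => //; [apply/andP; split; lra|rewrite ltxx].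
  by apply: it1; apply/andP; split; lra.
by rewrite e1 e2.
Qed.

End Collapse.

Section Reparam.
Context {R : realType} {X : metricType R}.
Variable f : R -> X.
Hypothesis fc : continuous f.
Variable K : set R.
Hypothesis Kclosed : closed K.
Hypothesis K01 : forall t, K t -> 0 <= t <= 1.
Hypothesis K0 : K 0.
Hypothesis K1 : K 1.
Hypothesis Kgap : forall s t, K s -> K t -> s < t ->
  (f s = f t <-> forall u, K u -> ~ (s < u < t)).

(* [level t] is the sum of 2^-(n+1) sup_(s <= t) bump_n (f s) over a countable
   family of bump functions separating points; it is monotone on [K] and constant
   exactly across gaps, so inverting it turns [f] into an injective path. *)
Let bump (n : nat) (x : X) : R :=
  if unpickle n is Some (q, r) then
    Num.max 0 (Num.min 1 (ratr r - mdist x (f (ratr (q : rat))))) else 0.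

Let bump_ge0 n x : 0 <= bump n x.
Proof. by rewrite /bump; case: unpickle => [[q r]|]//; rewrite le_max lexx. Qed.

Let bump_le1 n x : bump n x <= 1.
Proof.
by rewrite /bump; case: unpickle => [[q r]|]//; rewrite ge_max ler01 ge_min lexx.
Qed.

Let bump_lip n x y : bump n x <= bump n y + mdist x y.
Proof.
rewrite /bump; case: unpickle => [[q r]|]; last by rewrite add0r mdist_ge0.
have := metric_triangle y x (f (ratr q)); have := mdist_ge0 x y.
rewrite (metric_sym y x); move: (mdist _ _) (mdist _ _) (mdist _ _) => a b c a0 h.
rewrite ge_max; apply/andP; split.
  by rewrite (le_trans a0)// lerDr le_max lexx.
by rewrite -lerBlDr le_max; apply/orP; right; rewrite le_min; apply/andP; split;
  rewrite lerBlDr ge_min; apply/orP; [left|right]; lra.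
Qed.

Let prefix (n : nat) (t : R) : set R := [set bump n (f s) | s in [set s | K s /\ s <= t]].

Let height n t := sup (prefix n t).

Let prefix_ub n t : has_ubound (prefix n t).
Proof. by exists 1 => _ [s _ <-]; exact: bump_le1. Qed.

Let height_ge n t s : K s -> s <= t -> bump n (f s) <= height n t.
Proof. by move=> Ks st; apply: ub_le_sup => //; exists s. Qed.

Let height_le n t (m : R) : K t -> (forall s, K s -> s <= t -> bump n (f s) <= m) ->
  height n t <= m.
Proof.
move=> Kt h; apply: ge_sup; first by exists (bump n (f t)); exists t.
by move=> _ [s [Ks st] <-]; exact: h.
Qed.

Let height_mono n s t : K s -> s <= t -> height n s <= height n t.
Proof.
by move=> Ks st; apply: height_le => // u Ku us; apply: height_ge => //; exact: le_trans us st.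
Qed.

Let height01 n t : K t -> 0 <= height n t <= 1.
Proof.
move=> Kt; apply/andP; split; first by apply: le_trans (height_ge n Kt (lexx t)).
by apply: height_le => // s _ _; exact: bump_le1.
Qed.

Let height_cont n t (e : R) : K t -> 0 < e -> exists2 d : R, 0 < d &
  forall s, K s -> `|s - t| < d -> `|height n s - height n t| <= e.
Proof.
move=> Kt e0; have e2 : 0 < e / 2 by rewrite divr_gt0.
have [d d0 hd] := (continuous_realP f).1 fc t _ e2.
exists d => // s Ks; rewrite ltr_norml => /andP[sd1 sd2].
have near_t u : `|u - t| < d -> bump n (f u) <= bump n (f t) + e / 2.
  by move=> /hd/ltW h; rewrite (le_trans (bump_lip n _ (f t)))// lerD2l metric_sym.
have near_s u : `|u - t| < d -> bump n (f t) <= bump n (f u) + e / 2.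
  by move=> /hd/ltW h; rewrite (le_trans (bump_lip n _ (f u)))// lerD2l.
have [ts|st] := leP t s.
  rewrite ger0_norm ?subr_ge0 ?height_mono// lerBlDl.
  apply: height_le => // u Ku us; have [ut|tu] := leP u t.
    by rewrite (le_trans (height_ge n Ku ut))// lerDl ltW.
  rewrite (le_trans (near_t u _))//; first by rewrite ltr_norml; lra.
  by apply: lerD; [exact: height_ge|lra].
have hst := height_mono n Ks (ltW st).
rewrite ler0_norm ?subr_le0// opprB lerBlDl.
apply: height_le => // u Ku ut; have [us|su] := leP u s.
  by rewrite (le_trans (height_ge n Ku us))// lerDl ltW.
rewrite (le_trans (near_t u _))//; first by rewrite ltr_norml; lra.
have h : bump n (f t) <= bump n (f s) + e / 2 by apply: near_s; rewrite ltr_norml; lra.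
have := height_ge n Ks (lexx s); lra.
Qed.

Let part N t : R := \sum_(n < N) height n t / 2 ^+ n.+1.

Let level t := sup (range (part^~ t)).

Let part_le N M t : K t -> (N <= M)%N -> part N t <= part M t <= part N t + 2^-1 ^+ N.
Proof.
move=> Kt /subnKC <-; move: (M - N)%N => j {M}.
(* The exact geometric tail is what the induction on [j] can carry. *)
suff : part N t <= part (N + j) t <= part N t + 2^-1 ^+ N - 2^-1 ^+ (N + j).
  move=> /andP[-> h]; rewrite (le_trans h)// gerBl exprn_ge0//.
elim: j => [|j /andP[h1 h2]]; first by rewrite addn0 addrK lexx.
rewrite addnS /part big_ord_recr /= -/(part _ _).
have /andP[g0 g1] := height01 (N + j) Kt.
have p0 : 0 < 2^-1 ^+ (N + j) :> R by rewrite exprn_gt0.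
have eq : (2 ^+ (N + j).+1)^-1 = 2^-1 * 2^-1 ^+ (N + j) :> R by rewrite -exprVn exprS.
rewrite eq [2^-1 ^+ (N + j).+1]exprS.
have : 0 <= height (N + j) t * (2^-1 * 2^-1 ^+ (N + j)) <= 2^-1 * 2^-1 ^+ (N + j).
  by rewrite mulr_ge0 ?mulr_ge0 ?(ltW p0)//= ler_piMl// mulr_ge0 ?(ltW p0).
rewrite -/(part N t) in h1 h2 *; rewrite -/(part (N + j) t); lra.
Qed.

Let level_bounds N t : K t -> part N t <= level t <= part N t + 2^-1 ^+ N.
Proof.
move=> Kt.
have ub : ubound (range (part^~ t)) (part N t + 2^-1 ^+ N).
  move=> _ [M _ <-]; have [NM|/ltnW MN] := leqP N M; first by have /andP[] := part_le Kt NM.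
  have /andP[h _] := part_le Kt MN; rewrite (le_trans h)// lerDl exprn_ge0//.
apply/andP; split; last by apply: ge_sup => //; exists (part 0 t); exists 0%N.
by apply: ub_le_sup; [exists (part N t + 2^-1 ^+ N)|exists N].
Qed.

Let level_mono s t : K s -> K t -> s <= t -> level s <= level t.
Proof.
move=> Ks Kt st; apply: ge_sup; first by exists (part 0 s); exists 0%N.
move=> _ [N _ <-]; have /andP[h _] := level_bounds N Kt; apply: le_trans h.
by apply: ler_sum => n _; rewrite ler_pM2r ?invr_gt0 ?exprn_gt0// height_mono.
Qed.

(** Every partial sum that includes the [n]-th term gains at least the increase of this term, and so
    does the supremum. *)
Let level_lt s t n : K s -> K t -> s <= t -> height n s < height n t -> level s < level t.
Proof.
move=> Ks Kt st hn; pose d := (height n t - height n s) / 2 ^+ n.+1.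
have d0 : 0 < d by rewrite divr_gt0 ?subr_gt0 ?exprn_gt0.
suff : level s <= level t - d by lra.
apply: ge_sup; first by exists (part 0 s); exists 0%N.
move=> _ [N _ <-]; have /andP[h _] := part_le Ks (leq_addr n.+1 N).
apply: (le_trans h); rewrite lerBrDr.
have /andP[h' _] := level_bounds (N + n.+1) Kt; apply: le_trans h'.
have nN : (n < N + n.+1)%N by rewrite addnS ltnS leq_addl.
rewrite /part (bigD1 (Ordinal nN))//= [leRHS](bigD1 (Ordinal nN))//=.
rewrite /d mulrBl addrAC [_ / _ + _]addrC subrK lerD2l.
by apply: ler_sum => i _; rewrite ler_pM2r ?invr_gt0 ?exprn_gt0// height_mono.
Qed.

Let level_eq s t : K s -> K t -> s < t -> f s = f t -> level s = level t.
Proof.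
move=> Ks Kt st fst; suff h n : height n s = height n t.
  have hp : part^~ t = part^~ s by apply/funext => N; apply: eq_bigr => n _; rewrite h.
  by rewrite /level hp.
apply/eqP; rewrite eq_le height_mono//= ?(ltW st)//.
apply: height_le => // u Ku ut; have [us|su] := leP u s; first exact: height_ge.
have /eqP -> : u == t.
  rewrite eq_le ut leNgt; apply/negP => ut'.
  by apply: ((Kgap Ks Kt st).1 fst u Ku); rewrite su.
by rewrite -fst; apply: height_ge.
Qed.

Let Kcompact : compact K.
Proof.
rewrite (_ : K = [set` `[0, 1]] `&` K).
  exact: (compact_closedI (@segment_compact R 0 1) Kclosed).
by apply/seteqP; split=> [t Kt|t []//]; split => //=; rewrite in_itv /= K01.
Qed.

(** Otherwise points of [K] up to [s] with images tending to [f t] cluster at some [p] with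
    [f p = f t]. As p differs from s, the point [s] of [K] lies strictly between [p] and [t],
    against the gap condition. *)
Let far s t : K s -> K t -> s < t -> f s <> f t ->
  exists2 r : R, 0 < r & forall u, K u -> u <= s -> r <= mdist (f t) (f u).
Proof.
move=> Ks Kt st fst; apply: contrapT => nr.
have H (n : nat) : {u | (K u /\ u <= s) /\ mdist (f t) (f u) < n.+1%:R^-1}.
  apply: cid; apply: contrapT => nu; apply: nr; exists n.+1%:R^-1 => // u Ku us.
  by rewrite leNgt; apply/negP => h; apply: nu; exists u.
have [p Kp hp] := @compact_seq_cluster R R^o K (fun n => sval (H n)) Kcompact
  (fun n => (svalP (H n)).1.1).
have fpt : f t = f p.
  apply: mdist_lt_eq => e e0; have e2 : 0 < e / 2 by rewrite divr_gt0.
  have [d d0 hd] := (continuous_realP f).1 fc p _ e2.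
  have [n Nn hn] := hp d (Num.truncn (e / 2)^-1) d0.
  rewrite (le_trans (metric_triangle _ (f (sval (H n))) _))// [leRHS]splitr lerD//.
    rewrite ltW// (lt_le_trans (svalP (H n)).2)// invf_ple ?posrE//.
    rewrite (le_trans (ltW (truncnS_gt _)))// ler_nat ltnS//.
  by rewrite metric_sym; apply/ltW/hd.
have ps : p <= s.
  apply/ler_addgt0Pl => e e0; have [n _ hn] := hp e 0%N e0.
  have := (svalP (H n)).1.2; move: hn; rewrite /mdist /= ltr_norml; lra.
move: ps; rewrite le_eqVlt => /predU1P[ps|ps]; first by case: fst; rewrite fpt ps.
have pt := lt_trans ps st.
by apply: ((Kgap Kp Kt pt).1 (esym fpt) s Ks); rewrite ps.
Qed.

(** A bump centred at [f q] close to [f t], with [q] rational and a rational radius between r/3 and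
    2r/3, is positive at [f t] and vanishes at all [f u] with [u <= s]. *)
Let level_strict s t : K s -> K t -> s < t -> f s <> f t -> level s < level t.
Proof.
move=> Ks Kt st fst; have [r r0 hr] := far Ks Kt st fst.
have r3 : 0 < r / 3 by rewrite divr_gt0.
have [d d0 hd] := (continuous_realP f).1 fc t _ r3.
have /rat_in_itvoo [q] : t - d < t + d by lra.
rewrite in_itv /= => /andP[q1 q2].
have /rat_in_itvoo [rho] : r / 3 < 2 * r / 3 by lra.
rewrite in_itv /= => /andP[rho1 rho2].
have fq : mdist (f t) (f (ratr q)) < r / 3.
  by apply: hd; rewrite ltr_norml; apply/andP; split; lra.
apply: (@level_lt _ _ (pickle (q, rho))) => //; first exact: ltW.
apply: (@le_lt_trans _ _ 0).
  apply: height_le => // u Ku us; rewrite /bump pickleK ge_max lexx /= ge_min.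
  apply/orP; right; have := hr u Ku us; have := metric_triangle (f t) (f (ratr q)) (f u).
  rewrite (metric_sym (f (ratr q))); lra.
apply: lt_le_trans (height_ge _ Kt (lexx t)).
rewrite /bump pickleK lt_max lt_min ltr01 /=; apply/orP; right; lra.
Qed.

Let half_small (e : R) : 0 < e -> exists N, 2^-1 ^+ N < e.
Proof.
move=> e0; exists (Num.truncn e^-1).+1; rewrite exprVn invf_plt ?posrE ?exprn_gt0//.
rewrite (lt_trans (truncnS_gt _))// -natrX ltr_nat; exact: ltn_expl.
Qed.

Let part_cont N t (e : R) : K t -> 0 < e -> exists2 d : R, 0 < d &
  forall s, K s -> `|s - t| < d -> `|part N s - part N t| <= e.
Proof.
move=> Kt; elim: N e => [|N IH] e e0.
  by exists 1 => // s _ _; rewrite /part !big_ord0 subrr normr0 ltW.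
have e2 : 0 < e / 2 by rewrite divr_gt0.
have [d d0 hd] := IH _ e2; have [d' d'0 hd'] := @height_cont N _ _ Kt e2.
exists (Num.min d d'); first by rewrite lt_min d0.
move=> s Ks; rewrite lt_min => /andP[/(hd s Ks) h1 /(hd' s Ks) h2].
rewrite /part !big_ord_recr /= -!/(part _ _) opprD addrACA -mulrBl.
rewrite (le_trans (ler_normD _ _))// [leRHS]splitr lerD//.
rewrite normrM (le_trans _ h2)// ler_piMr// normfV ger0_norm ?exprn_ge0//.
by rewrite invf_le1 ?exprn_gt0// exprn_ege1// ler1n.
Qed.

Let level_cont t (e : R) : K t -> 0 < e -> exists2 d : R, 0 < d &
  forall s, K s -> `|s - t| < d -> `|level s - level t| < e.
Proof.
move=> Kt e0; have e3 : 0 < e / 3 by rewrite divr_gt0.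
have [N hN] := half_small e3; have [d d0 hd] := part_cont N Kt e3.
exists d => // s Ks /(hd s Ks); rewrite ler_norml ltr_norml => /andP[h1 h2].
have /andP[h3 h4] := level_bounds N Ks; have /andP[h5 h6] := level_bounds N Kt.
lra.
Qed.

(** Take the last point [m] of level at most [v] and the next point [m'] of level at least [v]. If
    the level of [m] were below [v], no point of [K] would lie between them, so their images, hence
    their levels, would agree. *)
Let level_onto v : level 0 <= v <= level 1 -> exists2 t, K t & level t = v.
Proof.
move=> /andP[v0 v1]; pose A := [set t | K t /\ level t <= v].
have cA : closed A.
  apply/(@closed_mdistP R R^o) => t ht.
  have Kt : K t.
    apply: ((@closed_mdistP R R^o K).1 Kclosed t) => e /ht[y [Ky _] yt].
    by exists y.
  split => //; apply/ler_addgt0Pl => e e0; have [d d0 hd] := level_cont Kt e0.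
  have [y [Ky yv] yt] := ht d d0; have := hd y Ky yt; rewrite ltr_norml; lra.
have [|m [[Km mv] m0 m1 hm]] := @closed_max _ A 0 1 cA _ ler01; first by [].
exists m => //; move: mv; rewrite le_eqVlt => /predU1P[//|mv]; exfalso.
pose B := [set t | K t /\ v <= level t].
have cB : closed B.
  apply/(@closed_mdistP R R^o) => t ht.
  have Kt : K t.
    apply: ((@closed_mdistP R R^o K).1 Kclosed t) => e /ht[y [Ky _] yt].
    by exists y.
  split => //; apply/ler_addgt0Pl => e e0; have [d d0 hd] := level_cont Kt e0.
  have [y [Ky yv] yt] := ht d d0; have := hd y Ky yt; rewrite ltr_norml; lra.
have [|m' [[Km' m'v] m'0 m'1 hm']] := @closed_min _ B 1 m cB _ m1; first by [].
have mm' : m < m'.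
  rewrite lt_neqAle m'1 andbT; apply/eqP => e; move: m'v; rewrite -e; lra.
suff e : f m = f m' by have := level_eq Km Km' mm' e; lra.
apply/(Kgap Km Km' mm') => u Ku /andP[mu um].
have /andP[u0 u1] := K01 Ku.
have [uv|vu] := leP (level u) v; first by have := hm u (conj Ku uv) u1; lra.
by have := hm' u (conj Ku (ltW vu)) (ltW mu); lra.
Qed.

(** On [K] the value of [f] depends only on the level, by [level_strict]; compactness of [K] makes
    the dependence continuous. *)
Let level_inv t (e : R) : K t -> 0 < e -> exists2 d : R, 0 < d &
  forall s, K s -> `|level s - level t| < d -> mdist (f t) (f s) < e.
Proof.
move=> Kt e0; apply: contrapT => nd.
have H (n : nat) : {u | (K u /\ e <= mdist (f t) (f u)) /\ `|level u - level t| < n.+1%:R^-1}.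
  apply: cid; apply: contrapT => nu; apply: nd; exists n.+1%:R^-1 => // u Ku us.
  by rewrite ltNge; apply/negP => h; apply: nu; exists u.
have [p Kp hp] := @compact_seq_cluster R R^o K (fun n => sval (H n)) Kcompact
  (fun n => (svalP (H n)).1.1).
have lp : level p = level t.
  apply/eqP; rewrite -subr_eq0 -normr_le0; apply/ler_addgt0Pl => a a0; rewrite addr0.
  have a2 : 0 < a / 2 by rewrite divr_gt0.
  have [d d0 hd] := level_cont Kp a2.
  have [n Nn hn] := hp d (Num.truncn (a / 2)^-1) d0.
  have h1 := hd _ (svalP (H n)).1.1 hn.
  have h2 : `|level (sval (H n)) - level t| < a / 2.
    rewrite (lt_le_trans (svalP (H n)).2)// invf_ple ?posrE//.
    by rewrite (le_trans (ltW (truncnS_gt _)))// ler_nat ltnS.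
  rewrite distrC in h1; move: h1 h2; rewrite !ltr_norml ler_norml; lra.
have fp : f p = f t.
  have [pt|tp|->//] := ltgtP p t; apply: contrapT => fpt.
    by have := level_strict Kp Kt pt fpt; lra.
  by have := level_strict Kt Kp tp (nesym fpt); lra.
have [d d0 hd] := (continuous_realP f).1 fc p _ e0.
have [n _ hn] := hp d 0%N d0.
have := hd _ hn; rewrite fp; have := (svalP (H n)).1.2; lra.
Qed.

Lemma reparametrize : f 0 <> f 1 -> exists g : R -> X,
  [/\ continuous g, {in `[0, 1] &, injective g}, g 0 = f 0, g 1 = f 1 &
      forall v, exists2 t, K t & g v = f t].
Proof.
move=> f01; have l01 := level_strict K0 K1 ltr01 f01.
pose L := level 1 - level 0; have L0 : 0 < L by rewrite subr_gt0.
pose cl (t : R) := Num.max 0 (Num.min t 1).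
have cl01 t : 0 <= cl t <= 1 by rewrite /cl le_max lexx ge_max ler01 ge_min lexx orbT.
have clid t : 0 <= t <= 1 -> cl t = t.
  by move=> /andP[t0 t1]; rewrite /cl (min_idPl _)//; apply/max_idPr.
have cll s t : `|cl s - cl t| <= `|s - t|.
  have h1 := ler_norm (s - t); have h2 := ler_norm (t - s); have h3 := normr_ge0 (s - t).
  rewrite distrC in h2; rewrite ler_norml /cl /Order.max /Order.min.
  by case: (ltP s 1) => ?; case: (ltP t 1) => ?; rewrite ?ltr01;
     case: (ltP 0 s) => ?; case: (ltP 0 t) => ?; apply/andP; split; lra.
have H v : {t | K t /\ level t = level 0 + L * cl v}.
  apply: cid; have /andP[c0 c1] := cl01 v.
  have [|t Kt e] := @level_onto (level 0 + L * cl v); last by exists t.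
  by rewrite lerDl mulr_ge0 ?(ltW L0)//= -lerBrDl ler_piMr// ltW.
pose g v := f (sval (H v)).
have gE v t : K t -> level t = level 0 + L * cl v -> g v = f t.
  move=> Kt e; have [Ks es0] := svalP (H v); rewrite /g.
  have es : level (sval (H v)) = level t by rewrite es0 e.
  have [st|ts|->//] := ltgtP (sval (H v)) t; apply: contrapT => fst.
    by have := level_strict Ks Kt st fst; lra.
  by have := level_strict Kt Ks ts (nesym fst); lra.
exists g; split.
- apply/continuous_realP => v e e0; have [Kv ev] := svalP (H v).
  have [d d0 hd] := level_inv Kv e0.
  exists (d / L); first by rewrite divr_gt0.
  move=> w; rewrite ltr_pdivlMr// => h; have [Kw ew] := svalP (H w).
  apply: hd => //; rewrite ev ew addrAC opprD addrA subrr add0r addrC -mulrBr.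
  by rewrite normrM (gtr0_norm L0) mulrC (le_lt_trans _ h)// ler_pM2r.
- move=> v w; rewrite !in_itv /= => v01 w01 gvw.
  have [Kv ev] := svalP (H v); have [Kw ew] := svalP (H w).
  have : level (sval (H v)) = level (sval (H w)).
    have [st|ts|->//] := ltgtP (sval (H v)) (sval (H w)); first exact: level_eq.
    by apply/esym/level_eq.
  rewrite ev ew !clid// => /addrI/mulfI; apply.
  by rewrite gt_eqF.
- by apply: gE => //; rewrite clid ?lexx ?ler01// mulr0 addr0.
- by apply: gE => //; rewrite clid ?lexx ?ler01// mulr1 /L addrC subrK.
- by move=> v; exists (sval (H v)) => //; have [] := svalP (H v).
Qed.

End Reparam.

Section ArcOfPath.
Context {R : realType} {X : metricType R}.

Lemma arc_of_path (f : R -> X) : continuous f -> f 0 <> f 1 -> exists g : R -> X,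
  [/\ continuous g, {in `[0, 1] &, injective g}, g 0 = f 0, g 1 = f 1 &
      forall v, exists2 t, 0 <= t <= 1 & g v = f t].
Proof.
move=> fc f01; have [U [oU U0 U1 gU] mU] := collapsible_max fc.
pose K := [set` `[0 : R, 1]] `&` ~` U.
have K01 t : K t -> 0 <= t <= 1 by case=> /=; rewrite in_itv.
have [||||||g [? ? ? ? gK]] := @reparametrize R X f fc K => //.
- by apply: closedI; [exact: interval_closed|exact: open_closedC].
- by split => //=; rewrite in_itv /= lexx ler01.
- by split => //=; rewrite in_itv /= lexx ler01.
- move=> s t Ks Kt st; have /andP[s0 s1] := K01 _ Ks; have /andP[t0 t1] := K01 _ Kt.
  have [_ ns] := Ks; have [_ nt] := Kt; split=> [fst u [_ nu] sut|h].
    by apply: nu; apply: (mU s t).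
  apply: gU => // u /andP[su ut]; apply: contrapT => nu; apply: (h u).
    by split => //=; rewrite in_itv /=; apply/andP; split; lra.
  by rewrite su.
exists g; split => // v; have [t /K01 t01 e] := gK v; by exists t.
Qed.

End ArcOfPath.

(** * Uniqueness of arcs *)

Section Segments.
Context {R : realType} {X : metricType R}.
Implicit Types (a b c x y z : X) (A Y : set X) (f g : R -> X).

Definition arc_param (a b : X) (f : R -> X) :=
  [/\ continuous f, {in `[0, 1] &, injective f}, f 0 = a & f 1 = b].

Definition unit_seg : set R := [set u | 0 <= u <= 1].

Lemma unit_segE : [set` `[0, 1]] = unit_seg.
Proof. by apply/seteqP; split=> u; rewrite /= in_itv. Qed.

Lemma arc_param_inj a b f : arc_param a b f ->
  forall u v, 0 <= u <= 1 -> 0 <= v <= 1 -> f u = f v -> u = v.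
Proof. by case=> _ fi _ _ u v hu hv; apply: fi; rewrite in_itv. Qed.

Lemma arc_param_is_arc a b f : a <> b -> arc_param a b f -> is_arc a b (f @` unit_seg).
Proof.
move=> ab [fc fi f0 f1]; right; split => //; exists f; rewrite unit_segE; split => //.
exact: continuous_subspaceT.
Qed.

Lemma is_arc_param a b A : a <> b -> is_arc a b A ->
  exists2 f, arc_param a b f & A = f @` unit_seg.
Proof.
move=> ab [[]//|[_ [f [fc fi f0 f1 ->]]]].
pose cl (t : R) := Num.max 0 (Num.min t 1).
have cl01 t : 0 <= cl t <= 1 by rewrite /cl le_max lexx ge_max ler01 ge_min lexx orbT.
have clid t : 0 <= t <= 1 -> cl t = t.
  by move=> /andP[t0 t1]; rewrite /cl (min_idPl _)//; apply/max_idPr.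
have cll s t : `|cl s - cl t| <= `|s - t|.
  have h1 := ler_norm (s - t); have h2 := ler_norm (t - s); have h3 := normr_ge0 (s - t).
  rewrite distrC in h2; rewrite ler_norml /cl /Order.max /Order.min.
  by case: (ltP s 1) => ?; case: (ltP t 1) => ?; rewrite ?ltr01;
     case: (ltP 0 s) => ?; case: (ltP 0 t) => ?; apply/andP; split; lra.
exists (f \o cl); last first.
  rewrite unit_segE; apply/seteqP; split=> _ [u u01 <-]; exists u => //=; by rewrite clid.
split.
- apply/continuous_realP => t e e0.
  have [|d d0 hd] := (within_realP _ f).1 fc (cl t) e _ e0; first by rewrite unit_segE; exact: cl01.
  exists d => // s st; apply: hd; first by rewrite unit_segE; exact: cl01.
  exact: le_lt_trans (cll _ _) st.
- by move=> u v; rewrite !in_itv /= => hu hv /=; rewrite !clid// => /fi; apply; rewrite in_itv.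
- by rewrite /= clid ?lexx ?ler01.
- by rewrite /= clid ?lexx ?ler01.
Qed.

Lemma closed_preimage f Y : continuous f -> closed Y -> closed (f @^-1` Y).
Proof. by move=> fc cY; apply: closed_comp => // u _; exact: fc. Qed.

Lemma unit_image_compact f : continuous f -> compact (f @` unit_seg).
Proof.
move=> fc; apply: continuous_compact; first exact: continuous_subspaceT.
by rewrite -unit_segE; exact: segment_compact.
Qed.

Lemma compact_closed_metric A : compact A -> closed A.
Proof. by apply: compact_closed; exact: metric_hausdorff. Qed.

(** The abscissa parametrizes both closed half circles; [F] is drawn on the upper one, [G] on the
    lower one, and they agree at the abscissae -1 and 1 where the halves meet. *)
Lemma circle_glue (F G : R -> X) : continuous F -> continuous G ->
  F (- 1) = G (- 1) -> F 1 = G 1 ->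
  (forall u v : R, -1 <= u <= 1 -> -1 <= v <= 1 -> F u = F v -> u = v) ->
  (forall u v : R, -1 <= u <= 1 -> -1 <= v <= 1 -> G u = G v -> u = v) ->
  (forall u v : R, -1 <= u <= 1 -> -1 < v < 1 -> F u <> G v) ->
  has_simple_closed_curve [set: X].
Proof.
move=> Fc Gc e0 e1 Fi Gi FG.
pose h (p : R * R) := if 0 <= p.2 then F p.1 else G p.1.
have circ_bd (p : R * R) : circle p -> -1 <= p.1 <= 1.
  rewrite /circle /= => hp; have := sqr_ge0 p.2; rewrite -hp.
  by move=> h1; apply/andP; split; nra.
exists h; split; last split; last by [].
- pose up := @circle R `&` [set p : R * R | 0 <= p.2].
  pose dn := @circle R `&` [set p : R * R | p.2 <= 0].
  have -> : @circle R = up `|` dn.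
    apply/seteqP; split=> [p cp|p [[]|[]]//].
    by have [h1|/ltW h1] := leP 0 p.2; [left|right].
  have cc : closed (@circle R).
    rewrite (_ : @circle R = (fun p : R * R => p.1 * p.1 + p.2 * p.2) @^-1` [set 1])//.
    apply: closed_comp; last exact: closed_eq.
    by move=> p _; apply: cvgD; apply: cvgM; (exact: cvg_fst || exact: cvg_snd).
  apply: withinU_continuous.
  - apply: closedI => //; apply: (@closed_comp _ _ snd [set x : R | 0 <= x]); last exact: closed_ge.
    by move=> p _; exact: cvg_snd.
  - apply: closedI => //; apply: (@closed_comp _ _ snd [set x : R | x <= 0]); last exact: closed_le.
    by move=> p _; exact: cvg_snd.
  - apply: (@subspace_eq_continuous _ _ _ (F \o fst)).
      by move=> p; rewrite inE => -[_ /= hp]; rewrite /h /from_subspace /= hp.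
    apply: continuous_subspaceT => p; apply: continuous_comp; [exact: cvg_fst|exact: Fc].
  - apply: (@subspace_eq_continuous _ _ _ (G \o fst)).
      move=> p; rewrite inE => -[cp /= hp]; rewrite /h /from_subspace /=; case: ifP => // hp'.
      have p20 : p.2 = 0 by apply/eqP; rewrite eq_le hp hp'.
      have : p.1 ^+ 2 = 1 by move: cp; rewrite /circle /= p20 expr0n addr0.
      by move/eqP; rewrite sqrf_eq1 => /orP[]/eqP->.
    apply: continuous_subspaceT => p; apply: continuous_comp; [exact: cvg_fst|exact: Gc].
- have bd_lt (p : R * R) : circle p -> p.2 < 0 -> -1 < p.1 < 1.
    rewrite /circle /= => hp p2; have h2 : 0 < p.2 ^+ 2 by rewrite exprn_even_gt0//= lt_eqF.
    by have h1 : p.1 ^+ 2 < 1 by [lra]; apply/andP; split; nra.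
  move=> [p1 p2] [q1 q2]; rewrite !inE => cp cq; rewrite /h /=.
  have bp := circ_bd _ cp; have bq := circ_bd _ cq.
  have sq u v : 0 <= u -> 0 <= v -> u ^+ 2 = v ^+ 2 -> u = v :> R.
    by move=> u0 v0 /eqP; rewrite eqrXn2// => /eqP.
  move: (cp) (cq); rewrite /circle /= => ep eq.
  case: leP => hp; case: leP => hq.
  + move=> /(Fi _ _ bp bq) /= e; subst q1; congr (_, _); apply: sq => //.
    by apply: (@addrI _ (p1 ^+ 2)); rewrite ep eq.
  + by move=> /(FG _ _ bp (bd_lt _ cq hq)).
  + by move=> /esym/(FG _ _ bq (bd_lt _ cp hp)).
  + move=> /(Gi _ _ bp bq) /= e; subst q1; congr (_, _); apply: oppr_inj; apply: sq.
    * by rewrite oppr_ge0 ltW.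
    * by rewrite oppr_ge0 ltW.
    * by rewrite !sqrrN; apply: (@addrI _ (p1 ^+ 2)); rewrite ep eq.
Qed.

(** If [f t] is off the arc of [g], the stretch of [f] between the nearest hits of that arc before
    and after [t] closes up with the part of [g] between these hits to a simple closed curve. *)
Lemma arc_sub a b f g : ~ has_simple_closed_curve [set: X] -> a <> b ->
  arc_param a b f -> arc_param a b g -> f @` unit_seg `<=` g @` unit_seg.
Proof.
move=> nscc ab pf pg _ [t t01 <-]; apply: contrapT => nt; apply: nscc.
have [fc _ f0 f1] := pf; have [gc _ g0 g1] := pg.
set G := g @` unit_seg in nt.
have cA : closed (f @^-1` G).
  exact: (closed_preimage fc (compact_closed_metric (unit_image_compact gc))).
have /andP[t0 t1] := t01.
have [|s1 [[u1 u101 e1] s10 s1t h1]] := @closed_max _ _ 0 t cA _ t0.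
  by exists 0; [rewrite /unit_seg /= lexx ler01|rewrite f0].
have [|s2 [[u2 u201 e2] s21 ts2 h2]] := @closed_min _ _ 1 t cA _ t1.
  by exists 1; [rewrite /unit_seg /= lexx ler01|rewrite f1].
have s1t' : s1 < t.
  rewrite lt_neqAle s1t andbT; apply/eqP => e; apply: nt; rewrite -e; by exists u1.
have ts2' : t < s2.
  rewrite lt_neqAle ts2 andbT; apply/eqP => e; apply: nt; rewrite e; by exists u2.
have u12 : u1 != u2.
  apply/eqP => e; have : f s1 = f s2 by rewrite -e1 -e2 e.
  by move/(arc_param_inj pf); lra.
(* Carries [-1, 1] to the interval between [p] and [q] in either orientation, as [u1] may exceed
   [u2]. *)
pose aff (p q v : R) := p + (q - p) * ((v + 1) / 2).
have affc p q : continuous (aff p q).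
  move=> v; apply: cvgD; first exact: cvg_cst.
  apply: cvgM; first exact: cvg_cst.
  apply: cvgM; last exact: cvg_cst.
  by apply: cvgD; [exact: cvg_id|exact: cvg_cst].
have aff_bd (p q v : R) : 0 <= p <= 1 -> 0 <= q <= 1 -> -1 <= v <= 1 -> 0 <= aff p q v <= 1.
  by move=> hp hq hv; rewrite /aff; apply/andP; split; nra.
have aff_inj p q v w : p != q -> aff p q v = aff p q w -> v = w.
  rewrite -subr_eq0 => pq /addrI /mulfI e; have : (v + 1) / 2 = (w + 1) / 2.
    by apply: e; rewrite subr_eq0 eq_sym -subr_eq0.
  lra.
have s101 : 0 <= s1 <= 1 by lra.
have s201 : 0 <= s2 <= 1 by lra.
have u101' : 0 <= u1 <= 1 by [].
have u201' : 0 <= u2 <= 1 by [].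
have affl (p q : R) : aff p q (-1) = p by rewrite /aff; lra.
have affr p q : aff p q 1 = q by rewrite /aff; lra.
apply: (@circle_glue (f \o aff s1 s2) (g \o aff u1 u2)).
- by move=> v; apply: continuous_comp; [exact: affc|exact: fc].
- by move=> v; apply: continuous_comp; [exact: affc|exact: gc].
- by rewrite /= !affl.
- by rewrite /= !affr.
- move=> v w hv hw /(arc_param_inj pf (aff_bd _ _ _ s101 s201 hv) (aff_bd _ _ _ s101 s201 hw)).
  by apply: aff_inj; rewrite lt_eqF// (lt_trans s1t').
- move=> v w hv hw /(arc_param_inj pg (aff_bd _ _ _ u101 u201 hv) (aff_bd _ _ _ u101 u201 hw)).
  exact: aff_inj.
move=> v w hv hw /= e.
have hw' : -1 <= w <= 1 by lra.
have Gv : G (f (aff s1 s2 v)).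
  by rewrite e; exists (aff u1 u2 w) => //; exact: aff_bd.
have hb : s1 <= aff s1 s2 v <= s2 by rewrite /aff; apply/andP; split; nra.
have : aff s1 s2 v = s1 \/ aff s1 s2 v = s2.
  have [h|/ltW h] := leP (aff s1 s2 v) t.
    by left; have := h1 _ Gv h; lra.
  by right; have := h2 _ Gv h; lra.
case=> e'; rewrite e' in e.
  have /(arc_param_inj pg) : g u1 = g (aff u1 u2 w) by rewrite e1.
  move=> /(_ u101' (aff_bd _ _ _ u101 u201 hw')); rewrite -{1}(affl u1 u2).
  by move/(aff_inj _ _ _ _ u12); lra.
have /(arc_param_inj pg) : g u2 = g (aff u1 u2 w) by rewrite e2.
move=> /(_ u201' (aff_bd _ _ _ u101 u201 hw')); rewrite -{1}(affr u1 u2).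
by move/(aff_inj _ _ _ _ u12); lra.
Qed.

End Segments.

(** * The tree structure of a dendrite *)

Section Dendrite.
Context {R : realType} {X : metricType R}.
Implicit Types (a b c m x y z : X) (A U V Y : set X) (f g : R -> X).

Definition seg a b : set X := xget set0 [set A | is_arc a b A].

Definition convex Y := forall a b, Y a -> Y b -> seg a b `<=` Y.

Hypothesis D : is_dendrite [set: X].

Lemma is_arc_exists U a b : open U -> connected U -> U a -> U b ->
  exists2 A, is_arc a b A & A `<=` U.
Proof.
move=> oU cU Ua Ub; have [ab|ab] := pselect (a = b).
  by exists [set a]; [left|move=> _ ->].
have [_ cX _ lX _] := D.
have [f [fc f0 f1 fU]] := path_exists cX lX oU cU Ua Ub.
have [|g [gc gi g0 g1 gf]] := arc_of_path fc; first by rewrite f0 f1.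
exists (g @` unit_seg).
  by apply: arc_param_is_arc => //; split => //; rewrite ?g0 ?g1.
by move=> _ [v _ <-]; have [t t01 ->] := gf v; exact: fU.
Qed.

Lemma is_arc_unique a b A B : is_arc a b A -> is_arc a b B -> A = B.
Proof.
have [_ _ _ _ nscc] := D.
have [<-|ab] := pselect (a = b).
  by move=> [[_ ->]|[]//] [[_ ->]|[]//].
move=> /(is_arc_param ab)[f pf ->] /(is_arc_param ab)[g pg ->].
by apply/seteqP; split; exact: (arc_sub nscc ab).
Qed.

Lemma segP a b : is_arc a b (seg a b).
Proof.
have [_ _ cX _ _] := D.
have [||||A hA _] := @is_arc_exists [set: X] a b => //; first exact: openT.
exact: (@xgetPex _ set0 [set A | is_arc a b A] (ex_intro _ A hA)).
Qed.

Lemma segE a b A : is_arc a b A -> A = seg a b.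
Proof. by move=> hA; exact: is_arc_unique hA (segP a b). Qed.

Lemma seg_param a b : a <> b -> exists2 f, arc_param a b f & seg a b = f @` unit_seg.
Proof. by move=> ab; exact: is_arc_param (segP a b). Qed.

Lemma segxx a : seg a a = [set a].
Proof. by apply/esym/segE; left. Qed.

(** By uniqueness the arc drawn inside [U] is [seg a b], so open connected sets are convex. *)
Lemma seg_open U a b : open U -> connected U -> U a -> U b -> seg a b `<=` U.
Proof.
by move=> oU cU Ua Ub; have [A /segE <-] := is_arc_exists oU cU Ua Ub.
Qed.

Lemma seg_l a b : seg a b a.
Proof.
have [<-|ab] := pselect (a = b); first by rewrite segxx.
have [f [_ _ f0 _] ->] := seg_param ab.
by exists 0 => //; rewrite /unit_seg /= lexx ler01.
Qed.

Lemma seg_r a b : seg a b b.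
Proof.
have [<-|ab] := pselect (a = b); first by rewrite segxx.
have [f [_ _ _ f1] ->] := seg_param ab.
by exists 1 => //; rewrite /unit_seg /= lexx ler01.
Qed.

Lemma seg_sub_param a b f s t : arc_param a b f -> 0 <= s <= 1 -> 0 <= t <= 1 ->
  seg (f s) (f t) = f @` [set u | exists2 l, 0 <= l <= 1 & u = s + (t - s) * l].
Proof.
move=> pf hs ht; have [<-|st] := pselect (s = t).
  rewrite segxx; apply/seteqP; split=> [_ ->|_ [_ [l _ ->] <-]].
    by exists s => //; exists 0; rewrite ?lexx ?ler01// mulr0 addr0.
  by rewrite subrr mul0r addr0.
have fst : f s <> f t by move/(arc_param_inj pf hs ht).
have [fc _ _ _] := pf.
have ok l : 0 <= l <= 1 -> 0 <= s + (t - s) * l <= 1 by move=> hl; apply/andP; split; nra.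
rewrite -(segE (@arc_param_is_arc _ _ _ _ (fun l => f (s + (t - s) * l)) fst _)).
  apply/seteqP; split=> [_ [l hl <-]|_ [_ [l hl ->] <-]]; last by exists l.
  by exists (s + (t - s) * l) => //; exists l.
split.
- move=> l; apply: (@continuous_comp _ _ _ (fun l => s + (t - s) * l) f); last exact: fc.
  by apply: cvgD; [exact: cvg_cst|apply: cvgM; [exact: cvg_cst|exact: cvg_id]].
- move=> l m; rewrite !in_itv /= => hl hm /(arc_param_inj pf (ok _ hl) (ok _ hm)).
  by move=> /addrI/mulfI; apply; rewrite subr_eq0; apply/eqP/nesym.
- by rewrite mulr0 addr0.
- by rewrite mulr1 addrC subrK.
Qed.

Lemma segC a b : seg a b = seg b a.
Proof.
have [->//|ab] := pselect (a = b).
have [f pf _] := seg_param ab; have [_ _ f0 f1] := pf.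
have h0 : 0 <= (0 : R) <= 1 by rewrite lexx ler01.
have h1 : 0 <= (1 : R) <= 1 by rewrite lexx ler01.
have := seg_sub_param pf h0 h1; have := seg_sub_param pf h1 h0.
rewrite f0 f1 => -> ->; congr (f @` _); apply/seteqP.
by split=> _ [l hl ->]; exists (1 - l); lra.
Qed.

Lemma seg_split a b c : seg a b c ->
  seg a b = seg a c `|` seg c b /\ seg a c `&` seg c b = [set c].
Proof.
have [<-|ab] := pselect (a = b).
  by rewrite segxx => ->; rewrite segxx setUid setIid.
have [f pf ->] := seg_param ab => -[t ht <-].
have [_ _ f0 f1] := pf.
have h0 : 0 <= (0 : R) <= 1 by rewrite lexx ler01.
have h1 : 0 <= (1 : R) <= 1 by rewrite lexx ler01.
rewrite -{2}f0 -{2}f1 -{1}f0 -{1}f1 (seg_sub_param pf h0 ht) (seg_sub_param pf ht h1).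
have /andP[t0 t1] := ht.
have L u : (exists2 l, 0 <= l <= 1 & u = 0 + (t - 0) * l) <-> 0 <= u <= t.
  split=> [[l hl ->]|hu]; first by apply/andP; split; nra.
  have [e|tn] := eqVneq t 0; first by exists 0; lra.
  have tp : 0 < t by rewrite lt_neqAle eq_sym tn t0.
  exists (u / t); last by rewrite subr0 add0r mulrC divfK.
  by rewrite divr_ge0 ?ler_pdivrMr ?mul1r; lra.
have Rr u : (exists2 l, 0 <= l <= 1 & u = t + (1 - t) * l) <-> t <= u <= 1.
  split=> [[l hl ->]|hu]; first by apply/andP; split; nra.
  have [e|tn] := eqVneq t 1; first by exists 0; lra.
  have tp : 0 < 1 - t by rewrite subr_gt0 lt_neqAle tn t1.
  exists ((u - t) / (1 - t)); last by rewrite mulrC divfK ?gt_eqF// addrC subrK.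
  by apply/andP; split; [apply: divr_ge0; lra|rewrite ler_pdivrMr// mul1r; lra].
split; apply/seteqP; split.
- move=> _ [u hu <-]; rewrite /unit_seg /= in hu; have [ut|tu] := leP u t; [left|right]; exists u => //=.
    by apply/L; lra.
  by apply/Rr; lra.
- by move=> _ [[u /L hu <-]|[u /Rr hu <-]]; exists u => //; rewrite /unit_seg /=; lra.
- move=> _ [[u /L hu <-] [v /Rr hv]] => /(arc_param_inj pf) e.
  have vu : v = u by apply: e; lra.
  by congr f; lra.
- by move=> _ ->; split; exists t => //; [apply/L|apply/Rr]; lra.
Qed.

Lemma seg_cat a b c : seg a c `&` seg c b `<=` [set c] -> seg a b = seg a c `|` seg c b.
Proof.
have [<-|ac] := pselect (a = c).
  rewrite segxx => _; apply/esym/setUidPr => _ ->; exact: seg_l.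
have [<-|cb] := pselect (c = b).
  rewrite segxx => _; apply/esym/setUidPl => _ ->; exact: seg_r.
have [f pf ef] := seg_param ac; have [g pg eg] := seg_param cb.
rewrite ef eg => h; apply/esym/segE; right.
have [fc _ f0 f1] := pf; have [gc _ g0 g1] := pg.
have aff_c (p q : R) : continuous (fun u : R => p * u + q).
  by move=> u; apply: cvgD; [apply: cvgM; [exact: cvg_cst|exact: cvg_id]|exact: cvg_cst].
pose k (u : R) := if u <= 2^-1 then f (2 * u + 0) else g (2 * u + (-1)).
have kinj u v : 0 <= u <= 1 -> 0 <= v <= 1 -> k u = k v -> u = v.
  move=> hu hv; rewrite /k; case: leP => u2; case: leP => v2.
  - by move/(arc_param_inj pf) => e; have : 2 * u + 0 = 2 * v + 0 by [apply: e; lra]; lra.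
  - move=> e; have : (f @` unit_seg `&` g @` unit_seg) (f (2 * u + 0)).
      by split; [exists (2 * u + 0)|rewrite e; exists (2 * v + -1)] => //; rewrite /unit_seg /=; lra.
    move/h => /= ec; rewrite ec in e; rewrite -g0 in e.
    have : 0 = 2 * v + -1 by apply: (arc_param_inj pg) e; lra.
    lra.
  - move=> e; have : (f @` unit_seg `&` g @` unit_seg) (f (2 * v + 0)).
      by split; [exists (2 * v + 0)|rewrite -e; exists (2 * u + -1)] => //; rewrite /unit_seg /=; lra.
    move/h => /= ec; rewrite ec in e; rewrite -g0 in e.
    have : 2 * u + -1 = 0 by apply: (arc_param_inj pg) e; lra.
    lra.
  - by move/(arc_param_inj pg) => e; have : 2 * u + -1 = 2 * v + -1 by [apply: e; lra]; lra.
have k0 : k 0 = a by rewrite /k invr_ge0 ler0n mulr0 addr0.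
have k1 : k 1 = b.
  by rewrite /k ifF ?mulr1 -?g1; [congr g; lra|apply/negbTE; rewrite -ltNge; lra].
split.
  by move=> e; have : (0 : R) = 1 by [apply: kinj; rewrite ?lexx ?ler01// k0 k1]; lra.
exists k; rewrite unit_segE; split => //.
- rewrite (_ : unit_seg = [set u : R | 0 <= u <= 2^-1] `|` [set u : R | 2^-1 <= u <= 1]).
    apply: withinU_continuous.
    + rewrite (_ : mkset _ = [set` `[0, 2^-1]]); first exact: interval_closed.
      by apply/seteqP; split=> u; rewrite /= in_itv.
    + rewrite (_ : mkset _ = [set` `[2^-1, 1]]); first exact: interval_closed.
      by apply/seteqP; split=> u; rewrite /= in_itv.
    + apply: (@subspace_eq_continuous _ _ _ (f \o (fun u => 2 * u + 0))).
        by move=> u; rewrite inE /from_subspace /k /= => /andP[_ ->].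
      by apply: continuous_subspaceT => u; apply: continuous_comp; [exact: aff_c|exact: fc].
    + apply: (@subspace_eq_continuous _ _ _ (g \o (fun u => 2 * u + -1))).
        move=> u; rewrite inE /from_subspace /k /= => /andP[u2 _].
        case: leP => // u2'; have -> : u = 2^-1 by apply/eqP; rewrite eq_le u2 u2'.
        by rewrite mulfV// addr0 subrr g0 f1.
      by apply: continuous_subspaceT => u; apply: continuous_comp; [exact: aff_c|exact: gc].
  apply/seteqP; split=> u; rewrite /unit_seg /=.
    by move=> hu; have [h1|h1] := leP u 2^-1; [left|right]; lra.
  by case; lra.
- apply/seteqP; split.
    move=> _ [[u hu <-]|[u hu <-]]; rewrite /unit_seg /= in hu.
      exists (u / 2); first by rewrite /unit_seg /=; lra.
      by rewrite /k ifT; [congr f; lra|lra].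
    have [e|un] := eqVneq u 0.
      by exists 2^-1; [rewrite /unit_seg /=; lra|rewrite /k lexx e g0 -f1; congr f; lra].
    have up : 0 < u by rewrite lt_neqAle eq_sym un; lra.
    exists ((u + 1) / 2); first by rewrite /unit_seg /=; lra.
    by rewrite /k ifF; [congr g; lra|apply/negbTE; rewrite -ltNge; lra].
  move=> _ [u hu <-]; rewrite /unit_seg /= in hu; rewrite /k; case: leP => u2.
    by left; exists (2 * u + 0) => //; rewrite /unit_seg /=; lra.
  by right; exists (2 * u + -1) => //; rewrite /unit_seg /=; lra.
Qed.

Lemma seg_compact a b : compact (seg a b).
Proof.
have [<-|ab] := pselect (a = b); first by rewrite segxx; exact: compact_set1.
by have [f [fc _ _ _] ->] := seg_param ab; exact: unit_image_compact.
Qed.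

Lemma seg_closed a b : closed (seg a b).
Proof. exact: compact_closed_metric (@seg_compact a b). Qed.

Lemma seg_connected a b : connected (seg a b).
Proof.
have [<-|ab] := pselect (a = b); first by rewrite segxx; exact: connected1.
have [f [fc _ _ _] ->] := seg_param ab.
have h : connected (@unit_seg R) by rewrite -unit_segE; exact: segment_connected.
by apply: connected_continuous_connected h _; exact: continuous_subspaceT.
Qed.

Lemma seg_sub a b c : seg a b c -> seg a c `<=` seg a b.
Proof. by move=> /seg_split[-> _]; exact: subsetUl. Qed.

Lemma seg_subr a b c : seg a b c -> seg c b `<=` seg a b.
Proof. by move=> /seg_split[-> _]; exact: subsetUr. Qed.

Lemma seg_cases a b c x : seg a b c -> seg a b x -> seg a c x \/ seg c b x.
Proof. by move=> /seg_split[-> _] []; [left|right]. Qed.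

Lemma seg_meet a b c x : seg a b c -> seg a c x -> seg c b x -> x = c.
Proof.
move=> /seg_split[_ e] h1 h2; have : (seg a c `&` seg c b) x by [].
by rewrite e.
Qed.

Lemma seg_anti a b c : seg a b c -> seg c b a -> a = c.
Proof. by move=> h1 h2; apply: (seg_meet h1) h2; exact: seg_l. Qed.

Lemma gate_exists Y x y : closed Y -> Y y ->
  exists m, [/\ Y m, seg x y m & seg x m `&` Y = [set m]].
Proof.
move=> cY Yy; have [e|xy] := pselect (x = y).
  subst y; exists x; rewrite segxx; split => //.
  by apply/seteqP; split=> [_ [-> _]|_ ->].
have [f pf ef] := seg_param xy; have [fc _ f0 f1] := pf.
have [|t [Yt t1 t0 ht]] := closed_min (closed_preimage fc cY) _ ler01; first by rewrite /= f1.
have ht01 : 0 <= t <= 1 by lra.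
have h0 : 0 <= (0 : R) <= 1 by rewrite lexx ler01.
exists (f t); split => //; first by rewrite ef; exists t.
rewrite -f0 (seg_sub_param pf h0 ht01); apply/seteqP; split=> [_ [[u [l hl ->] <-] Yu]|_ ->].
  congr f; have := ht _ Yu; have -> : 0 + (t - 0) * l = t * l by ring.
  by move=> h; have := h ltac:(nra); nra.
split => //; exists t => //; exists 1; last by ring.
by rewrite lexx ler01.
Qed.

(** The median is the point at which the arc from [b] to [c] first meets [seg a c]. *)
Lemma median_exists a b c : exists m, [/\ seg a b m, seg b c m & seg a c m].
Proof.
have [m [m1 m2 m3]] := gate_exists b (@seg_closed a c) (seg_r a c).
exists m; split => //; rewrite (@seg_cat a b m); first by left; exact: seg_r.
by move=> x [h1 h2]; rewrite -m3; split; [rewrite segC|exact: seg_sub h1].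
Qed.

Lemma seg_tri a b c : seg a b `<=` seg a c `|` seg c b.
Proof.
have [m [m1 m2 m3]] := median_exists a b c.
move=> x /(seg_cases m1) [h|h]; first by left; exact: (seg_sub m3).
by right; rewrite segC; apply: (seg_sub m2); rewrite segC.
Qed.

Lemma median_unique a b c m m' : seg a b m -> seg b c m -> seg a c m ->
  seg a b m' -> seg b c m' -> seg a c m' -> m' = m.
Proof.
move=> m1 m2 m3 /(seg_cases m1) h1 /(seg_cases m2) h2 /(seg_cases m3) h3.
case: h1 h2 h3 => h1 [h2|h2] [h3|h3].
- by apply: (seg_meet m1) => //; rewrite segC.
- exact: (seg_meet m3).
- by apply: (seg_meet m3).
- exact: (seg_meet m3).
- exact: (seg_meet m1).
- by apply: (seg_meet m2) => //; rewrite segC.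
- by apply: (seg_meet m2) => //; rewrite segC.
- by apply: (seg_meet m2) => //; rewrite segC.
Qed.

Lemma seg_convex a b x y : seg a b x -> seg a b y -> seg x y `<=` seg a b.
Proof.
move=> hx hy; have [h|h] := seg_cases hx hy.
  by rewrite segC => z /(seg_subr h); exact: seg_sub.
by move=> z /(seg_sub h); exact: seg_subr.
Qed.

(* [seg o x y] reads y <= x in the tree order with root [o]. *)
Lemma tree_anti o x y : seg o y x -> seg o x y -> x = y.
Proof. by move=> h1 h2; apply/esym/(seg_meet h1) => //; exact: seg_r. Qed.

Lemma tree_trans o y x z : seg o y x -> seg o z y -> seg o z x.
Proof. by move=> h /seg_sub; exact. Qed.

Lemma tree_linear o z x y : seg o z x -> seg o z y -> seg o y x \/ seg o x y.
Proof.
move=> hx hy; have [|h1] := seg_cases hy hx; first by left.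
have [|h2] := seg_cases hx hy; first by right.
by left; rewrite (seg_anti h1 h2); exact: seg_r.
Qed.

Lemma median_meet o x y m w : seg o x m -> seg o y m -> seg x y m ->
  seg o x w -> seg o y w -> seg o m w.
Proof.
move=> m1 m3 m2 /(seg_cases m1)[|h1] // /(seg_cases m3)[|h2] //.
by rewrite (@seg_meet x y m w) //; [exact: seg_r|rewrite segC].
Qed.

Lemma seg_image (g : X -> X) a b : continuous g -> injective g -> g @` seg a b = seg (g a) (g b).
Proof.
move=> gc gi; have [<-|ab] := pselect (a = b).
  by rewrite !segxx image_set1.
have [f pf ->] := seg_param ab; have [fc fi f0 f1] := pf.
apply: segE; rewrite image_comp; apply: arc_param_is_arc; first by move/gi.
split; rewrite ?/comp ?f0 ?f1//.
- by move=> u; apply: continuous_comp; [exact: fc|exact: gc].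
- by move=> u v hu hv /gi; exact: fi.
Qed.

Lemma seg_map (g : X -> X) a b c : continuous g -> injective g -> seg a b c -> seg (g a) (g b) (g c).
Proof. by move=> gc gi h; rewrite -seg_image//; exists c. Qed.

Lemma convex_nbhd x U : open U -> U x -> exists V, [/\ open V, V x, V `<=` U, connected V & convex V].
Proof.
move=> oU Ux; have [_ _ _ lX _] := D.
have [V [oV Vx VU cV]] := lX x I U oU Ux; rewrite setIT in VU cV.
by exists V; split => // a b Va Vb; exact: seg_open.
Qed.

(** For [y] in a convex neighbourhood of [x] that misses [t], the arc [o, y] is contained in [o, x]
    and [x, y] together, and [x, y] misses [t]. *)
Lemma closed_up o t : closed [set x | seg o x t].
Proof.
rewrite -[X in closed X]setCK; apply: open_closedC.
apply/open_mdistP => x nx; have xt : x <> t by move=> e; apply: nx; rewrite e; exact: seg_r.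
have [||V [oV Vx Vt _ cV]] := @convex_nbhd x (~` [set t]) => //.
  by apply: closed_openC; exact: compact_closed_metric (@compact_set1 _ t).
have [e e0 eV] := (open_mdistP V).1 oV x Vx.
exists e => // y /eV Vy /= /(@seg_tri _ _ x)[//|h].
by have := Vt _ (cV _ _ Vx Vy _ h); apply.
Qed.

(** A component of the complement of [p] is open by local connectedness, hence convex, so it
    contains the arcs between its points. *)
Lemma component_seg p x y : p <> x -> p <> y ->
  connected_component (~` [set p]) x y <-> ~ seg x y p.
Proof.
move=> px py; have [_ _ _ lX _] := D.
have op : open (~` [set p]).
  by apply: closed_openC; exact: compact_closed_metric (@compact_set1 _ p).
split=> [h|h].
  suff oC : open (connected_component (~` [set p]) x).
    move=> hp; have : connected_component (~` [set p]) x p.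
      apply: seg_open hp => //; first exact: component_connected.
      by apply: connected_component_refl => /esym.
    by move/connected_component_sub; apply.
  rewrite openE => z hz; have zp := connected_component_sub hz.
  have [V [oV Vz VU cV]] := lX z I _ op zp; rewrite setIT in VU cV.
  have : V `<=` connected_component (~` [set p]) x.
    move=> w Vw; apply: connected_component_trans hz _; exists V => //; split => //.
  by move=> VC; exact: filterS VC (open_nbhs_nbhs (conj oV Vz)).
exists (seg x y); last exact: seg_r.
split; [exact: seg_l| |exact: seg_connected].
by move=> z hz e; apply: h; rewrite -e.
Qed.

End Dendrite.

(** * Heisenberg actions on dendrites *)

Section Flows.
Context {R : realType} {X : metricType R}.
Implicit Types (A E Z U V : int -> X -> X).

Record flow A : Prop := Flow {
  flow0 : forall p, A 0 p = p;
  flowD : forall x y p, A (x + y) p = A x (A y p);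
  flow_cont : forall x, continuous (A x) }.

(* The relations of an integral Heisenberg group acting through [A] and [E], with
   central part [Z] and commutator [A x, E y] = Z (k x y). *)
Record heis A E Z (k : int) : Prop := Heis {
  heis_l : flow A;
  heis_r : flow E;
  heis_c : flow Z;
  heis_cl : forall x y p, Z x (A y p) = A y (Z x p);
  heis_cr : forall x y p, Z x (E y p) = E y (Z x p);
  heis_rel : forall x y p, E y (A x p) = Z (k * x * y) (A x (E y p)) }.

Lemma flowK A x : flow A -> cancel (A x) (A (- x)).
Proof. by move=> fA p; rewrite -(flowD fA) addNr (flow0 fA). Qed.

Lemma flowVK A x : flow A -> cancel (A (- x)) (A x).
Proof. by move=> fA p; rewrite -(flowD fA) subrr (flow0 fA). Qed.

Lemma flow_inj A x : flow A -> injective (A x).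
Proof. by move=> fA; exact: can_inj (flowK x fA). Qed.

Lemma flow_fix A p : flow A -> A 1 p = p -> forall x, A x p = p.
Proof.
move=> fA h; have hn (n : nat) : A n%:Z p = p.
  by elim: n => [|n IH]; [exact: flow0|rewrite -addn1 PoszD (flowD fA) h].
case=> [n|n]; first exact: hn.
by rewrite NegzE; apply: (flow_inj (x := n.+1%:Z) fA); rewrite (flowVK _ fA) hn.
Qed.

Lemma heis_sym A E Z k : heis A E Z k -> heis E A Z (- k).
Proof.
case=> fA fE fZ ZA ZE rel; split => // x y p.
rewrite rel -(flowD fZ) (_ : _ + _ = 0) ?(flow0 fZ)//; ring.
Qed.

Hypothesis D : is_dendrite [set: X].

Lemma flow_seg A x p q r : flow A -> seg p q r -> seg (A x p) (A x q) (A x r).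
Proof. by move=> fA; apply: (seg_map D); [exact: flow_cont|exact: flow_inj]. Qed.

Lemma flow_segV A x p q r : flow A -> seg (A x p) (A x q) r -> seg p q (A (- x) r).
Proof. by move=> fA /(flow_seg (- x) fA); rewrite !(flowK _ fA). Qed.

(** The arc [o, p] is invariant, so [A 1] or its inverse moves [m] towards [o], unless [m] is
    fixed. *)
Lemma flow_sign A o p m : flow A -> A 1 o = o -> A 1 p = p -> seg o p m ->
  exists2 x : int, x = 1 \/ x = -1 & seg o m (A x m).
Proof.
move=> fA Ao Ap om; have om1 : seg o p (A 1 m).
  by rewrite -Ao -Ap; exact: flow_seg.
have [h|h] := tree_linear D om1 om; first by exists 1; [left|].
exists (-1); first by right.
by have := flow_seg (-1) fA h; rewrite (flow_fix fA Ao) (flowK _ fA).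
Qed.

Lemma heis_fix_c A E Z k x y o : heis A E Z k -> A 1 o = o -> E 1 o = o ->
  Z (k * x * y) o = o.
Proof.
move=> H Ao Eo; have := heis_rel H x y o.
by rewrite !(flow_fix (heis_l H) Ao, flow_fix (heis_r H) Eo).
Qed.

(** In the order rooted at [o], [E y] carries A (-x) m, which lies above [m] on the branch to [p],
    to a point [w] whose arc leaves [o, m] at [t], the image E y m strictly below [m]. By the
    Heisenberg relation, A x w = Z c t and w = Z c (A (-x) t) for one exponent c; as A x t <= t,
    also A x w <= w. So A x w and A x m both lie below [w] and are comparable; then so are [w] and
    [m], which is absurd. *)
Lemma heis_tripod_half A E Z k o p q m x y : heis A E Z k ->
  A 1 o = o -> E 1 o = o -> A 1 p = p -> E 1 q = q ->
  seg o p m -> seg o q m -> seg p q m ->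
  seg o m (A x m) -> seg o m (E y m) -> A x m <> m -> E y m <> m ->
  ~ seg o (E y m) (A x m).
Proof.
move=> H Ao Eo Ap Eq mp mq mpq ax ey an en ae.
have fA := heis_l H; have fE := heis_r H; have fZ := heis_c H.
have Ao' := flow_fix fA Ao; have Eo' := flow_fix fE Eo.
have Zo j l := heis_fix_c j l H Ao Eo.
set t := E y m in ey en ae *.
pose w := E y (A (- x) m).
have meet_m r : seg o p r -> seg o q r -> seg o m r by exact: median_meet.
have le_inv B z : flow B -> B 1 o = o -> seg o m (B z m) -> seg o (B (- z) m) m.
  move=> fB Bo h; rewrite -{1}(flow_fix fB Bo (- z)).
  by have := flow_seg (- z) fB h; rewrite (flowK _ fB).
have le_end B z s : flow B -> B 1 o = o -> B 1 s = s -> seg o s m -> seg o s (B z m).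
  by move=> fB Bo Bs h; rewrite -{1}(flow_fix fB Bo z) -(flow_fix fB Bs z); exact: flow_seg.
have tw : seg o w t.
  by rewrite /w /t -{1}(Eo' y); apply: flow_seg => //; exact: le_inv.
(* [E (- y)] takes [w] and [m] to points on the arcs from [o] to [p] and to [q], which part at [m];
   hence [w] and [m] have meet [t]. *)
have meet_t r : seg o w r -> seg o m r -> seg o t r.
  move=> wr mr; rewrite -(flowVK y fE r) /t -{1}(Eo' y); apply: flow_seg => //.
  apply: meet_m.
    apply: (tree_trans D) (le_end _ (- x) _ fA Ao Ap mp).
    by rewrite -{1}(Eo' (- y)); rewrite -{1}(flowK y fE (A (- x) m)); exact: flow_seg.
  apply: (tree_trans D) (le_end _ (- y) _ fE Eo Eq mq).
  by rewrite -{1}(Eo' (- y)); exact: flow_seg.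
have we : w = Z (- (k * x * y)) (A (- x) t).
  by rewrite /w (heis_rel H) mulrN mulNr.
have Aw : A x w = Z (- (k * x * y)) t.
  by rewrite we -(heis_cl H) (flowVK _ fA).
have Zo' : Z (- (k * x * y)) o = o by rewrite -mulNr -mulrN; exact: Zo.
have Aw_le : seg o w (A x w).
  have h : seg o t (A x t).
    by apply: (tree_trans D) ae; rewrite -{1}(Ao' x); exact: flow_seg.
  rewrite Aw we -{2}(flowK x fA t) -{1}Zo' -{1}(Ao' (- x)).
  by apply: flow_seg => //; exact: flow_seg.
have mt : A (- x) m <> m by move=> e; apply: an; rewrite -{1}e (flowVK _ fA).
have Aw_meet : seg o (A x m) (A x w) -> False.
  move=> h; have h1 : seg o t w.
    by apply: meet_t; [exact: seg_r|rewrite -(flowK x fA w) -(flowK x fA m)-{1}(Ao' (- x)); exact: flow_seg].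
  have /(flow_inj fE) := tree_anti D h1 tw; exact: mt.
have mt2 : seg o t m -> False by move=> h; apply: en; apply/esym/(tree_anti D h ey).
have [h|h] := tree_linear D Aw_le (tree_trans D ae tw); first exact: Aw_meet.
apply: mt2; apply: meet_t; last exact: seg_r.
by rewrite -(flowK x fA w) -(flowK x fA m) -{1}(Ao' (- x)); exact: flow_seg.
Qed.

Lemma heis_tripod A E Z k o p q m : heis A E Z k ->
  A 1 o = o -> E 1 o = o -> A 1 p = p -> E 1 q = q ->
  seg o p m -> seg o q m -> seg p q m -> A 1 m = m \/ E 1 m = m.
Proof.
move=> H Ao Eo Ap Eq mp mq mpq.
have fA := heis_l H; have fE := heis_r H.
have [x hx ax] := flow_sign fA Ao Ap mp.
have [y hy ey] := flow_sign fE Eo Eq mq.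
have one B z : flow B -> z = 1 \/ z = -1 -> B z m = m -> B 1 m = m.
  by move=> fB [->//|-> e]; rewrite -{1}e -(opprK 1) (flowVK _ fB).
have [/(one _ _ fA hx)|an] := pselect (A x m = m); first by left.
have [/(one _ _ fE hy)|en] := pselect (E y m = m); first by right.
have [h|h] := tree_linear D ax ey; exfalso.
  exact: (heis_tripod_half H Ao Eo Ap Eq mp mq mpq ax ey an en h).
by apply: (heis_tripod_half (heis_sym H) Eo Ao Eq Ap mq mp _ ey ax en an h); rewrite (segC D).
Qed.
Lemma flow_iter_le A o m j k : flow A -> A 1 o = o -> seg o m (A 1 m) ->
  (j <= k)%R -> seg o (A j m) (A k m).
Proof.
move=> fA Ao h jk; have [n ->] : exists n : nat, k = j + n%:Z.
  by exists (`|k - j|%N); rewrite gez0_abs ?subr_ge0//; ring.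
rewrite (flowD fA) -{1}(flow_fix fA Ao j); apply: flow_seg => //.
elim: n {jk k} => [|n IH]; first by rewrite (flow0 fA); exact: seg_r.
rewrite -addn1 PoszD; apply: (tree_trans D) _ IH.
by rewrite (flowD fA) -{1}(flow_fix fA Ao n%:Z); exact: flow_seg.
Qed.

Lemma flow_iter_fix A o m (i j : int) : flow A -> A 1 o = o -> seg o m (A 1 m) ->
  (i < j)%R -> seg o (A j m) (A i m) -> A 1 m = m.
Proof.
move=> fA Ao h ij hij.
have e : A i m = A j m.
  by apply: (tree_anti D) hij _; apply: flow_iter_le => //; exact: ltW.
have e1 : A (j - i) m = m by rewrite addrC (flowD fA) -e (flowK _ fA).
apply: (tree_anti D h).
by have := @flow_iter_le A o m 1 (j - i) fA Ao h; rewrite e1; apply; lia.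
Qed.

(** Displacements along the orbit of [m] are measured by the least such arc that contains a
    point. *)
Definition band A m (j : nat) : set X := seg (A j%:Z m) (A (- j%:Z) m).

Lemma band_mem A o m (i : int) (j : nat) : flow A -> A 1 o = o -> seg o m (A 1 m) ->
  (`|i| <= j%:Z)%R -> band A m j (A i m).
Proof.
move=> fA Ao h; rewrite ler_norml => /andP[i1 i2].
have h1 := flow_iter_le fA Ao h i2; have h2 := flow_iter_le fA Ao h i1.
have h3 := tree_trans D h1 h2.
by have [h4|] := seg_cases D h3 h2; first by rewrite -(tree_anti D h1 h4); exact: seg_l.
Qed.

(** As [H] commutes with [A], its bound of one step at [m] carries over to all iterates of [m], so
    each application of [H r] widens a band by one step. *)
Lemma band_shift A H o m (r : int) (n j : nat) z : flow A -> A 1 o = o ->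
  seg o m (A 1 m) -> flow H -> (forall x y p, H x (A y p) = A y (H x p)) ->
  band A m 1 (H r m) -> band A m j z -> band A m (j + n) (H (r * n%:Z) z).
Proof.
move=> fA Ao h fH HA Hm; elim: n j z => [|n IH] j z hz.
  by rewrite mulr0 (flow0 fH) addn0.
rewrite -addn1 PoszD mulrDr mulr1 (flowD fH) addnA addn1 -addn1.
have -> : (j + n + 1 = (j + 1) + n)%N by lia.
apply: IH; have := flow_seg r fH hz; rewrite !HA.
have ends (i : int) : (`|i| <= j%:Z)%R -> band A m (j + 1) (A i (H r m)).
  move=> hi; have := flow_seg i fA Hm; rewrite -!(flowD fA).
  by apply: (seg_convex D); apply: (band_mem fA Ao h);
    rewrite (le_trans (ler_normD _ _))// PoszD ?normrN ?normr1 ?lerD2r.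
by apply: (seg_convex D); apply: ends; rewrite ?normrN.
Qed.

Lemma heis_band A U V o m (k r s : int) : heis U V A k -> A 1 o = o ->
  seg o m (A 1 m) -> k * r * s != 0 ->
  band A m 1 (U r m) -> band A m 1 (U (- r) m) ->
  band A m 1 (V s m) -> band A m 1 (V (- s) m) -> A 1 m = m.
Proof.
move=> H Ao h krs Ur Ur' Vs Vs'.
have fU := heis_l H; have fV := heis_r H; have fA := heis_c H.
have cU x y p : U x (A y p) = A y (U x p) by rewrite (heis_cl H).
have cV x y p : V x (A y p) = A y (V x p) by rewrite (heis_cr H).
have hm : band A m 0 m by rewrite /band oppr0 (flow0 fA) (segxx D).
(* 5 is the least n with n^2 > 4n: the commutator of the fifth powers moves [m] by at most 20 steps
   of [A], but it is a power of [A] with exponent at least 25 in absolute value. *)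
have := band_shift 5 fA Ao h fU cU Ur hm.
move=> /(band_shift 5 fA Ao h fV cV Vs).
move=> /(band_shift 5 fA Ao h fU cU Ur').
move=> /(band_shift 5 fA Ao h fV cV Vs').
rewrite (heis_rel H (r * 5%:Z) (s * 5%:Z)) cU cV !mulNr (flowK _ fU) (flowK _ fV).
have -> : k * (r * 5%:Z) * (s * 5%:Z) = k * r * s * 25 by ring.
move: (k * r * s) krs => N N0; set i := N * 25.
rewrite /band => hi.
have h20 := @flow_iter_le A o m (- 20%:Z) 20%:Z fA Ao h isT.
have [i0|i0] := leP 0 i.
  have i20 : 20%:Z < i by rewrite /i in i0 *; lia.
  apply: (flow_iter_fix fA Ao h i20).
  have [//|g] := tree_linear D h20 (seg_subr D h20 hi).
  by rewrite (seg_meet D h20 g hi); exact: seg_r.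
have i20 : i < - 20%:Z by rewrite /i in i0 *; lia.
apply: (flow_iter_fix fA Ao h i20).
exact: (seg_subr D h20 hi).
Qed.

Lemma flow_scale A (z : int) : flow A -> flow (fun x => A (z * x)).
Proof.
case=> A0 AD Ac; split => [p|x y p|x]; [by rewrite mulr0|by rewrite mulrDr AD|exact: Ac].
Qed.

Lemma heis_scale_l A E Z k (z : int) : heis A E Z k -> heis (fun x => A (z * x)) E Z (k * z).
Proof.
case=> fA fE fZ ZA ZE rel; split => //; first exact: flow_scale.
by move=> x y p; rewrite rel; congr (Z _ _); ring.
Qed.

Lemma heis_scale_c A E Z k (z : int) : z * z = 1 -> heis A E Z k ->
  heis A E (fun x => Z (z * x)) (z * k).
Proof.
move=> zz [fA fE fZ ZA ZE rel]; split => //; first exact: flow_scale.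
move=> x y p; rewrite rel; congr (Z _ _).
by rewrite -[LHS]mul1r -zz; ring.
Qed.

Lemma tree_between (o a b m : X) : seg o b m -> seg o m a -> seg a b m.
Proof.
move=> bm ma; have h := tree_trans D ma bm.
have [h1|//] := seg_cases D h bm.
by rewrite (tree_anti D h1 ma); exact: seg_l.
Qed.

(** Since [E] fixes [m], the map U (k z) acts on A 1 m as E z does, and so keeps it below [m] for
    every z. The values z = y and z = -y bound U (k y) m from the two sides. *)
Lemma heis_comm_band A E U k o m y : heis A E U k -> A 1 o = o -> E 1 o = o ->
  E 1 m = m -> seg o m (A 1 m) -> band A m 1 (U (k * y) m).
Proof.
move=> H Ao Eo Em h; have fA := heis_l H; have fE := heis_r H; have fU := heis_c H.
have bE z : U (k * z) (A 1 m) = E z (A 1 m).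
  by rewrite (heis_rel H) mulr1 (flow_fix fE Em).
have bm z : seg o m (U (k * z) (A 1 m)).
  by rewrite bE -{1}(flow_fix fE Eo z) -{1}(flow_fix fE Em z); exact: flow_seg.
have Uo z : U (k * z) o = o by have := heis_fix_c 1 z H Ao Eo; rewrite mulr1.
have bb : seg o (U (k * y) (A 1 m)) (A 2 m).
  have -> : A 2 m = U (k * y) (A 1 (U (k * - y) (A 1 m))).
    rewrite -(heis_cl H) mulrN -(flowD fU) subrr (flow0 fU).
    by rewrite -(flowD fA).
  rewrite -{1}(Uo y); apply: flow_seg => //.
  by rewrite -{1}(flow_fix fA Ao 1); exact: flow_seg.
have Ue : U (k * y) m = A (-1) (U (k * y) (A 1 m)).
  by rewrite -(heis_cl H) (flowK _ fA).
apply: (@tree_between o).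
  by rewrite Ue -{1}(flow_fix fA Ao (- 1%:Z)); exact: flow_seg.
by have := flow_seg (-1) fA bb; rewrite -Ue (flow_fix fA Ao) -(flowD fA).
Qed.

(* If [A] moved [m], the commutators [U] of [A, E] and [V] of [A, F] would still
   keep [m] between [A (-1) m] and [A 1 m]; hence a word of length 4n in [U] and
   [V] shifts by at most 4n steps of [A], although it equals A (k n^2). *)
Lemma heis_arc_fix A E F U V k1 k2 k3 o p m : heis A E U k1 -> heis A F V k2 ->
  heis U V A k3 -> k1 * k2 * k3 != 0 ->
  A 1 o = o -> E 1 o = o -> A 1 p = p -> F 1 p = p -> seg o p m ->
  E 1 m = m -> F 1 m = m -> A 1 m = m.
Proof.
move=> H1 H2 H3 k0 Ao Eo Ap Fp mop Em Fm.
have [x x1 hx] := flow_sign (heis_l H1) Ao Ap mop.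
wlog : A k1 k2 k3 x x1 H1 H2 H3 k0 Ao Ap hx / x = 1.
  case: x1 hx => -> hx W; first by apply: (W A k1 k2 k3 1) => //; left.
  have fA := heis_l H1.
  have -> : A 1 m = m <-> A (-1 * 1) m = m.
    by split=> [/(flow_fix fA)->//|e]; rewrite -{1}e (flowVK _ fA).
  apply: (W (fun z => A (-1 * z)) (k1 * -1) (k2 * -1) (-1 * k3) 1) => //.
  - by left.
  - exact: heis_scale_l.
  - exact: heis_scale_l.
  - exact: heis_scale_c.
  - by move: k0; rewrite !mulf_eq0 !negb_or => /andP[/andP[-> ->] ->].
  - exact: flow_fix.
  - exact: flow_fix.
move=> x1'; rewrite {}x1' {x x1} in hx; have fA := heis_l H1.
(* Seen from [p], it is the inverse of [A] that pulls [m] in; the commutators with [F] are bounded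
   from this end. *)
have hp : seg p m (A (-1 * 1) m).
  have h1 : seg o (A (-1) m) m.
    by have := flow_seg (-1) fA hx; rewrite (flow_fix fA Ao) (flowK _ fA).
  have h2 : seg o p (A (-1) m).
    by have := flow_seg (-1) fA mop; rewrite (flow_fix fA Ao) (flow_fix fA Ap).
  have [h3|h3] := seg_cases D mop h2; last by rewrite (segC D).
  by rewrite (tree_anti D h3 h1); exact: seg_r.
have B1 y := heis_comm_band y H1 Ao Eo Em hx.
have B2 y : band A m 1 (V (k2 * -1 * y) m).
  have := heis_comm_band y (heis_scale_l (-1) H2) (flow_fix fA Ap _) Fp Fm hp.
  by rewrite /band !mulN1r opprK (segC D).
apply: (heis_band (r := k1 * 1) (s := k2 * -1 * 1) H3 Ao hx _ (B1 1) _ (B2 1)).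
- by move: k0; rewrite !mulf_eq0 !negb_or => /andP[/andP[-> ->] ->].
- by rewrite -mulrN; exact: B1.
- by rewrite -mulrN; exact: B2.
Qed.

End Flows.

Lemma total_max (T : finType) (x0 : T) (r : T -> T -> Prop) :
  (forall x y, r x y \/ r y x) -> (forall x y z, r x y -> r y z -> r x z) ->
  exists x, forall y, r x y.
Proof.
move=> tot tr; suff [x hx] : exists x, forall y, y \in x0 :: enum T -> r x y.
  by exists x => y; apply: hx; rewrite inE mem_enum orbT.
elim: (enum T) => [|a s [x hx]].
  by exists x0 => y; rewrite inE => /eqP->; have [] := tot x0 x0.
have [xa|ax] := tot x a.
  exists x => y; rewrite !inE => /or3P[/eqP->|/eqP->//|ys]; apply: hx; rewrite inE ?eqxx//.
  by rewrite ys orbT.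
exists a => y; rewrite !inE => /or3P[/eqP->|/eqP->|ys].
- by apply: (tr _ x) => //; apply: hx; rewrite inE eqxx.
- by have [] := tot a a.
- by apply: (tr _ x) => //; apply: hx; rewrite inE ys orbT.
Qed.

(* Witte's argument: among flows comparable at [z], choose one, [C i], whose
   iterates dominate those of all the others. Being the commutator of two dominated
   flows, C i (k n^2) is a word of length 4n in them, so it cannot exceed C i (4Mn). *)
Section Domination.
Context {R : realType} {X : metricType R}.
Hypothesis D : is_dendrite [set: X].
Variables (T : finType) (a : T -> int -> X -> X) (o z : X).
Hypothesis ao : forall i, a i 1 o = o.
Hypothesis aheis : forall i, exists u v k, k != 0 /\ heis (a u) (a v) (a i) k.
Hypothesis az : forall i, seg o z (a i 1 z) \/ seg o (a i 1 z) z.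

Let aflow i : flow (a i).
Proof. by have [u [v [k [_ []]]]] := aheis i. Qed.

(** Orients the flows, so that every [C i] moves [z] towards [o] or fixes it. *)
Let sgn i : int := if `[< seg o z (a i 1 z) >] then 1 else -1.

Let sgn2 i : sgn i * sgn i = 1.
Proof. by rewrite /sgn; case: asboolP. Qed.

Let C i (x : int) := a i (sgn i * x).

Let Cflow i : flow (C i). Proof. exact: (flow_scale _ (aflow i)). Qed.

Let Co i : C i 1 o = o. Proof. exact: (flow_fix (aflow i) (ao i)). Qed.

Let Cz i : seg o z (C i 1 z).
Proof.
have := az i; rewrite /C /sgn; case: asboolP => [h _|h [//|h']]; first by rewrite mulr1.
by have := flow_seg D (-1) (aflow i) h'; rewrite (flow_fix (aflow i) (ao i)) (flowK _ (aflow i)).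
Qed.

Let Cmono i (j k : int) : (j <= k)%R -> seg o (C i j z) (C i k z).
Proof. by move=> jk; apply: (flow_iter_le D (Cflow i) (Co i) (Cz i)). Qed.

Let dom i j := forall n : nat, exists M : nat, seg o (C j n%:Z z) (C i M%:Z z).

(** All forward iterates of [z] lie on the arc [o, z] and are therefore comparable. *)
Let dom_total i j : dom i j \/ dom j i.
Proof.
have [h|] := pselect (dom i j); first by left.
move=> /existsNP[n hn]; right=> M; exists n.
have c1 := @Cmono i 0 M%:Z isT; have c2 := @Cmono j 0 n%:Z isT.
rewrite (flow0 (Cflow _)) in c1; rewrite (flow0 (Cflow _)) in c2.
by have [h|] := tree_linear D c1 c2; [case: hn; exists M|].
Qed.

Let dom_trans i j k : dom i j -> dom j k -> dom i k.
Proof.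
move=> ij jk n; have [M hM] := jk n; have [N hN] := ij M; exists N.
exact: (tree_trans D hN hM).
Qed.

(** One-sided counterpart of [band_shift]: each application of [H r] costs at most [M] steps of [A]
    towards [o]. *)
Lemma heis_shift (A H : int -> X -> X) (r : int) (M n j : nat) w : flow A -> A 1 o = o ->
  flow H -> H 1 o = o -> (forall x y p, H x (A y p) = A y (H x p)) ->
  seg o (H r z) (A M%:Z z) -> seg o w (A j%:Z z) ->
  seg o (H (r * n%:Z) w) (A (j + M * n)%N%:Z z).
Proof.
move=> fA Ao fH Ho HA hr; elim: n j w => [|n IH] j w hw.
  by rewrite mulr0 muln0 addn0 (flow0 fH).
rewrite -addn1 PoszD mulrDr mulr1 (flowD fH).
have -> : (j + M * (n + 1) = (j + M) + M * n)%N by lia.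
apply: IH; apply: (tree_trans D (y := H r (A j%:Z z))); last first.
  by rewrite -{1}(flow_fix fH Ho r); exact: flow_seg.
by rewrite HA PoszD (flowD fA) -{1}(flow_fix fA Ao j%:Z); exact: flow_seg.
Qed.

Let dominant_fix i : (forall j, dom i j) -> C i 1 z = z.
Proof.
move=> hi; have [u [v [k [k0 H0]]]] := aheis i.
have H := heis_scale_c (sgn2 i) H0; set K := sgn i * k in H.
have K0 : K != 0 by rewrite mulf_neq0// /sgn; case: asboolP.
(* Only one of the two signs uses domination, since the other moves [z] away from [o]. *)
have bound j : exists M : nat, forall r : int, r = 1 \/ r = -1 -> seg o (a j r z) (C i M%:Z z).
  have [M hM] := hi j 1%N; exists M => r hr.
  have [->|->] : r = sgn j \/ r = - sgn j.
    by rewrite /sgn; case: asboolP => _; case: hr => ->; rewrite ?opprK; [left|right|right|left].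
    by move: hM; rewrite /C mulr1.
  have h : seg o (a j (- sgn j) z) z.
    have := flow_seg D (- sgn j) (aflow j) (Cz j).
    by rewrite (flow_fix (aflow j) (ao j)) /C mulr1 (flowK _ (aflow j)).
  apply: (tree_trans D _ h); have := @Cmono i 0 M%:Z isT.
  by rewrite (flow0 (Cflow i)).
have [M1 hM1] := bound u; have [M2 hM2] := bound v.
pose M := maxn M1 M2.
have bu r : r = 1 \/ r = -1 -> seg o (a u r z) (C i M%:Z z).
  by move=> /hM1 h; apply: (tree_trans D (Cmono _ _) h); rewrite lez_nat leq_maxl.
have bv r : r = 1 \/ r = -1 -> seg o (a v r z) (C i M%:Z z).
  by move=> /hM2 h; apply: (tree_trans D (Cmono _ _) h); rewrite lez_nat leq_maxr.
have cu x y p : a u x (C i y p) = C i y (a u x p) by apply/esym; exact: (heis_cl H).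
have cv x y p : a v x (C i y p) = C i y (a v x p) by apply/esym; exact: (heis_cr H).
(* This sign makes the commutator a positive power of [C i]. *)
pose s : int := if 0 < K then 1 else -1.
have hs : s = 1 \/ s = -1 by rewrite /s; case: ifP; [left|right].
have hs' : - s = 1 \/ - s = -1 by case: hs => ->; [right|left].
have Ks : 0 < K * s.
  rewrite /s; move: (K) K0 => K1 /eqP K10; case: ifP => h; lia.
(* With n > 4M, the exponent of the commutator, at least n^2, exceeds the 4Mn steps that its letters
   allow. *)
pose n := (4 * M).+1.
have hz : seg o z (C i 0%N%:Z z) by rewrite (flow0 (Cflow i)); exact: seg_r.
have fu := aflow u; have fv := aflow v; have fC := Cflow i; have fCo := Co i.
have := heis_shift n fC fCo fu (ao u) cu (bu 1 (or_introl erefl)) hz.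
move=> /(heis_shift n fC fCo fv (ao v) cv (bv s hs)).
move=> /(heis_shift n fC fCo fu (ao u) cu (bu (-1) (or_intror erefl))).
move=> /(heis_shift n fC fCo fv (ao v) cv (bv (- s) hs')).
rewrite (heis_rel H (1 * n%:Z) (s * n%:Z)) cu cv !mulNr (flowK _ fu) (flowK _ fv) => h.
apply: (flow_iter_fix D fC fCo (Cz i) _ h).
have : n%:Z <= K * s * n%:Z by rewrite ler_peMl// -[1]add0r lezD1.
have -> : K * (1 * n%:Z) * (s * n%:Z) = (K * s * n%:Z) * n%:Z by ring.
rewrite /n; nia.
Qed.

(** When the dominant flow fixes [z], the forward iterates of the others are confined between [z]
    and [z]. *)
Lemma dominated_fix i : a i 1 z = z.
Proof.
have [m hm] := total_max i dom_total dom_trans.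
have e := dominant_fix hm.
have [M hM] := hm i 1%N; rewrite (flow_fix (Cflow m) e) in hM.
have : C i 1 z = z by apply: (tree_anti D (Cz i) hM).
rewrite /C mulr1 /sgn; case: asboolP => // _ e1.
by rewrite -{1}e1 (flowVK _ (aflow i)).
Qed.

End Domination.

(** * Points of period two in sets closed under medians *)

Section Periodic.
Context {R : realType} {X : metricType R}.
Hypothesis D : is_dendrite [set: X].
Implicit Types (S : set X) (g : X -> X).

(** A substitute for convexity that fixed point sets do have: homeomorphisms preserve arcs, hence
    medians. *)
Definition median_closed S := forall a b c m, S a -> S b -> S c ->
  seg a b m -> seg b c m -> seg a c m -> S m.

(** Monotone iterates have a single cluster point, since any two cluster points lie below each
    other; [g] maps cluster points to cluster points. *)
Lemma chain_fix g S m : continuous g -> injective g -> closed S ->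
  (forall n, S (iter n g m)) -> (forall n, seg m (iter n.+1 g m) (iter n g m)) ->
  exists2 p, S p & g p = p.
Proof.
move=> gc gi cS Su hm; have [_ cX _ _ _] := D.
pose u n := iter n g m.
have mono n k : (n <= k)%N -> seg m (u k) (u n).
  move=> /subnKC <-; elim: (k - n)%N => [|j IH]; first by rewrite addn0; exact: seg_r.
  by rewrite addnS; apply: (tree_trans D IH (hm _)).
pose cl q := forall (e : R) N, 0 < e -> exists2 n, (N <= n)%N & mdist q (u n) < e.
have cl_closed q (F : set X) N : cl q -> closed F -> (forall n, (N <= n)%N -> F (u n)) -> F q.
  move=> hq /closed_mdistP cF h; apply: cF => e e0; have [n Nn hn] := hq e N e0.
  by exists (u n) => //; exact: h.
have [p _ hp] := compact_seq_cluster cX (fun n => I : [set: X] (u n)).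
have up q n : cl q -> seg m q (u n).
  move=> hq; apply: (cl_closed q [set x | seg m x (u n)] n hq); first exact: closed_up.
  by move=> k; exact: mono.
have below q q' : cl q -> cl q' -> seg m q' q.
  move=> hq hq'; apply: (cl_closed q (seg m q') 0%N hq); first exact: seg_closed.
  by move=> n _; exact: up.
exists p; first by apply: (cl_closed p S 0%N hp cS) => n _; exact: Su.
have hgp : cl (g p).
  move=> e N e0; have [d d0 hd] := (continuous_mdistP g).1 gc p e e0.
  have [n Nn hn] := hp d N d0; exists n.+1; first exact: leqW.
  by rewrite /u iterS; exact: hd.
by apply: (tree_anti D); exact: below.
Qed.

Lemma seg_chain (a b c d : X) : seg a c b -> seg b d c -> b <> c -> seg a d c.
Proof.
move=> hb hc bc; rewrite (@seg_cat _ _ D a d c); first by left; exact: (seg_r D).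
move=> x [xa xd]; rewrite (segC D) in xa; rewrite (segC D) in hb.
have [h|h] := tree_linear D xa hb.
  by apply: (seg_meet D hc) => //; rewrite (segC D).
by case: bc; apply: (seg_anti D hc); exact: (seg_sub D xd).
Qed.

Lemma seg_mid (a b m x y : X) : seg a b m -> seg a m x -> seg m b y -> seg x y m.
Proof.
move=> hm hx hy; rewrite (@seg_cat _ _ D x y m); first by left; exact: (seg_r D).
move=> z [zx zy]; apply: (seg_meet D hm); first exact: (seg_subr D hx).
exact: (seg_sub D hy).
Qed.

Lemma chain_iter g m : continuous g -> injective g -> g m <> m -> seg m (g (g m)) (g m) ->
  forall n, seg m (iter n.+1 g m) (iter n g m).
Proof.
move=> gc gi gm h; have st n : seg (iter n g m) (iter n.+2 g m) (iter n.+1 g m).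
  by elim: n => //= n IH; exact: (seg_map D gc gi).
have ne n : iter n g m <> iter n.+1 g m.
  by elim: n => [|n IH]; [move/esym|move/gi].
elim=> [|n IH]; first exact: seg_l.
exact: seg_chain IH (st n) (ne n).
Qed.

(** [g] maps the arc from [m] to [gi m] into itself and reverses its order, so the iterates of
    [g \o g] at [m] move monotonically along it. *)
Lemma fix_reversed g gi S m : continuous g -> continuous gi -> cancel g gi -> cancel gi g ->
  closed S -> (forall x, S x -> S (g x)) -> S m -> seg m (gi m) (g m) ->
  exists2 p, S p & g (g p) = p.
Proof.
move=> gc gic gK giK cS gS Sm h; have ginj := can_inj gK.
have rev x y : seg m y x -> seg m (gi m) y -> seg m (g x) (g y) /\ seg m (gi m) (g x).
  move=> yx hy; have h1 : seg (g m) m (g y) by rewrite -{2}(giK m); exact: seg_map.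
  have h2 : seg (g m) (g y) (g x) by exact: seg_map.
  have h3 := tree_trans D h2 h1; split.
    have [h4|] := seg_cases D h3 h1; last by rewrite (segC D).
    by rewrite (tree_anti D h4 h2); exact: seg_r.
  by apply: (seg_sub D h); rewrite (segC D).
apply: (@chain_fix (g \o g) S m) => //.
- by move=> x; apply: continuous_comp; exact: gc.
- exact: inj_comp.
- by elim=> //= n IH; apply/gS/gS.
have : forall n, seg m (iter n.+1 (g \o g) m) (iter n (g \o g) m) /\
    seg m (gi m) (iter n.+1 (g \o g) m).
  elim=> [|n [h1 h2]].
    split; first exact: seg_l.
    by have [] := rev (g m) (g m) (seg_r D _ _) h.
  have [h3 h4] := rev _ _ h1 h2.
  have hg : seg m (gi m) (g (iter n.+1 (g \o g) m)).
    by have [] := rev _ _ (seg_r D m (iter n.+1 (g \o g) m)) h2.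
  by have [h5 h6] := rev _ _ h3 h4; have [_ h7] := rev _ _ (seg_r D _ _) hg.
by move=> H n; have [] := H n.
Qed.

(* With m the median of g^-1 s, s and g s, either the iterates of [g] move [m]
   monotonically along arcs, and converge in [S], or [g] reverses an arc at [m],
   and those of g^2 do. *)
Lemma fix_square g gi S : continuous g -> continuous gi -> cancel g gi -> cancel gi g ->
  closed S -> median_closed S -> S !=set0 ->
  (forall x, S x -> S (g x)) -> (forall x, S x -> S (gi x)) ->
  exists2 p, S p & g (g p) = p.
Proof.
move=> gc gic gK giK cS mS [s Ss] gS giS.
have [ginj giinj] := (can_inj gK, can_inj giK).
have [m [m1 m2 m3]] := median_exists D (gi s) s (g s).
have Sm : S m by apply: (mS (gi s) s (g s)); [exact: giS| |exact: gS| | |].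
have gm : seg s (g s) (g m) by rewrite -{1}(giK s); exact: seg_map.
have gim : seg (gi s) s (gi m) by rewrite -{2}(gK s); exact: seg_map.
have [e|gmm] := pselect (g m = m); first by exists m => //; rewrite e.
(* In this case [g m] and [gi m] lie on the same arc [m, s], and one of [g], [gi] reverses an arc at
   [m]. *)
have [h|h] := tree_linear D gm m2.
  have h1 : seg m s (gi m).
    apply: (@tree_between _ _ D (gi s)) => //.
    by have := seg_map D gic giinj h; rewrite gK.
  have h0 : seg m s (g m) by rewrite (segC D).
  have [h2|h2] := tree_linear D h0 h1.
  - exact: fix_reversed gc gic gK giK cS gS Sm h2.
  - have [p Sp hp] := fix_reversed gic gc giK gK cS giS Sm h2.
    by exists p => //; rewrite -{1}hp !giK.
(* Now [gi m] and [g m] lie on opposite sides of [m], so [g] translates. *)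
have h1 : seg (gi s) m (gi m) by have := seg_map D gic giinj h; rewrite gK.
have h2 : seg m (g s) (g m) by exact: (@tree_between _ _ D s).
have h3 : seg m (g (g m)) (g m).
  by have := seg_map D gc ginj (seg_mid m3 h1 h2); rewrite giK.
have [|p Sp hp] := chain_fix gc ginj cS _ (chain_iter gc ginj gmm h3).
  by elim=> //= n; exact: gS.
by exists p; rewrite ?hp.
Qed.

End Periodic.

(** * Elementary matrices and finite quotients *)

Section Transvections.
Variable n : nat.
Local Notation M := 'M[int]_n.
Implicit Types (v : 'cV[int]_n) (w u : 'rV[int]_n) (i j l p q r : 'I_n) (c d : int) (g : M).

Definition transv v w : M := 1%:M + v *m w.
Definition cb i : 'cV[int]_n := delta_mx i 0.
Definition rb j : 'rV[int]_n := delta_mx 0 j.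
Definition elem i j c : M := transv (c *: cb i) (rb j).
Definition dot w v : int := (w *m v) 0 0.

Lemma dotE w v : w *m v = (dot w v)%:M.
Proof. exact: mx11_scalar. Qed.

Lemma dot_rb j v : dot (rb j) v = v j 0.
Proof. by rewrite /dot -rowE mxE. Qed.

Lemma dot_basis i j : dot (rb j) (cb i) = (i == j)%:R.
Proof. by rewrite dot_rb mxE eqxx andbT eq_sym. Qed.

Lemma dotDr w v v' : dot w (v + v') = dot w v + dot w v'.
Proof. by rewrite /dot mulmxDr mxE. Qed.

Lemma dotDl w w' v : dot (w + w') v = dot w v + dot w' v.
Proof. by rewrite /dot mulmxDl mxE. Qed.

Lemma dotZr w v c : dot w (c *: v) = c * dot w v.
Proof. by rewrite /dot -scalemxAr mxE. Qed.

Lemma dotZl w v c : dot (c *: w) v = c * dot w v.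
Proof. by rewrite /dot -scalemxAl mxE. Qed.

Lemma transvM v w v' w' :
  transv v w *m transv v' w' = 1%:M + v *m w + v' *m w' + dot w v' *: (v *m w').
Proof.
rewrite /transv mulmxDl mul1mx mulmxDr mulmx1 -mulmxA (mulmxA w) dotE.
rewrite mul_scalar_mx -scalemxAr -!addrA; congr (_ + _).
by rewrite addrCA !addrA.
Qed.

Lemma transv0l w : transv 0 w = 1%:M. Proof. by rewrite /transv mul0mx addr0. Qed.
Lemma transv0r v : transv v 0 = 1%:M. Proof. by rewrite /transv mulmx0 addr0. Qed.

Lemma transvDr v w w' : dot w v = 0 -> transv v w *m transv v w' = transv v (w + w').
Proof. by move=> h; rewrite transvM h scale0r addr0 /transv mulmxDr addrA. Qed.

Lemma transvDl v v' w : dot w v' = 0 -> transv v w *m transv v' w = transv (v + v') w.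
Proof. by move=> h; rewrite transvM h scale0r addr0 /transv mulmxDl addrA. Qed.

Lemma transvZ v w c : transv (c *: v) w = transv v (c *: w).
Proof. by rewrite /transv -scalemxAl -scalemxAr. Qed.

Lemma transvVr v w : dot w v = 0 -> transv v w *m transv (- v) w = 1%:M.
Proof.
by move=> h; rewrite transvDl ?subrr ?transv0l// -scaleN1r dotZr h mulr0.
Qed.

Lemma transv_comm v w v' w' : dot w v = 0 -> dot w' v' = 0 -> dot w' v = 0 ->
  transv v w *m transv v' w' =
  transv (dot w v' *: v) w' *m (transv v' w' *m transv v w).
Proof.
move=> _ h2 h3; rewrite mulmxA transvDl// !transvM h3 scale0r addr0.
rewrite mulmxDl -scalemxAl -!addrA; congr (_ + _).
by rewrite [RHS]addrC -addrA [RHS]addrCA.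
Qed.

Lemma transv_conj g g' v w : g *m g' = 1%:M -> g *m transv v w *m g' = transv (g *m v) (w *m g').
Proof. by move=> h; rewrite /transv mulmxDr mulmxDl mulmx1 h !mulmxA. Qed.

Lemma elemD i j c d : i != j -> elem i j c *m elem i j d = elem i j (c + d).
Proof.
move=> ij; rewrite /elem transvDl ?scalerDl//.
by rewrite dotZr dot_basis (negbTE ij) mulr0.
Qed.

Lemma elem0 i j : elem i j 0 = 1%:M. Proof. by rewrite /elem scale0r transv0l. Qed.

Lemma elem_comm i j l c d : i != j -> i != l -> l != j ->
  elem i l c *m elem l j d = elem i j (c * d) *m (elem l j d *m elem i l c).
Proof.
move=> ij il lj; rewrite transv_comm.
- by rewrite /elem dotZr dot_basis eqxx mulr1 scalerA mulrC.
- by rewrite dotZr dot_basis (negbTE il) mulr0.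
- by rewrite dotZr dot_basis (negbTE lj) mulr0.
- by rewrite dotZr dot_basis (negbTE ij) mulr0.
Qed.

Lemma elem_unit i j c : i != j -> elem i j c \in unitmx.
Proof.
move=> ij; have [] // := @mulmx1_unit _ _ (elem i j c) (elem i j (- c)).
by rewrite elemD// subrr elem0.
Qed.

Lemma third (i j : 'I_n) : (2 < n)%N -> exists l, (i != l) && (l != j).
Proof.
move=> n3; have : (#|[set i; j]%SET| < #|'I_n|)%N.
  by rewrite card_ord (leq_ltn_trans _ n3)// cards2; case: (_ != _).
rewrite ltnNge => /negP h; apply: contrapT => nl; apply: h.
apply/subset_leq_card/fintype.subsetP => l _; rewrite !inE.
by apply: contrapT => /negP; rewrite negb_or eq_sym => h; apply: nl; exists l.
Qed.

Lemma elemE i j c p q : elem i j c p q = (p == q)%:R + c * ((p == i) && (q == j))%:R.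
Proof.
by rewrite !mxE big_ord1 !mxE eqxx andbT -mulrA -natrM mulnb.
Qed.

Lemma elem_det i j c : i != j -> \det (elem i j c) = 1.
Proof.
move=> ij; wlog ji : i j ij / (j < i)%N => [W|].
  have [|ji|/val_inj e] := ltngtP j i; first exact: W; last by rewrite e eqxx in ij.
  rewrite -det_tr (_ : _^T = elem j i c) ?W 1?eq_sym//.
  by apply/matrixP => p q; rewrite mxE !elemE eq_sym andbC.
rewrite det_trig ?big1// => [p _|].
  rewrite elemE eqxx; case: eqVneq => [->|_] /=; last by rewrite mulr0 addr0.
  by rewrite (negbTE ij) mulr0 addr0.
apply/is_trig_mxP => p q pq; rewrite elemE -val_eqE (ltn_eqF pq) add0r.
case: eqVneq => [ep|_]; last by rewrite mulr0.
case: eqVneq => [eq|_] /=; last by rewrite mulr0.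
by move: pq; rewrite ep eq ltnNge (ltnW ji).
Qed.

Lemma elem_r i j c : elem i j c = transv (cb i) (c *: rb j).
Proof. by rewrite /elem transvZ. Qed.

Lemma transv_commE v w v' w' : dot w v = 0 -> dot w' v' = 0 -> dot w' v = 0 ->
  transv (dot w v' *: v) w' =
  transv v w *m transv v' w' *m transv (- v) w *m transv (- v') w'.
Proof.
move=> h1 h2 h3; rewrite transv_comm// -!mulmxA (mulmxA (transv v w)) transvVr//.
by rewrite mul1mx transvVr// mulmx1.
Qed.

(* An explicit word in elementary matrices for transvections. Its instance with
   a = b = k gives generation by the elementary matrices congruent to 1 mod k, that
   with a = b = 1 shows that conjugates of elementary matrices depend, modulo the
   normal closure of the k-th powers, only on residues mod k. *)
Section Factorization.
(** Binary relations run the same word for two transvections in parallel, as the comparison of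
    residues requires. *)
Variables (P : M -> M -> Prop) (Q : int -> int -> Prop).
Hypothesis n3 : (2 < n)%N.
Hypothesis P1 : P 1%:M 1%:M.
Hypothesis PM : forall a b a' b', P a b -> P a' b' -> P (a *m a') (b *m b').
Hypothesis PE : forall i j c c', i != j -> Q c c' -> P (elem i j c) (elem i j c').

Lemma factor_sum_r (I : Type) (s : seq I) (f f' : I -> 'rV[int]_n) v v' :
  (forall x, dot (f x) v = 0) -> (forall x, dot (f' x) v' = 0) ->
  (forall x, P (transv v (f x)) (transv v' (f' x))) ->
  P (transv v (\sum_(x <- s) f x)) (transv v' (\sum_(x <- s) f' x)).
Proof.
move=> h h' hP; elim: s => [|x s IH]; first by rewrite !big_nil !transv0r.
by rewrite !big_cons -transvDr// -[transv v' _]transvDr//; exact: PM.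
Qed.

Lemma factor_sum_l (I : Type) (s : seq I) (f f' : I -> 'cV[int]_n) w w' :
  (forall x, dot w (f x) = 0) -> (forall x, dot w' (f' x) = 0) ->
  (forall x, P (transv (f x) w) (transv (f' x) w')) ->
  P (transv (\sum_(x <- s) f x) w) (transv (\sum_(x <- s) f' x) w').
Proof.
move=> h h' hP; elim: s => [|x s IH]; first by rewrite !big_nil !transv0l.
have d (g : I -> 'cV[int]_n) y : (forall x, dot y (g x) = 0) -> dot y (\sum_(j <- s) g j) = 0.
  by move=> hg; rewrite /dot mulmx_sumr summxE big1 // => j _; exact: hg.
by rewrite !big_cons -transvDl ?d// -[transv _ w']transvDl ?d//; exact: PM.
Qed.

(** The Koszul syzygies of the column [v]: rows supported at two positions that annihilate it. *)
Definition wedge p q v : 'rV[int]_n := v q 0 *: rb p - v p 0 *: rb q.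

Lemma dot_wedge p q v z : dot (wedge p q v) z = v q 0 * z p 0 - v p 0 * z q 0.
Proof. by rewrite /wedge -scaleN1r dotDl !dotZl !dot_rb mulN1r. Qed.

(** Exactness of the Koszul complex of a unimodular column: the sum is (u v) w - (w v) u, written
    out in coordinates. *)
Lemma wedge_decomp u w v : dot u v = 1 -> dot w v = 0 ->
  w = \sum_(x : 'I_n * 'I_n) (w 0 x.1 * u 0 x.2) *: wedge x.1 x.2 v.
Proof.
move=> uv wv; have dsum y : dot y v = \sum_q y 0 q * v q 0 by rewrite /dot mxE.
rewrite -(pair_big xpredT xpredT (fun p q => (w 0 p * u 0 q) *: wedge p q v)) /=.
have -> : \sum_p \sum_q (w 0 p * u 0 q) *: wedge p q v =
   \sum_p \sum_q (w 0 p * (u 0 q * v q 0)) *: rb p -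
   \sum_p \sum_q (u 0 q * (w 0 p * v p 0)) *: rb q.
  rewrite -sumrB; apply: eq_bigr => p _; rewrite -sumrB; apply: eq_bigr => q _.
  rewrite /wedge scalerBr !scalerA; congr (_ *: _ - _ *: _); ring.
rewrite [X in _ - X]exchange_big /= [X in _ - X]big1 ?subr0; last first.
  by move=> q _; rewrite -scaler_suml -mulr_sumr -dsum wv mulr0 scale0r.
have -> : \sum_p \sum_q (w 0 p * (u 0 q * v q 0)) *: rb p = \sum_p w 0 p *: rb p.
  by apply: eq_bigr => p _; rewrite -scaler_suml -mulr_sumr -dsum uv mulr1.
exact: row_sum_delta.
Qed.

Lemma col_decomp v : v = \sum_r v r 0 *: cb r.
Proof.
by apply/colP => i; rewrite summxE (bigD1 i)//= !mxE !eqxx mulr1 big1 ?addr0// => j ji;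
   rewrite !mxE eq_sym (negbTE ji) mulr0.
Qed.

(** Split [v] into its part in the plane of [p] and [q] and the rest. The rest gives elementary
    matrices directly. The plane part is a commutator through a third index [r], of a column
    transvection scaled by [a] and a row transvection scaled by [b * c], each a product of two
    elementary matrices. *)
Lemma factor_wedge p q (a b c c' : int) v v' : p != q ->
  (forall e x, Q (e * (a * v x 0)) (e * (a * v' x 0))) ->
  (forall e x, Q (e * (b * c * v x 0)) (e * (b * c' * v' x 0))) ->
  (forall e x y, Q (e * (a * b * c * v x 0 * v y 0)) (e * (a * b * c' * v' x 0 * v' y 0))) ->
  P (transv v ((a * b * c) *: wedge p q v)) (transv v' ((a * b * c') *: wedge p q v')).
Proof.
move=> pq Ha Hb Hab; have [r /andP[pr rq]] := third p q n3.
have qp : q != p by rewrite eq_sym.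
have rp : r != p by rewrite eq_sym.
have qr : q != r by rewrite eq_sym.
pose plane (z : 'cV[int]_n) := z p 0 *: cb p + z q 0 *: cb q.
have plane_wedge (z : 'cV[int]_n) : dot (wedge p q z) (plane z) = 0.
  by rewrite dot_wedge /plane !mxE !eqxx (negbTE pq) (negbTE qp) /=; ring.
have split_v (z : 'cV[int]_n) : z = plane z + \sum_(x | (x != p) && (x != q)) z x 0 *: cb x.
  by rewrite {1}(col_decomp z) (bigD1 p)//= (bigD1 q)//= addrA.
have out_wedge x (z : 'cV[int]_n) : x != p -> x != q -> dot (wedge p q z) (cb x) = 0.
  move=> xp xq; rewrite dot_wedge !mxE (eq_sym p) (eq_sym q) (negbTE xp) (negbTE xq) /=.
  by rewrite !mulr0 subr0.
have Ea e (z : 'cV[int]_n) : transv (e *: (a *: plane z)) (rb r) =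
    elem p r (e * (a * z p 0)) *m elem q r (e * (a * z q 0)).
  rewrite /elem transvDl; last by rewrite dotZr dot_basis (negbTE qr) mulr0.
  by rewrite /plane !scalerDr !scalerA !mulrA.
have Eb e (z : 'cV[int]_n) d (x : 'I_n) : x != p -> x != q ->
    transv (cb x) (e *: (d *: wedge p q z)) =
    elem x p (e * (d * z q 0)) *m elem x q (- e * (d * z p 0)).
  move=> xp xq; rewrite !elem_r transvDr; last first.
    by rewrite dotZl dot_basis (negbTE xp) mulr0.
  by rewrite /wedge !scalerBr !scalerA mulNr scaleNr !mulrA.
have Pa e : P (transv (e *: (a *: plane v)) (rb r)) (transv (e *: (a *: plane v')) (rb r)).
  by rewrite !Ea; apply: PM; exact: PE.
have Pb e : P (transv (cb r) (e *: ((b * c) *: wedge p q v)))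
              (transv (cb r) (e *: ((b * c') *: wedge p q v'))).
  by rewrite !Eb//; apply: PM; apply: PE.
have Ep (z : 'cV[int]_n) d : transv (plane z) ((a * b * d) *: wedge p q z) =
    transv (1 *: (a *: plane z)) (rb r) *m transv (cb r) (1 *: ((b * d) *: wedge p q z)) *m
    transv ((-1) *: (a *: plane z)) (rb r) *m transv (cb r) ((-1) *: ((b * d) *: wedge p q z)).
  have -> : transv (cb r) (-1 *: ((b * d) *: wedge p q z)) =
            transv (- cb r) ((b * d) *: wedge p q z).
    by rewrite -[in RHS]scaleN1r transvZ.
  rewrite !scale1r scaleN1r -transv_commE.
  - by rewrite dot_basis eqxx scale1r transvZ scalerA mulrA.
  - by rewrite /plane dotZr dotDr !dotZr !dot_basis (negbTE pr) (negbTE qr) !mulr0.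
  - by rewrite dotZl out_wedge ?mulr0.
  - by rewrite dotZl dotZr plane_wedge !mulr0.
have Pp : P (transv (plane v) ((a * b * c) *: wedge p q v))
            (transv (plane v') ((a * b * c') *: wedge p q v')).
  by rewrite !Ep; apply: PM; [apply: PM; [apply: PM|]|].
have So (z : 'cV[int]_n) d x : x != p -> x != q -> transv (z x 0 *: cb x) (d *: wedge p q z) =
    elem x p (1 * (d * z x 0 * z q 0)) *m elem x q (- 1 * (d * z x 0 * z p 0)).
  move=> xp xq; rewrite transvZ scalerA -[_ *: _]scale1r Eb//.
  by congr (elem _ _ _ *m elem _ _ _); ring.
have sum0 (z : 'cV[int]_n) d :
    dot (d *: wedge p q z) (\sum_(x | (x != p) && (x != q)) z x 0 *: cb x) = 0.
  rewrite /dot mulmx_sumr summxE big1 // => x /andP[xp xq].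
  by rewrite -/(dot _ _) dotZl dotZr out_wedge// !mulr0.
have main (z : 'cV[int]_n) d : transv z (d *: wedge p q z) = transv (plane z) (d *: wedge p q z) *m
    transv (\sum_(x | (x != p) && (x != q)) z x 0 *: cb x) (d *: wedge p q z).
  by rewrite transvDl ?sum0// -split_v.
rewrite main [in X in P _ X]main; apply: PM => //.
rewrite big_mkcond [in X in P _ X]big_mkcond /=; apply: factor_sum_l.
- by move=> x; case: ifP => [/andP[xp xq]|_]; rewrite ?dotZl ?dotZr ?out_wedge ?mulr0// /dot mulmx0 mxE mulr0.
- by move=> x; case: ifP => [/andP[xp xq]|_]; rewrite ?dotZl ?dotZr ?out_wedge ?mulr0// /dot mulmx0 mxE mulr0.
move=> x; case: ifP => [/andP[xp xq]|_]; last by rewrite !transv0l.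
by rewrite !So//; apply: PM; apply: PE.
Qed.

Lemma factor_transv (a b : int) u w v u' w' v' :
  dot u v = 1 -> dot w v = 0 -> dot u' v' = 1 -> dot w' v' = 0 ->
  (forall e x, Q (e * (a * v x 0)) (e * (a * v' x 0))) ->
  (forall e p q x, Q (e * (b * (w 0 p * u 0 q) * v x 0)) (e * (b * (w' 0 p * u' 0 q) * v' x 0))) ->
  (forall e p q x y, Q (e * (a * b * (w 0 p * u 0 q) * v x 0 * v y 0))
                       (e * (a * b * (w' 0 p * u' 0 q) * v' x 0 * v' y 0))) ->
  P (transv v ((a * b) *: w)) (transv v' ((a * b) *: w')).
Proof.
move=> uv wv uv' wv' Ha Hb Hab.
rewrite (wedge_decomp uv wv) (wedge_decomp uv' wv') !scaler_sumr.
have wz p q c (z : 'cV[int]_n) : dot (c *: wedge p q z) z = 0.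
  by rewrite dotZl dot_wedge mulrC [X in X - _]mulrC subrr mul0r.
apply: factor_sum_r => [x|x|[p q] /=]; rewrite ?scalerA ?wz//.
have [->|pq] := eqVneq p q; first by rewrite /wedge !subrr !scaler0 !transv0r.
by apply: factor_wedge.
Qed.

End Factorization.

End Transvections.

(** * Generation of SL_n(Z) by elementary matrices *)

Section Generation.
Variable n : nat.
Local Notation M := 'M[int]_n.
Implicit Types (a b g h : M) (S : set M).

(** Words without inverses suffice, because the letter sets [elems] and [conjs] are closed under
    inversion. *)
Inductive gen S : M -> Prop :=
| gen1 : gen S 1%:M
| genM a b : S a -> gen S b -> gen S (a *m b).

Lemma gen_mul S a b : gen S a -> gen S b -> gen S (a *m b).
Proof.
by elim=> [|c d Sc _ IH] gb; rewrite ?mul1mx// -mulmxA; apply: genM => //; exact: IH.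
Qed.

Lemma gen_in S a : S a -> gen S a.
Proof. by move=> Sa; rewrite -[a]mulmx1; apply: genM => //; exact: gen1. Qed.

Definition elems (k : int) : set M := [set a | exists i j c, i != j /\ a = elem i j (k * c)].

Lemma elems_gen k i j c : i != j -> gen (elems k) (elem i j (k * c)).
Proof. by move=> ij; apply: gen_in; exists i, j, c. Qed.

Lemma elem_gen1 i j c : i != j -> gen (elems 1) (elem i j c).
Proof. by move=> ij; rewrite -[c]mul1r; exact: elems_gen. Qed.

Lemma gen_sum_r S (I : Type) (s : seq I) (f : I -> 'rV[int]_n) v :
  (forall x, dot (f x) v = 0) -> (forall x, gen S (transv v (f x))) ->
  gen S (transv v (\sum_(x <- s) f x)).
Proof.
move=> h; apply: (@factor_sum_r n (fun a _ => gen S a) _ _ I s f f v v) => //; first exact: gen1.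
by move=> *; exact: gen_mul.
Qed.

Lemma gen_transv_row i (w : 'rV[int]_n) : w 0 i = 0 -> gen (elems 1) (transv (cb i) w).
Proof.
move=> wi; have -> : w = \sum_j w 0 j *: rb j by rewrite [LHS]row_sum_delta.
apply: gen_sum_r => j; have [->|ji] := eqVneq j i.
- by rewrite wi scale0r /dot mul0mx mxE.
- by rewrite dotZl dot_basis eq_sym (negbTE ji) mulr0.
- by rewrite wi scale0r transv0r; exact: gen1.
- by rewrite -elem_r; apply: elem_gen1; rewrite eq_sym.
Qed.

Lemma elem_mulE i j c a p q : (elem i j c *m a) p q = a p q + c * (p == i)%:R * a j q.
Proof.
rewrite /elem /transv mulmxDl mul1mx mxE; congr (_ + _).
by rewrite -mulmxA -rowE mxE big_ord1 !mxE eqxx andbT.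
Qed.

Lemma elem_cancel i j c a : i != j -> gen (elems 1) (elem i j c *m a) -> gen (elems 1) a.
Proof.
move=> ij h; have -> : a = elem i j (- c) *m (elem i j c *m a).
  by rewrite mulmxA elemD// addNr elem0 mul1mx.
by apply: gen_mul => //; exact: elem_gen1.
Qed.

End Generation.

Lemma SL_one : forall a : 'M[int]_0, gen (@elems 0 1) a.
Proof. by move=> a; rewrite [a]flatmx0 -[0](flatmx0 1%:M); exact: gen1. Qed.

Section Euclid.
Variable m : nat.
Hypothesis IHm : forall a : 'M[int]_m, \det a = 1 -> gen (@elems m 1) a.
Local Notation M := 'M[int]_(1 + m).
Implicit Types a : M.

Lemma cb_rshift i : cb (rshift 1 i) = col_mx 0 (cb i) :> 'cV[int]_(1 + m).
Proof.
apply/colP => k; rewrite !mxE; case: splitP => l kl; rewrite !mxE -val_eqE /= kl.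
  by rewrite [l]ord1.
by rewrite eqn_add2l.
Qed.

Lemma rb_rshift j : rb (rshift 1 j) = row_mx 0 (rb j) :> 'rV[int]_(1 + m).
Proof.
apply/rowP => k; rewrite !mxE; case: splitP => l kl; rewrite !mxE -!val_eqE /= kl.
  by rewrite [l]ord1.
by rewrite eqn_add2l.
Qed.

Lemma gen_lift (b : 'M[int]_m) : gen (@elems m 1) b ->
  gen (@elems (1 + m) 1) (block_mx 1%:M 0 0 b).
Proof.
elim=> [|c d [i [j [x [ij ->]]]] _ IH].
  by rewrite -scalar_mx_block; exact: gen1.
have -> : block_mx 1%:M 0 0 (elem i j (1 * x) *m d) =
    elem (rshift 1 i) (rshift 1 j) (1 * x) *m (block_mx 1%:M 0 0 d : M).
  have -> : elem (rshift 1 i) (rshift 1 j) (1 * x) = block_mx 1%:M 0 0 (elem i j (1 * x)).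
    rewrite /elem /transv cb_rshift rb_rshift scale_col_mx scaler0 mul_col_row !mul0mx mulmx0.
    by rewrite (scalar_mx_block 1 m 1) add_block_mx !addr0.
  by rewrite mulmx_block !mulmx0 !mul0mx !mul1mx !addr0 add0r.
by apply: gen_mul => //; apply: elem_gen1; rewrite eq_rshift.
Qed.

Lemma gen_first_col a : \det a = 1 -> (forall i, a i 0 = (i == 0)%:R) -> gen (elems 1) a.
Proof.
move=> da ca.
have e : a = block_mx 1%:M (ursubmx a) 0 (drsubmx a).
  rewrite -[LHS]submxK; congr block_mx; apply/matrixP => i j; rewrite !mxE.
    by rewrite [j]ord1 [i]ord1 (_ : lshift m 0 = 0) ?ca//; exact/val_inj.
  by rewrite [j]ord1 (_ : lshift m 0 = 0) ?ca//; exact/val_inj.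
have d' : \det (drsubmx a) = 1 by move: da; rewrite {1}e det_ublock det1 mul1r.
have -> : a = block_mx 1%:M 0 0 (drsubmx a) *m block_mx 1%:M (ursubmx a) 0 1%:M.
  by rewrite mulmx_block !mulmx0 !mul0mx !mul1mx !mulmx1 !addr0 !add0r.
apply: gen_mul; first exact/gen_lift/IHm.
have -> : block_mx 1%:M (ursubmx a) 0 1%:M = @transv (1 + m) (cb 0) (row_mx 0 (ursubmx a)).
  rewrite /transv (_ : cb 0 = col_mx 1%:M 0 :> 'cV[int]_(1 + m)); last first.
    apply/colP => i; rewrite !mxE; case: splitP => j ij; rewrite !mxE.
      by rewrite [j]ord1 -val_eqE /= ij [j]ord1.
    by rewrite -val_eqE /= ij.
  by rewrite mul_col_row !mulmx0 !mul0mx (scalar_mx_block 1 m 1) add_block_mx mul1mx !addr0 !add0r.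
apply: gen_transv_row; rewrite mxE; case: splitP => j; last by [].
by rewrite mxE.
Qed.

Lemma gen_unit_col a i (u : int) : \det a = 1 -> u * u = 1 -> a i 0 = u ->
  (forall j, j != i -> a j 0 = 0) -> gen (elems 1) a.
Proof.
move=> da uu ai a0; have d1 (x : M) p q c : p != q -> \det x = 1 -> \det (elem p q c *m x) = 1.
  by move=> pq dx; rewrite det_mulmx dx mulr1 elem_det.
have [i0|i0] := eqVneq i 0.
  subst i; have [m0|mp] := posnP m.
    have k0 (k : 'I_(1 + m)) : k = 0 by apply: val_inj; have := ltn_ord k => /=; lia.
    have ea : a = u%:M by apply/matrixP => p q; rewrite mxE (k0 p) (k0 q) ai.
    apply: gen_first_col => // k; rewrite (k0 k) ai.
    by move: da; rewrite ea det_scalar m0 expr1.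
  have [j j0] : exists j : 'I_(1 + m), j != 0 by exists (rshift 1 (Ordinal mp)).
  have ji := j0; rewrite eq_sym in ji.
  (* On rows 0 and [j] the first column runs through (u, 0), (u, u), (1, u), (1, 0), by
     [u * u = 1]. *)
  apply: (@elem_cancel _ j 0 1) => //; apply: (@elem_cancel _ 0 j (u - 1)) => //.
  apply: (@elem_cancel _ j 0 (- u)) => //; apply: gen_first_col; first by do 3!apply: (d1) => //.
  move=> k; rewrite !elem_mulE !eqxx ?(negbTE j0) ?(negbTE ji) ?ai ?(a0 j)//.
  have [->|k0] := eqVneq k 0.
    rewrite ?(negbTE ji) ?ai /=; transitivity (u * u); [ring|exact: uu].
  rewrite a0//; have [_|kj] := eqVneq k j; rewrite /=; last by ring.
  transitivity (u - u * (u * u)); [ring|rewrite uu; ring].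
have i0' := i0; rewrite eq_sym in i0'.
(* On rows 0 and [i] the first column runs through (0, u), (1, u), (1, 0). *)
apply: (@elem_cancel _ 0 i u) => //; apply: (@elem_cancel _ i 0 (- u)) => //.
apply: gen_first_col; first by do 2!apply: (d1) => //.
move=> k; rewrite !elem_mulE !eqxx ai (a0 0)//.
have [->|k0] := eqVneq k 0.
  by rewrite (negbTE i0') a0//= mulr0 mul0r addr0 mulr1 add0r.
have [->|ki] := eqVneq k i; last by rewrite a0//= !(mulr0, mul0r, addr0).
rewrite ai /=; transitivity (u - u * (u * u)); [ring|rewrite uu; ring].
Qed.

Lemma euclid_step (x y : int) : x != 0 -> y != 0 -> (`|y| <= `|x|)%N ->
  exists c : int, (`|(x + c * y)%R| < `|x|)%N.
Proof.
move=> x0 y0 h; have [xp|xn] := leP 0 x; have [yp|yn] := leP 0 y.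
- exists (-1); lia.
- exists 1; lia.
- exists 1; lia.
- exists (-1); lia.
Qed.

(** Euclid's algorithm on the first column: while two entries are nonzero, a row operation lowers
    the sum of absolute values. A single nonzero entry divides the determinant and is a unit. *)
Lemma gen_SL_step (s : nat) a : \det a = 1 -> (\sum_i `|a i 0%R| <= s)%N -> gen (elems 1) a.
Proof.
elim: s a => [|s IH] a da hs.
all: have [[i [j [ij ai aj]]]|uniq] := pselect (exists i j, [/\ i != j, a i 0 != 0 & a j 0 != 0]).
- by move: hs; rewrite (bigD1 i)//= leqn0 addn_eq0 absz_eq0 (negbTE ai).
- have [i ai] : exists i, a i 0 != 0.
    apply: contrapT => h; have : \det a = 0; last by rewrite da.
    rewrite (expand_det_col a 0) big1// => k _; have [->|k0] := eqVneq (a k 0) 0.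
      by rewrite mul0r.
    by case: h; exists k.
  by move: hs; rewrite (bigD1 i)//= leqn0 addn_eq0 absz_eq0 (negbTE ai).
- wlog ji : i j ij ai aj / (`|a j 0%R| <= `|a i 0%R|)%N => [W|].
    have [h|/ltnW h] := leqP `|a j 0%R|%N `|a i 0%R|%N; first exact: (W i j).
    by apply: (W j i) => //; rewrite eq_sym.
  have [c hc] := euclid_step ai aj ji.
  apply: (elem_cancel (c := c) ij); apply: IH.
    by rewrite det_mulmx da mulr1 elem_det.
  rewrite -ltnS; apply: leq_trans hs; rewrite (bigD1 i)//= [X in (_ < X)%N](bigD1 i)//=.
  rewrite elem_mulE eqxx mulr1 -addSn leq_add// leq_sum// => k ki.
  by rewrite elem_mulE (negbTE ki) mulr0 mul0r addr0.
have [i ai] : exists i, a i 0 != 0.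
  apply: contrapT => h; have : \det a = 0; last by rewrite da.
  rewrite (expand_det_col a 0) big1// => k _; have [->|k0] := eqVneq (a k 0) 0.
    by rewrite mul0r.
  by case: h; exists k.
have a0 j : j != i -> a j 0 = 0.
  by move=> ji; apply/eqP; apply: contrapT => /negP aj; apply: uniq; exists j, i.
apply: (@gen_unit_col a i (a i 0)) => //.
have : a i 0 * cofactor a i 0 = 1.
  by rewrite -da (expand_det_col a 0) (bigD1 i)//= big1 ?addr0// => k /a0 ->; rewrite mul0r.
move: (a i 0) (cofactor a i 0) => u x ux.
have : (`|u| * `|x| = 1)%N by rewrite -abszM ux.
by move/eqP; rewrite muln_eq1 => /andP[/eqP hu _]; lia.
Qed.

End Euclid.

Lemma SL_elementary n (a : 'M[int]_n) : \det a = 1 -> gen (@elems n 1) a.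
Proof.
elim: n a => [|n IH] a da; first exact: SL_one.
exact: (gen_SL_step (m := n) IH da (leqnn _)).
Qed.

(** The bound on [b - a] makes it a divisor of [(size s)!], which serves as a common period wherever
    the lemma is applied. *)
Lemma pigeonhole_nat (T : Type) (Rl : nat -> T -> Prop) (s : seq T) :
  (forall m, exists2 x, List.In x s & Rl m x) ->
  exists a b x, [/\ (a < b)%N, (b - a <= size s)%N, Rl a x & Rl b x].
Proof.
move=> h; have /choice[f hf] : forall m, exists i, (i < size s)%N /\ forall x0, Rl m (nth x0 s i).
  move=> m.
  have [x xs hx] := h m; elim: s xs {h} => // y s IH [e|/IH[i [i1 i2]]].
    by exists 0%N; split=> //= _; rewrite e.
  by exists i.+1.
have : ~~ injectiveb (fun i : 'I_(size s).+1 => Ordinal (hf i).1).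
  apply/negP => /injectiveP /leq_card; rewrite !card_ord ltnn//.
move=> /injectivePn[i [j ij] [fij]].
wlog lij : i j ij fij / (i < j)%N => [W|].
  have [|l|/val_inj e] := ltngtP i j; first exact: W.
    by apply: (W j i) => //; rewrite eq_sym.
  by rewrite e eqxx in ij.
have s0 : (0 < size s)%N by have [h0 _] := hf 0%N; exact: leq_ltn_trans h0.
have x0 : T by case: (s) s0 => [|y ?].
exists i, j, (nth x0 s (f i)); split => //.
- by rewrite leq_subLR (leq_trans _ (leq_addl _ _))// -ltnS.
- by have [_ h2] := hf i; exact: h2.
- by rewrite fij; have [_ h2] := hf j; exact: h2.
Qed.

Lemma dvdn_factorial d m : (0 < d)%N -> (d <= m)%N -> exists q, (m`! = d * q)%N.
Proof. by move=> d0 dm; have /dvdnP[q ->] : (d %| m`!)%N by [apply: dvdn_fact; rewrite d0]; exists q; rewrite mulnC. Qed.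

Lemma invmxM n (a b : 'M[int]_n) : a \in unitmx -> b \in unitmx ->
  invmx (a *m b) = invmx b *m invmx a.
Proof.
move=> ua ub; rewrite -[RHS](mulmxK (_ : a *m b \in unitmx)) ?unitmx_mul ?ua//.
by rewrite !mulmxA mulmxKV// mulVmx// mul1mx.
Qed.

(** * One-parameter subgroups and a subgroup of finite index *)

Section FiniteIndex.
Variables (n : nat) (G : set 'M[int]_n).
Hypothesis Gfi : finite_index_subgroup_SLZ G.

Definition param (p : int -> 'M[int]_n) :=
  (forall a b, p (a + b) = p a *m p b) /\ forall a, SLZ n (p a).

Lemma SL_unit g : SLZ n g -> g \in unitmx.
Proof. by rewrite /SLZ /= unitmxE => ->; exact: unitr1. Qed.

Lemma param0 p : param p -> p 0 = 1%:M.
Proof.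
move=> [pD pS]; have := pD 0 0; rewrite addr0 => /(congr1 (mulmx (invmx (p 0)))).
by rewrite mulmxA mulVmx ?mul1mx ?SL_unit// => ->; rewrite // mulVmx ?SL_unit.
Qed.

Lemma param_inv p a : param p -> invmx (p a) = p (- a).
Proof.
move=> hp; have [pD pS] := hp.
have e : p (- a) *m p a = 1%:M by rewrite -pD addNr param0.
by rewrite -[LHS]mul1mx -e mulmxK ?SL_unit.
Qed.

Lemma param_mul p (d : int) c : param p -> G (p d) -> G (p (d * c)).
Proof.
move=> hp; have [pD pS] := hp; have [[_ G1 GM GV] _] := Gfi => Gd.
have Gn (m : nat) : G (p (d * m%:Z)).
  elim: m => [|m IH]; first by rewrite mulr0 param0.
  by rewrite -addn1 PoszD mulrDr mulr1 pD; exact: GM.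
case: c => [m|m]; first exact: Gn.
by rewrite NegzE mulrN -param_inv//; exact/GV/Gn.
Qed.

(** Two values of [p] with arguments at most [size s] apart lie in one left coset of [G], so [p d]
    is in [G] for a positive [d] dividing [(size s)!], a constant independent of [p]. *)
Lemma finite_index_param : exists K : nat, (0 < K)%N /\
  forall p, param p -> forall c, G (p (K%:Z * c)).
Proof.
have [[GS G1 GM GV] [s [_ hs]]] := Gfi.
exists (size s)`!; split; first exact: fact_gt0.
move=> p hp c; have [pD pS] := hp.
have [|a [b [g [ab bas [c1 Gc1 e1] [c2 Gc2 e2]]]]] :=
  @pigeonhole_nat _ (fun m g => exists2 c, G c & p m%:Z = g *m c) s.
  move=> m; have [g gs [c' Gc' e]] := hs _ (pS m%:Z); exists g; last by exists c'.
  by elim: (s) gs => //= x t IH; rewrite inE => /predU1P[->|/IH]; [left|right].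
have ba : (0 < b - a)%N by rewrite subn_gt0.
have Gd : G (p (b - a)%N%:Z).
  have -> : p (b - a)%N%:Z = invmx c1 *m c2; last by apply: GM => //; exact: GV.
  have -> : (b - a)%N%:Z = - a%:Z + b%:Z by lia.
  have c1u := SL_unit (GS _ Gc1).
  have gu : g \in unitmx by have := SL_unit (pS a%:Z); rewrite e1 unitmx_mul => /andP[].
  rewrite pD -param_inv// e1 e2.
  by rewrite invmxM// -mulmxA mulKmx.
have [q ->] := dvdn_factorial ba bas.
by rewrite PoszM -mulrA; exact: param_mul.
Qed.

End FiniteIndex.

(** * The quotient of SL_n(Z) by the conjugates of the e_ij(k c) *)

Section Quotient.
Variable n : nat.
Local Notation M := 'M[int]_n.
Hypothesis n3 : (2 < n)%N.
Implicit Types (a b g h : M).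

Lemma SL_mul a b : SLZ n a -> SLZ n b -> SLZ n (a *m b).
Proof. by rewrite /SLZ /= det_mulmx => -> ->; rewrite mulr1. Qed.

Lemma SL_inv a : SLZ n a -> SLZ n (invmx a).
Proof. by rewrite /SLZ /= det_inv => ->; rewrite invr1. Qed.

Lemma SL_elem i j c : i != j -> SLZ n (elem i j c).
Proof. exact: elem_det. Qed.

Definition conjs (k : int) : set M :=
  [set a | exists g i j c, [/\ SLZ n g, i != j & a = g *m elem i j (k * c) *m invmx g]].

Lemma conjs_SL k a : conjs k a -> SLZ n a.
Proof.
by move=> [g [i [j [c [Sg ij ->]]]]]; do !apply: SL_mul => //; [exact: SL_elem|exact: SL_inv].
Qed.

Lemma gen_SL k a : gen (conjs k) a -> SLZ n a.
Proof. by elim=> [|c d /conjs_SL Sc _ IH]; [rewrite /SLZ /= det1|exact: SL_mul]. Qed.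

Lemma conj_mul g a b : SLZ n g -> g *m (a *m b) *m invmx g = (g *m a *m invmx g) *m (g *m b *m invmx g).
Proof. by move=> /SL_unit gu; rewrite !mulmxA mulmxKV. Qed.

Lemma conjs_conj k h a : SLZ n h -> conjs k a -> conjs k (h *m a *m invmx h).
Proof.
move=> Sh [g [i [j [c [Sg ij ->]]]]]; exists (h *m g), i, j, c; split => //; first exact: SL_mul.
by rewrite invmxM ?SL_unit ?SL_mul// !mulmxA.
Qed.

Lemma gen_conj k h a : SLZ n h -> gen (conjs k) a -> gen (conjs k) (h *m a *m invmx h).
Proof.
move=> Sh; elim=> [|c d Sc _ IH]; first by rewrite mulmx1 mulmxV ?SL_unit//; exact: gen1.
by rewrite conj_mul//; apply: genM => //; exact: conjs_conj.
Qed.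

Lemma conjs_inv k a : conjs k a -> conjs k (invmx a).
Proof.
move=> [g [i [j [c [Sg ij ->]]]]]; exists g, i, j, (- c); split => //.
have gu := SL_unit Sg; have eu := elem_unit (k * c) ij.
rewrite !invmxM ?unitmx_mul ?gu ?eu ?unitmx_inv// invmxK mulmxA.
congr (_ *m _ *m _); rewrite -[LHS]mul1mx -(elem0 i j).
rewrite (_ : 0 = k * - c + k * c); last by rewrite mulrN addNr.
by rewrite -elemD// mulmxK.
Qed.

Lemma gen_inv k a : gen (conjs k) a -> gen (conjs k) (invmx a).
Proof.
elim=> [|c d Sc Sd IH]; first by rewrite invmx1; exact: gen1.
have cu := SL_unit (conjs_SL Sc); have du := SL_unit (gen_SL Sd); rewrite invmxM//.
by apply: gen_mul => //; apply: gen_in; exact: conjs_inv.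
Qed.

(** Equality in the quotient by the normal subgroup that [conjs k] generates. *)
Definition eqv k a b := exists2 c, gen (conjs k) c & a = b *m c.

Lemma eqv_refl k a : eqv k a a.
Proof. by exists 1%:M; [exact: gen1|rewrite mulmx1]. Qed.

Lemma eqv_trans k b a c : eqv k a b -> eqv k b c -> eqv k a c.
Proof.
move=> [x gx ->] [y gy ->]; exists (y *m x); last by rewrite mulmxA.
exact: gen_mul.
Qed.

Lemma eqv_mul k a b a' b' : SLZ n b' -> eqv k a b -> eqv k a' b' -> eqv k (a *m a') (b *m b').
Proof.
move=> Sb' [x gx ->] [y gy ->]; exists (invmx b' *m x *m b' *m y).
  apply: gen_mul => //; rewrite -{2}[b']invmxK; apply: gen_conj => //; exact: SL_inv.
by rewrite !mulmxA mulmxK// SL_unit.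
Qed.

Lemma conj_elemE g i j c : SLZ n g ->
  g *m elem i j c *m invmx g = transv (g *m cb i) (c *: (rb j *m invmx g)).
Proof.
move=> /SL_unit gu; rewrite /elem transv_conj; last exact: mulmxV.
by rewrite -scalemxAr transvZ.
Qed.

Lemma dot_conj g i j : SLZ n g -> dot (rb j *m invmx g) (g *m cb i) = (i == j)%:R.
Proof.
by move=> /SL_unit gu; rewrite /dot mulmxA mulmxKV// -/(dot _ _) dot_basis.
Qed.

Lemma conj_dots g i j c : SLZ n g -> i != j ->
  dot (rb i *m invmx g) (g *m cb i) = 1 /\ dot (c *: (rb j *m invmx g)) (g *m cb i) = 0.
Proof. by move=> Sg ij; rewrite dotZl !dot_conj// eqxx (negbTE ij) mulr0. Qed.

(** The conjugate is a transvection along the column [g *m cb i], unimodular because row [i] of the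
    inverse of [g] pairs to 1 with it. The factorization spends one factor [k] on each side of its
    commutators. *)
Lemma conj_elem_gen k g i j c : SLZ n g -> i != j ->
  gen (elems k) (g *m elem i j (k * k * c) *m invmx g).
Proof.
move=> Sg ij; have [uv wv] := conj_dots c Sg ij.
rewrite conj_elemE// -scalerA.
apply: (@factor_transv n (fun a _ => gen (elems k) a) (fun x _ => exists d, x = k * d)
  n3 _ _ _ k k (rb i *m invmx g) (c *: (rb j *m invmx g)) (g *m cb i)
  (rb i *m invmx g) (c *: (rb j *m invmx g)) (g *m cb i)) => //.
- exact: gen1.
- by move=> *; exact: gen_mul.
- by move=> p q x _ pq [d ->]; exact: elems_gen.
- by move=> e x; exists (e * (g *m cb i) x 0); ring.
- move=> e p q x; exists (e * ((c *: (rb j *m invmx g)) 0 p * (rb i *m invmx g) 0 q) * (g *m cb i) x 0).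
  ring.
- move=> e p q x y; exists (e * k * ((c *: (rb j *m invmx g)) 0 p * (rb i *m invmx g) 0 q) *
    (g *m cb i) x 0 * (g *m cb i) y 0); ring.
Qed.

Definition cong (k x y : int) := exists d, x = y + k * d.

Lemma cong_refl k x : cong k x x.
Proof. by exists 0; rewrite mulr0 addr0. Qed.

Lemma cong_mul k x y x' y' : cong k x y -> cong k x' y' -> cong k (x * x') (y * y').
Proof. by move=> [d ->] [d' ->]; exists (d * y' + y * d' + d * k * d'); ring. Qed.

(** The factorization writes both conjugates as the same word in elementary matrices, with exponents
    polynomial in [c] or [d] and the entries of the conjugating matrices and their inverses;
    congruent exponents give letters equal modulo [conjs k]. *)
Lemma conj_cong k g h i j c d : SLZ n g -> SLZ n h -> i != j ->
  (forall p q, cong k (g p q) (h p q)) ->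
  (forall p q, cong k ((invmx g) p q) ((invmx h) p q)) -> cong k c d ->
  eqv k (g *m elem i j c *m invmx g) (h *m elem i j d *m invmx h).
Proof.
move=> Sg Sh ij cg cgi cc; have [uv wv] := conj_dots c Sg ij.
have [uv' wv'] := conj_dots d Sh ij.
suff [] : SLZ n (transv (h *m cb i) ((1 * 1) *: (d *: (rb j *m invmx h)))) /\
    eqv k (transv (g *m cb i) ((1 * 1) *: (c *: (rb j *m invmx g))))
          (transv (h *m cb i) ((1 * 1) *: (d *: (rb j *m invmx h)))).
  by move=> _; rewrite mulr1 !scale1r -!conj_elemE.
have ev x (z : M) : (z *m cb i) x 0 = z x i by rewrite -colE mxE.
have ew x y (z : M) : (rb y *m z) 0 x = z y x by rewrite -rowE mxE.
have es f x y (z : M) : (f *: (rb y *m z)) 0 x = f * z y x by rewrite mxE ew.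
apply: (@factor_transv n (fun a b => SLZ n b /\ eqv k a b) (cong k)
  n3 _ _ _ 1 1 (rb i *m invmx g) _ _ (rb i *m invmx h) _ _) => //.
- by split; [rewrite /SLZ /= det1|exact: eqv_refl].
- by move=> a b a' b' [Sb ab] [Sb' ab']; split; [exact: SL_mul|exact: eqv_mul].
- move=> p q x y pq [z ->]; split; first exact: SL_elem.
  exists (elem p q (k * z)); last by rewrite elemD.
  apply: gen_in; exists 1%:M, p, q, z; split => //; first by rewrite /SLZ /= det1.
  by rewrite invmx1 mulmx1 mul1mx.
- by move=> e x; rewrite !ev; do !apply: cong_mul => //; exact: cong_refl.
- move=> e p q x; rewrite !ev !es !ew.
  by do !apply: cong_mul => //; exact: cong_refl.
- move=> e p q x y; rewrite !ev !es !ew.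
  by do !apply: cong_mul => //; exact: cong_refl.
Qed.

Section Finite.
Variable k' : nat.
Let k : int := k'.+1%:Z.

Let res (x : int) : 'I_k'.+1 := inord `|(x %% k)%Z|.

Let res_cong x y : res x = res y -> cong k x y.
Proof.
move/(congr1 (@nat_of_ord _)); have kn : k != 0 by [].
have lt z : (`|(z %% k)%Z| < k'.+1)%N.
  by have := ltz_pmod z (isT : 0 < k); have := modz_ge0 z kn; rewrite /k; lia.
rewrite !inordK// => e; exists ((x %/ k)%Z - (y %/ k)%Z).
have ex := divz_eq x k; have ey := divz_eq y k.
have em : (x %% k)%Z = (y %% k)%Z.
  by rewrite -(gez0_abs (modz_ge0 x kn)) -(gez0_abs (modz_ge0 y kn)) e.
move: ex ey; rewrite em; move: (x %/ k)%Z (y %/ k)%Z (y %% k)%Z => p q r -> ->; ring.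
Qed.

Let T : finType := ('I_n * 'I_n * 'I_k'.+1 * {ffun 'I_n * 'I_n -> 'I_k'.+1} *
  {ffun 'I_n * 'I_n -> 'I_k'.+1})%type.

(** Finitely many data that determine a letter up to [eqv], by [conj_cong]. *)
Let code g i j c : T := (i, j, res c, [ffun x => res (g x.1 x.2)],
  [ffun x => res (invmx g x.1 x.2)]).

Let letter := conjs 1.

Let classify : exists cl : M -> T, forall a, letter a -> exists g i j c,
  [/\ SLZ n g, i != j, a = g *m elem i j c *m invmx g & cl a = code g i j c].
Proof.
suff /choice[cl hcl] : forall a, exists t : T, letter a -> exists g i j c,
  [/\ SLZ n g, i != j, a = g *m elem i j c *m invmx g & t = code g i j c] by exists cl.
move=> a; have [[g [i [j [c [Sg ij ->]]]]]|na] := pselect (letter a).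
  by exists (code g i j (1 * c)) => _; exists g, i, j, (1 * c).
have i0 : 'I_n := Ordinal (ltn_trans (isT : (0 < 2)%N) n3).
by exists (code 1%:M i0 i0 0) => /na.
Qed.

Let prodm (l : seq M) := foldr mulmx 1%:M l.

Let prodm_cat l l' : prodm (l ++ l') = prodm l *m prodm l'.
Proof. by elim: l => [|a l IH] /=; rewrite ?mul1mx// IH mulmxA. Qed.

Let letters (l : seq M) := forall a, a \in l -> letter a.

Let prodm_SL l : letters l -> SLZ n (prodm l).
Proof.
elim: l => [|a l IH] h; first by rewrite /SLZ /= det1.
apply: SL_mul; first by apply: (@conjs_SL 1); apply: h; rewrite inE eqxx.
by apply: IH => b bl; apply: h; rewrite inE bl orbT.
Qed.

(* Dietzmann's argument: modulo the normal closure of the k-th powers there are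
   finitely many conjugates of elementary matrices, all of order dividing k. In a
   word where one of them occurs k times, move these occurrences to the front by
   conjugating the other letters, and cancel them; so words of bounded length
   suffice. *)
Lemma SL_quotient_finite : exists r : seq M, (forall g, g \in r -> SLZ n g) /\
  forall h, SLZ n h -> exists2 g, g \in r & eqv k h g.
Proof.
have [cl hcl] := classify.
have cl_eqv a b : letter a -> letter b -> cl a = cl b -> eqv k a b.
  move=> /hcl[g [i [j [c [Sg ij -> ->]]]]] /hcl[g' [i' [j' [c' [Sg' ij' -> ->]]]]].
  case=> ei ej ec eg egi; subst i' j'; apply: conj_cong => //.
  - by move=> p q; apply: res_cong; move/ffunP: eg => /(_ (p, q)); rewrite !ffunE.
  - by move=> p q; apply: res_cong; move/ffunP: egi => /(_ (p, q)); rewrite !ffunE.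
  - exact: res_cong.
have /choice[rep hrep] : forall t : T, exists a, (exists2 b, letter b & cl b = t) ->
    letter a /\ cl a = t.
  move=> t; have [[b lb eb]|nb] := pselect (exists2 b, letter b & cl b = t).
    by exists b.
  by exists 1%:M => /nb.
have repP a : letter a -> letter (rep (cl a)) /\ eqv k a (rep (cl a)).
  move=> la; have [|l1 e1] := hrep (cl a); first by exists a.
  by split => //; apply: cl_eqv.
have SLl a : letter a -> SLZ n a by exact: conjs_SL.
have gather t r l : letters l -> (r <= count (fun a => cl a == t) l)%N ->
    exists l', [/\ letters l', (size l' + r = size l)%N &
      eqv k (prodm l) (prodm (nseq r (rep t) ++ l'))].
  elim: l r => [|a l IH] [|r] hl //.
  - by move=> _; exists [::]; split => //; exact: eqv_refl.
  - by move=> _; exists (a :: l); rewrite addn0; split => //; exact: eqv_refl.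
  have la : letter a by apply: hl; rewrite inE eqxx.
  have hl' : letters l by move=> b bl; apply: hl; rewrite inE bl orbT.
  move=> hc0; have {}hc0 : (r.+1 <= (cl a == t) + count (fun a => cl a == t) l)%N := hc0.
  move: hc0; have [ea|na] := eqVneq (cl a) t.
    rewrite add1n ltnS => /(IH r hl')[l' [h1 h2 h3]]; exists l'; split => //.
      by rewrite addnS h2.
    have [lr er] := repP a la; rewrite ea in lr er.
    apply: eqv_mul => //; apply: prodm_SL => b; rewrite mem_cat => /orP[|/h1//].
    by move=> /nseqP[-> _].
  rewrite add0n => hc; have [l' [h1 h2 h3]] := IH r.+1 hl' hc.
  have lrep : letter (rep t).
    have /hasP[b bl /eqP eb] : has (fun a => cl a == t) l by rewrite has_count (leq_trans _ hc).
    by rewrite -eb; have [] := repP b (hl' _ bl).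
  have [x xE] : exists x, prodm (nseq r.+1 (rep t)) = x by exists (prodm (nseq r.+1 (rep t))).
  have Sx : SLZ n x by rewrite -xE; apply: prodm_SL => b /nseqP[-> _].
  exists ((invmx x *m a *m x) :: l'); split.
  - move=> b; rewrite inE => /predU1P[->|/h1//].
    by rewrite -{2}[x]invmxK; apply: conjs_conj => //; exact: SL_inv.
  - by rewrite /= addSn h2.
  rewrite prodm_cat xE (_ : prodm (_ :: l') = invmx x *m a *m x *m prodm l')//.
  rewrite !mulmxA mulmxV ?SL_unit// mul1mx -mulmxA.
  rewrite prodm_cat xE in h3; change (eqv k (a *m prodm l) (a *m (x *m prodm l'))).
  apply: (eqv_mul _ (eqv_refl _ _) h3).
  by apply: SL_mul => //; exact: prodm_SL.
have power t : (exists2 b, letter b & cl b = t) -> eqv k (prodm (nseq k'.+1 (rep t))) 1%:M.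
  move=> /hrep[[g [i [j [c [Sg ij e]]]]] _]; exists (prodm (nseq k'.+1 (rep t))); last by rewrite mul1mx.
  apply: gen_in; exists g, i, j, c; split => //.
  suff H m : prodm (nseq m (rep t)) = g *m elem i j (m%:Z * c) *m invmx g by rewrite H.
  elim: m => [|m IH] /=; first by rewrite mul0r elem0 mulmx1 mulmxV ?SL_unit.
  rewrite IH e -conj_mul// elemD//; congr (_ *m elem _ _ _ *m _).
  by rewrite mul1r -add1n PoszD mulrDl mul1r.
(* In a word of more than [B] letters some class occurs at least [k'.+1] times. *)
pose B := (#|T| * k'.+1)%N.
have short l : letters l -> exists l', [/\ letters l', (size l' <= B)%N & eqv k (prodm l) (prodm l')].
  have [m] := ubnP (size l); elim: m l => // m IH l lm hl.
  have [lB|Bl] := leqP (size l) B; first by exists l; split => //; exact: eqv_refl.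
  have [t ht] : exists t, (k'.+1 <= count (fun a => cl a == t) l)%N.
    apply: contrapT => nt; have : (size l <= B)%N; last by rewrite leqNgt Bl.
    have -> : size l = (\sum_(t : T) count (fun a => cl a == t) l)%N.
      elim: (l) => [|a s IHs] /=; first by rewrite big1.
      rewrite big_split /= -IHs (bigD1 (cl a))//= eqxx big1 ?addn0// => t.
      by rewrite eq_sym => /negbTE ->.
    rewrite /B -sum_nat_const; apply: leq_sum => t _; rewrite leqNgt; apply/negP => h.
    by apply: nt; exists t; exact: ltnW.
  have [l1 [h1 h2 h3]] := gather t _ l hl ht.
  have ex : exists2 b, letter b & cl b = t.
    have /hasP[b bl /eqP eb] : has (fun a => cl a == t) l by rewrite has_count (leq_trans _ ht).
    by exists b => //; exact: hl.
  have [|l2 [g1 g2 g3]] := IH l1 _ h1; first by rewrite -ltnS (leq_trans _ lm)// -h2 addnS ltnS ltnS leq_addr.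
  exists l2; split => //; apply: eqv_trans g3; apply: (eqv_trans h3).
  rewrite prodm_cat -[X in eqv _ _ X]mul1mx; apply: eqv_mul; last exact: eqv_refl.
    exact: prodm_SL.
  exact: power.
have reps l : letters l -> eqv k (prodm l) (prodm (map rep (map cl l))) /\ letters (map rep (map cl l)).
  elim: l => [|a l IH] hl; first by split; [exact: eqv_refl|].
  have [lr er] := repP a (hl a (mem_head _ _)).
  have [|e2 l2] := IH; first by move=> b bl; apply: hl; rewrite inE bl orbT.
  split; first by apply: eqv_mul => //; exact: prodm_SL.
  by move=> b; rewrite inE => /predU1P[->//|/l2].
pose R0 := [seq prodm (map rep (val t)) | m <- iota 0 B.+1, t <- enum {: m.-tuple T}].
exists [seq g <- R0 | `[< SLZ n g >]]; split => [g|h Sh].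
  by rewrite mem_filter => /andP[/asboolP].
have [l hl eh] : exists2 l, letters l & h = prodm l.
  elim: (SL_elementary Sh) => [|a b [i [j [c [ij ->]]]] _ [l hl ->]]; first by exists [::].
  exists (elem i j (1 * c) :: l) => // d; rewrite inE => /predU1P[->|/hl//].
  exists 1%:M, i, j, c; split => //; first by rewrite /SLZ /= det1.
  by rewrite invmx1 mulmx1 mul1mx.
have [l1 [h1 h2 h3]] := short l hl; have [h4 h5] := reps l1 h1.
exists (prodm (map rep (map cl l1))); last by rewrite eh; exact: eqv_trans h3 h4.
rewrite mem_filter; apply/andP; split; first by apply/asboolP; exact: prodm_SL.
have sz : size (map cl l1) == size l1 by rewrite size_map.
apply/allpairsPdep; exists (size l1), (Tuple sz); split; [by rewrite mem_iota ltnS|by rewrite mem_enum|by []].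
Qed.

End Finite.

End Quotient.

(** * Fixed points of congruence subgroups *)

Section CommutingFlows.
Context {R : realType} {X : metricType R}.
Hypothesis D : is_dendrite [set: X].
Implicit Types (A : int -> X -> X) (S : set X).

Lemma flow_fixed_closed A c : flow A -> closed [set x | A c x = x].
Proof.
move=> fA; apply/closed_mdistP => x hx.
have fc := (continuous_mdistP _).1 (@flow_cont _ _ _ fA c).
apply: mdist_lt_eq => e e0; have e2 : 0 < e / 2 by rewrite divr_gt0.
have [d d0 hd] := fc x _ e2.
have [|y /= Fy xy] := hx (Num.min d (e / 2)); first by rewrite lt_min d0.
move: xy; rewrite lt_min => /andP[/hd h1 h2]; rewrite Fy in h1.
rewrite (le_trans (metric_triangle _ y _))// [leRHS]splitr lerD// ltW//.
by rewrite metric_sym.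
Qed.

Lemma flow_fixed_median A c : flow A -> median_closed [set x | A c x = x].
Proof.
move=> fA a b d m /= ha hb hd m1 m2 m3; apply: (median_unique D m1 m2 m3).
- by rewrite -ha -hb; exact: flow_seg.
- by rewrite -hb -hd; exact: flow_seg.
- by rewrite -ha -hd; exact: flow_seg.
Qed.

(** Moving [A c] past [E y] costs a power of [Z c], which commutes with [E] and fixes [p]. *)
Lemma heis_preserves_fix A E Z k (c y : int) p : heis A E Z k -> A c p = p -> Z c p = p ->
  A c (E y p) = E y p.
Proof.
move=> H Ap Zp; have fZ := heis_c H.
have Zm d : Z (c * d) p = p.
  by apply: (@flow_fix _ _ (fun x => Z (c * x)) p (flow_scale c fZ)); rewrite mulr1.
have := heis_rel H c y p; rewrite Ap => /(congr1 (Z (- (k * c * y)))).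
rewrite (flowK _ fZ) => <-; rewrite (heis_cr H); congr (E y _).
by have -> : - (k * c * y) = c * (- (k * y)) by ring.
Qed.

(** Cutting [S] down to the points fixed by the square of one flow keeps it closed and closed under
    medians, and commutation keeps it invariant under the other flows; [fix_square] keeps it
    nonempty. *)
Lemma commuting_flows_fix (T : eqType) (A : T -> int -> X -> X) (s : seq T) S :
  (forall t, t \in s -> flow (A t)) ->
  (forall t u c d x, t \in s -> u \in s -> A t c (A u d x) = A u d (A t c x)) ->
  closed S -> median_closed S -> S !=set0 ->
  (forall t c x, t \in s -> S x -> S (A t c x)) ->
  exists2 x, S x & forall t, t \in s -> A t 2 x = x.
Proof.
elim: s S => [|t s IH] S fA cA cS mS S0 iS; first by have [x Sx] := S0; exists x.
have ft : flow (A t) by apply: fA; rewrite mem_head.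
have sub u : u \in s -> u \in t :: s by rewrite inE orbC => ->.
have [||p Sp tp] := fix_square D (@flow_cont _ _ _ ft 1) (@flow_cont _ _ _ ft (-1))
  (flowK 1 ft) (flowVK 1 ft) cS mS S0.
- by move=> x; apply: iS; rewrite mem_head.
- by move=> x; apply: iS; rewrite mem_head.
have [||||||x [Sx tx] hx] := IH (S `&` [set x | A t 2 x = x]).
- by move=> u /sub; exact: fA.
- by move=> u v c d x us vs; apply: cA; exact: sub.
- by apply: closedI => //; exact: flow_fixed_closed.
- move=> a b d m [Sa ta] [Sb tb] [Sd td] m1 m2 m3; split.
    exact: (mS a b d).
  exact: (flow_fixed_median ft ta tb td).
- by exists p; split => //=; rewrite -[2]/(1 + 1) (flowD ft).
- move=> u c x us [Sx /= tx]; split; first by apply: iS => //; exact: sub.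
  by rewrite /= cA ?tx ?mem_head//; exact: sub.
by exists x => // u; rewrite inE => /orP[/eqP->//|]; exact: hx.
Qed.

End CommutingFlows.

Lemma finite_set_list (T : Type) (A : set T) : finite_set A -> exists s : seq T, forall x, A x -> List.In x s.
Proof.
move=> /(@finite_seqP {classic T}) [s ->]; exists s => x /=.
by elim: s => //= a s IH; rewrite inE => /orP[/eqP->|/IH]; [left|right].
Qed.

(** * The congruence fixed point sets of an action *)

Section Action.
Context {R : realType} {X : metricType R}.
Variables (n : nat) (G : set 'M[int]_n) (act : 'M[int]_n -> X -> X).
Hypothesis n3 : (2 < n)%N.
Hypothesis D : is_dendrite [set: X].
Hypothesis Gfi : finite_index_subgroup_SLZ G.
Hypothesis Gact : is_action G act.
Variable K0 : int.
Hypothesis K0G : forall p, param p -> forall c, G (p (K0 * c)).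
Implicit Types (g h : 'M[int]_n) (x y z : X) (k : int).

Lemma actM g h x : G g -> G h -> act (g *m h) x = act g (act h x).
Proof. by case: Gact => _ _ _; apply. Qed.

Lemma act1 x : act 1%:M x = x.
Proof. by case: Gact. Qed.

Lemma act_cont g : G g -> continuous (act g).
Proof. by case: Gact => h _ _ _; exact: h. Qed.

Lemma GV g : G g -> G (invmx g).
Proof. by case: Gfi => [[_ _ _ GinvV] _]; exact: GinvV. Qed.

Lemma GM g h : G g -> G h -> G (g *m h).
Proof. by case: Gfi => [[_ _ mulG _] _]; exact: mulG. Qed.

Lemma G_SL g : G g -> SLZ n g.
Proof. by case: Gfi => [[GS _ _ _] _]; exact: GS. Qed.

Lemma actK g : G g -> cancel (act g) (act (invmx g)).
Proof.
move=> Gg x; rewrite -actM//; last exact: GV.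
by rewrite mulVmx ?act1// SL_unit//; exact: G_SL.
Qed.

Lemma actVK g : G g -> cancel (act (invmx g)) (act g).
Proof.
move=> Gg x; rewrite -actM//; last exact: GV.
by rewrite mulmxV ?act1// SL_unit//; exact: G_SL.
Qed.

Lemma act_inj g : G g -> injective (act g).
Proof. by move=> Gg; exact: can_inj (actK Gg). Qed.

Lemma param_flow p : param p -> (forall c, G (p c)) -> flow (fun c => act (p c)).
Proof.
move=> hp Gp; have [pD _] := hp; split=> [x|a b x|c]; last exact: act_cont.
  by rewrite param0// act1.
by rewrite pD actM.
Qed.

Lemma param_conj g i j : SLZ n g -> i != j -> param (fun c => g *m elem i j c *m invmx g).
Proof.
move=> Sg ij; split=> [a b|a].
  by rewrite -elemD// conj_mul.
by do !apply: SL_mul => //; [exact: SL_elem|exact: SL_inv].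
Qed.

Definition mult k := exists q, k = K0 * q.

Lemma mult_mul k c : mult k -> mult (k * c).
Proof. by move=> [q ->]; exists (q * c); rewrite mulrA. Qed.

Definition fam g k (i j : 'I_n) (x : int) := act (g *m elem i j (k * x) *m invmx g).

Lemma fam_G g k i j c : mult k -> SLZ n g -> i != j -> G (g *m elem i j (k * c) *m invmx g).
Proof. by move=> [q ->] Sg ij; rewrite -mulrA; exact: (K0G (param_conj Sg ij)). Qed.

Lemma fam_flow g k i j : mult k -> SLZ n g -> i != j -> flow (fam g k i j).
Proof.
move=> mk Sg ij; have [pD pS] := param_conj Sg ij.
apply: (@param_flow (fun c => g *m elem i j (k * c) *m invmx g)) => [|c]; last exact: fam_G.
by split=> [a b|a]; rewrite ?mulrDr ?pD//; exact: pS.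
Qed.

Lemma elem_commute (i j l m : 'I_n) c d : j != l -> m != i ->
  elem i j c *m elem l m d = elem l m d *m elem i j c.
Proof.
move=> jl mi; rewrite /elem !transvM !dotZr !dot_basis (eq_sym l) (eq_sym i).
by rewrite (negbTE jl) (negbTE mi) !mulr0 !scale0r !addr0 -!addrA [X in _ + X]addrC.
Qed.

(** Families that commute are kept as a Heisenberg relation with constant 0, so that [heis_tripod]
    covers them too. *)
Lemma fam_heis g k (i j l m : 'I_n) : mult k -> SLZ n g -> i != j -> i != m -> l != j ->
  heis (fam g k l j) (fam g k i m) (fam g k i j) (if m == l then k else 0).
Proof.
move=> mk Sg ij im lj; have gu := SL_unit Sg.
have ji : j != i by rewrite eq_sym.
have jl : j != l by rewrite eq_sym.
have comp p q r s c d x : p != q -> r != s ->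
    fam g k p q c (fam g k r s d x) = act (g *m (elem p q (k * c) *m elem r s (k * d)) *m invmx g) x.
  move=> pq rs; rewrite /fam -actM; [by rewrite conj_mul|exact: (fam_G c mk Sg pq)|exact: (fam_G d mk Sg rs)].
split; try exact: fam_flow.
- by move=> x y p; rewrite !comp// elem_commute.
- by move=> x y p; rewrite !comp// elem_commute// 1?eq_sym.
move=> x y p; rewrite !comp// {1}/fam -actM; last 2 first.
- by rewrite conj_mul//; apply: GM; exact: fam_G.
- exact: fam_G.
rewrite -conj_mul//; congr (act (_ *m _ *m _) p).
have [ml|ml] := eqVneq m l.
  by subst m; rewrite elem_comm// mulmxA; congr (elem _ _ _ *m _ *m _); ring.
by rewrite !mul0r mulr0 elem0 mul1mx elem_commute.
Qed.

Definition fixed k : set X :=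
  [set x | forall g i j, SLZ n g -> i != j -> fam g k i j 1 x = x].

Lemma fixed_mul k c : mult k -> fixed k `<=` fixed (k * c).
Proof.
move=> mk x hx g i j Sg ij; have := flow_fix (fam_flow mk Sg ij) (hx g i j Sg ij) c.
by rewrite /fam mulr1.
Qed.

Lemma fixed_closed k : mult k -> closed (fixed k).
Proof.
move=> mk; have -> : fixed k = \bigcap_(t in [set t : 'M[int]_n * ('I_n * 'I_n) |
    SLZ n t.1 /\ t.2.1 != t.2.2]) [set x | fam t.1 k t.2.1 t.2.2 1 x = x].
  apply/seteqP; split => x hx; first by move=> [g [i j]] [Sg ij]; exact: hx.
  by move=> g i j Sg ij; exact: (hx (g, (i, j)) (conj Sg ij)).
by apply: closed_bigI => t [Sg ij]; apply: flow_fixed_closed; exact: fam_flow.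
Qed.

Lemma fixed_invariant k h x : mult k -> G h -> fixed k x -> fixed k (act h x).
Proof.
move=> mk Gh hx g i j Sg ij; have Sh := G_SL Gh; have hu := SL_unit Sh.
have S1 : SLZ n (invmx h *m g) by apply: SL_mul => //; exact: SL_inv.
have := hx _ i j S1 ij; rewrite /fam => e.
rewrite -actM//; last exact: fam_G.
rewrite -{2}e -actM//; last exact: fam_G.
congr (act _ x); rewrite invmxM ?unitmx_inv ?SL_unit// invmxK !mulmxA mulmxV// mul1mx.
by rewrite -!mulmxA.
Qed.

Definition offdiag : finType := {ij : 'I_n * 'I_n | ij.1 != ij.2}.

(** The domination argument applies because every e_pq is a commutator of e_pl and e_lq for a third
    index l. *)
Lemma fam_fix_between g k o z : mult k -> SLZ n g ->
  (forall i j, i != j -> fam g k i j 1 o = o) -> k != 0 ->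
  (forall i j, i != j -> seg o z (fam g k i j 1 z) \/ seg o (fam g k i j 1 z) z) ->
  forall i j, i != j -> fam g k i j 1 z = z.
Proof.
move=> mk Sg ho k0 hz i j ij.
pose a (t : offdiag) := fam g k (val t).1 (val t).2.
apply: (@dominated_fix _ _ D offdiag a o z _ _ _ (exist _ (i, j) ij)).
- by move=> [[i' j'] ij'] /=; exact: ho.
- move=> [[p q] /= pq]; have [l /andP[pl lq]] := third p q n3.
  exists (exist _ (l, q) lq), (exist _ (p, l) pl), k; split => //.
  by have := fam_heis mk Sg pq pl lq; rewrite eqxx.
- by move=> [[i' j'] ij'] /=; exact: hz.
Qed.

(** All families preserve an arc with fixed ends and so move its points along it, where domination
    forces them to be trivial. *)
Lemma fixed_convex k : mult k -> k != 0 -> convex (fixed k).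
Proof.
move=> mk k0 x y hx hy z xyz g i j Sg.
apply: (fam_fix_between (o := x)) => // [p q pq|p q pq]; first exact: hx.
have := flow_seg D 1 (fam_flow mk Sg pq) xyz; rewrite (hx g p q Sg pq) (hy g p q Sg pq) => h.
by have [] := tree_linear D xyz h; [right|left].
Qed.

Lemma gen_fix (S : set 'M[int]_n) a x : S `<=` G -> (forall s, S s -> act s x = x) ->
  gen S a -> G a /\ act a x = x.
Proof.
move=> SG hS; elim=> [|c d Sc _ [Gd IH]].
  by split; [case: Gfi => [[]]|exact: act1].
have Gc := SG _ Sc; split; first exact: GM.
by rewrite actM// IH hS.
Qed.

Lemma fixed_of_elems k x : mult k -> (forall i j, i != j -> act (elem i j k) x = x) ->
  fixed (k * k) x.
Proof.
move=> mk hx g i j Sg ij; rewrite /fam mulr1 -[k * k]mulr1.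
have S1 : SLZ n 1%:M by rewrite /SLZ /= det1.
have := @conj_elem_gen n n3 k g i j 1 Sg ij.
case/(@gen_fix _ _ x) => //.
- by move=> _ [p [q [c [pq ->]]]]; have := fam_G c mk S1 pq; rewrite invmx1 mulmx1 mul1mx.
- move=> _ [p [q [c [pq ->]]]].
  have h : fam 1%:M k p q 1 x = x by rewrite /fam invmx1 mulmx1 mul1mx mulr1; exact: hx.
  by have := flow_fix (fam_flow mk S1 pq) h c; rewrite /fam invmx1 mulmx1 mul1mx.
Qed.

Lemma SL1 : SLZ n 1%:M. Proof. by rewrite /SLZ /= det1. Qed.

Definition eflow k (i j : 'I_n) := fam 1%:M k i j.

Lemma eflow_flow k i j : mult k -> i != j -> flow (eflow k i j).
Proof. by move=> mk ij; apply: fam_flow => //; exact: SL1. Qed.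

Lemma eflow_heis k p q r : mult k -> p != q -> q != r -> p != r ->
  heis (eflow k q r) (eflow k p q) (eflow k p r) k.
Proof. by move=> mk pq qr pr; have := fam_heis mk SL1 pr pq qr; rewrite eqxx. Qed.

Lemma eflow_comm k i j l m c d x : mult k -> i != m -> l != j -> i != j -> m != l ->
  eflow k l j c (eflow k i m d x) = eflow k i m d (eflow k l j c x).
Proof.
move=> mk im lj ij ml; have H := fam_heis mk SL1 ij im lj; rewrite (negbTE ml) in H.
have := heis_rel H c d x.
by rewrite !mul0r (flow0 (heis_c H)).
Qed.

Lemma eflow_mul k c d i j x : eflow k i j (c * d) x = eflow (k * c) i j d x.
Proof. by rewrite /eflow /fam mulrA. Qed.

Lemma eflow_fix_mul k c i j x : mult k -> i != j -> eflow k i j 1 x = x ->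
  eflow (k * c) i j 1 x = x.
Proof. by move=> mk ij h; rewrite -eflow_mul (flow_fix (eflow_flow mk ij) h). Qed.

Lemma eflow_fix_comp k p q r x : mult k -> p != q -> q != r -> p != r ->
  eflow k p q 1 x = x -> eflow k q r 1 x = x -> eflow (k * k) p r 1 x = x.
Proof.
move=> mk pq qr pr h1 h2; rewrite -eflow_mul mulr1.
by have := heis_fix_c 1 1 (eflow_heis mk pq qr pr) h2 h1; rewrite !mulr1.
Qed.

(** The flows in [P] commute with each other, and so do those in [Q]. A commutator between the two
    classes is trivial or again in [P], so [Q] preserves the common fixed points of the squares of
    [P], and the second stage takes place there. *)
Lemma two_stage_fix k (P Q : pred ('I_n * 'I_n)) : mult k ->
  (forall p, P p || Q p -> p.1 != p.2) ->
  (forall p r, P p -> P r -> p.2 != r.1) -> (forall p r, Q p -> Q r -> p.2 != r.1) ->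
  (forall p r, P p -> Q r -> [|| (p.2 != r.1) && (r.2 != p.1),
     [&& p.2 == r.1, r.2 != p.1 & P (p.1, r.2)] |
     [&& p.2 != r.1, r.2 == p.1 & P (r.1, p.2)]]) ->
  exists x, forall p, P p || Q p -> eflow (k * 2) p.1 p.2 1 x = x.
Proof.
move=> mk dPQ cP cQ cPQ.
have dP p : P p -> p.1 != p.2 by move=> h; apply: dPQ; rewrite h.
have dQ p : Q p -> p.1 != p.2 by move=> h; apply: dPQ; rewrite h orbT.
pose A (p : 'I_n * 'I_n) := eflow k p.1 p.2.
pose S := [set x : X | forall p, P p -> A p 2 x = x].
have inE' (U : pred ('I_n * 'I_n)) p : (p \in [seq p <- enum {: 'I_n * 'I_n} | U p]) = U p.
  by rewrite mem_filter mem_enum andbT.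
have [X0 _ _ _ _] := D.
have fAP p : P p -> flow (A p) by move=> /dP; exact: eflow_flow.
have [||||||x _ hx] := @commuting_flows_fix _ _ D _ A [seq p <- enum {: 'I_n * 'I_n} | P p] setT.
- by move=> p; rewrite inE'; exact: fAP.
- move=> p r c d x; rewrite !inE' => hp hr; apply: eflow_comm => //.
  + exact: dP.
  + exact: dP.
  + by rewrite eq_sym; exact: cP.
  + exact: cP.
- exact: closedT.
- by [].
- by [].
- by [].
have Sx : S x by move=> p hp; apply: hx; rewrite inE'.
have [||||||y Sy hy] := @commuting_flows_fix _ _ D _ A [seq p <- enum {: 'I_n * 'I_n} | Q p] S.
- by move=> p; rewrite inE' => /dQ; exact: eflow_flow.
- move=> p r c d z; rewrite !inE' => hp hr; apply: eflow_comm => //.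
  + exact: dQ.
  + exact: dQ.
  + by rewrite eq_sym; exact: cQ.
  + exact: cQ.
- have -> : S = \bigcap_(p in [set p | P p]) [set z | A p 2 z = z].
    by apply/seteqP; split=> z /= hz p hp; exact: hz.
  by apply: closed_bigI => p hp; apply: flow_fixed_closed; exact: fAP.
- move=> a b d m ha hb hd m1 m2 m3 p hp.
  exact: (flow_fixed_median D (fAP p hp) (ha p hp) (hb p hp) (hd p hp) m1 m2 m3).
- by exists x.
- move=> r c z; rewrite inE' => hr Sz p hp; have pp := dP _ hp; have rr := dQ _ hr.
  have /or3P[/andP[h1 h2]|/and3P[/eqP h1 h2 h3]|/and3P[h1 /eqP h2 h3]] := cPQ p r hp hr.
  + by rewrite /A eflow_comm// 1?eq_sym// -/(A p) Sz.
  + have H : heis (A r) (A p) (A (p.1, r.2)) k.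
      by rewrite /A /= -h1; apply: eflow_heis; rewrite // ?h1// eq_sym.
    exact: (heis_preserves_fix c (heis_sym H) (Sz _ hp) (Sz _ h3)).
  + have H : heis (A p) (A r) (A (r.1, p.2)) k.
      by rewrite /A /= -h2; apply: eflow_heis; rewrite // ?h2// eq_sym.
    exact: (heis_preserves_fix c H (Sz _ hp) (Sz _ h3)).
exists y => p; rewrite -eflow_mul mulr1 => /orP[/Sy//|hp].
by apply: hy; rewrite inE'.
Qed.
(** Any two of the three families have one of [x2], [x4], [x6] as common fixed point, and each of
    the two also fixes one of the remaining points: this is the configuration of [heis_tripod] at
    the median. The factor 2 comes from the squares in [two_stage_fix]. *)
Lemma elems_common_fix k (al be : 'I_n) : mult k -> k != 0 -> al != be ->
  exists m, [/\ forall i, i != al -> i != be -> eflow (k * 2) i al 1 m = m,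
    eflow (k * 2) al be 1 m = m &
    forall j, j != al -> j != be -> eflow (k * 2) be j 1 m = m].
Proof.
move=> mk0 k00 ab; have ba : be != al by rewrite eq_sym.
have [||||x2 h2] := @two_stage_fix k
    [pred p | [&& p.1 != al, p.1 != be & (p.2 == al) || (p.2 == be)]] (pred1 (al, be)) mk0.
- by move=> [p q] /orP[/and3P[/= pa pb /orP[]/eqP->//]|/eqP->].
- by move=> [p q] [r s] /and3P[/= pa pb qa] /and3P[/= ra rb sa];
    case/orP: qa => /eqP->; rewrite eq_sym.
- by move=> p r /eqP-> /eqP->.
- move=> [p q] [r s] /and3P[/= pa pb qa] /eqP[-> ->] /=; rewrite pa pb (eq_sym be) pb eqxx orbT /=.
  by case: (q == al); rewrite ?orbT.
have [||||x4 h4] := @two_stage_fix k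
    [pred p | [&& p.2 != al, p.2 != be & (p.1 == al) || (p.1 == be)]] (pred1 (al, be)) mk0.
- by move=> [p q] /orP[/and3P[/= pa pb /orP[]/eqP->]|/eqP->//]; rewrite eq_sym.
- by move=> [p q] [r s] /and3P[/= pa pb qa] /and3P[/= ra rb sa];
    case/orP: sa => /eqP->.
- by move=> p r /eqP-> /eqP->.
- move=> [p q] [r s] /and3P[/= pa pb qa] /eqP[-> ->] /=; rewrite pa pb eqxx /=.
  by rewrite eqxx; case: (be == p); rewrite ?orbT.
have [||||x6 h6] := @two_stage_fix k
    [pred p | (p.1 == be) && (p.2 != be)] [pred p | [&& p.1 != al, p.1 != be & p.2 == al]] mk0.
- by move=> [p q] /orP[/andP[/= /eqP-> qb]|/and3P[/= pa pb /eqP->//]]; rewrite eq_sym.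
- by move=> [p q] [r s] /andP[_ qb] /andP[/= /eqP-> _].
- by move=> [p q] [r s] /and3P[/= pa pb /eqP->] /and3P[/= ra rb sa]; rewrite eq_sym.
- move=> [p q] [r s] /andP[/= /eqP-> qb] /and3P[/= ra rb /eqP->] /=.
  by rewrite ab eqxx; case: (q == r).
have {h2} [h2a h2b h2c] : [/\ forall i, i != al -> i != be -> eflow (k * 2) i al 1 x2 = x2,
    forall i, i != al -> i != be -> eflow (k * 2) i be 1 x2 = x2 & eflow (k * 2) al be 1 x2 = x2].
  split=> [i ia ib|i ia ib|].
  - by apply: (h2 (i, al)); rewrite /= ia ib eqxx.
  - by apply: (h2 (i, be)); rewrite /= ia ib eqxx orbT.
  - by apply: (h2 (al, be)); rewrite /= !eqxx ?orbT.
have {h4} [h4a h4b h4c] : [/\ forall i, i != al -> i != be -> eflow (k * 2) al i 1 x4 = x4,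
    forall i, i != al -> i != be -> eflow (k * 2) be i 1 x4 = x4 & eflow (k * 2) al be 1 x4 = x4].
  split=> [i ia ib|i ia ib|].
  - by apply: (h4 (al, i)); rewrite /= ia ib eqxx.
  - by apply: (h4 (be, i)); rewrite /= ia ib eqxx orbT.
  - by apply: (h4 (al, be)); rewrite /= !eqxx ?orbT.
have {h6} [h6a h6b] : (forall i, i != al -> i != be -> eflow (k * 2) i al 1 x6 = x6) /\
    (forall j, j != be -> eflow (k * 2) be j 1 x6 = x6).
  split=> [i ia ib|j jb].
    by apply: (h6 (i, al)); rewrite /= ia ib eqxx orbT.
  by apply: (h6 (be, j)); rewrite /= eqxx jb.
have [m [m1 m2 m3]] := median_exists D x2 x4 x6.
have mk : mult (k * 2) by exact: mult_mul.
have k0 : k * 2 != 0 by rewrite mulf_neq0.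
move: (k * 2) mk k0 h2a h2b h2c h4a h4b h4c h6a h6b => {mk0 k00}k mk k0 h2a h2b h2c h4a h4b h4c h6a h6b.
pose a i := eflow k i al 1 m = m; pose b := eflow k al be 1 m = m; pose c j := eflow k be j 1 m = m.
pose I i := i != al /\ i != be.
(* Two of the three families fix the median [m] by [heis_tripod]; [heis_arc_fix]
   then gives the third. *)
have ac i j : I i -> I j -> a i \/ c j.
  move=> [ia ib] [ja jb]; have H : heis (eflow k i al) (eflow k be j) (eflow k be al) (if j == i then k else 0).
    by apply: (fam_heis mk SL1) => //; rewrite eq_sym.
  by apply: (heis_tripod D H (h6a _ ia ib) (h6b _ jb) (h2a _ ia ib) (h4b _ ja jb));
    rewrite // (segC D).
have bai i : I i -> b \/ a i.
  move=> [ia ib]; have H := eflow_heis mk ia ab ib.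
  by apply: (heis_tripod D H h2c (h2a _ ia ib) h4c (h6a _ ia ib)).
have cb j : I j -> c j \/ b.
  move=> [ja jb]; have H : heis (eflow k be j) (eflow k al be) (eflow k al j) k.
    by apply: eflow_heis; rewrite // eq_sym.
  apply: (heis_tripod D H (h4b _ ja jb) h4c (h6b _ jb) h2c); rewrite // (segC D)//.
have m3' : seg x6 x2 m by rewrite (segC D).
have m2' : seg x6 x4 m by rewrite (segC D).
have kkk : k * (- k) * k != 0 by rewrite !mulf_neq0// oppr_eq0.
have kkk2 : (- k) * k * (- k) != 0 by rewrite !mulf_neq0// oppr_eq0.
(* In the copy of SL_3 on the indices [i], [al], [be], each of the three flows is, up to multiples,
   the commutator of its own commutators with the other two. *)
have toa i : I i -> b -> c i -> a i.
  move=> [ia ib] hb hc; have [ai bi] : al != i /\ be != i by rewrite !(eq_sym _ i).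
  exact: (heis_arc_fix D (eflow_heis mk bi ia ba) (heis_sym (eflow_heis mk ia ab ib))
    (eflow_heis mk ib ba ia) kkk (h6a _ ia ib) (h6b _ ib) (h2a _ ia ib) h2c m3' hc hb).
have tob i : I i -> a i -> c i -> b.
  move=> [ia ib] ha hc; have [ai bi] : al != i /\ be != i by rewrite !(eq_sym _ i).
  exact: (heis_arc_fix D (eflow_heis mk ia ab ib) (heis_sym (eflow_heis mk ab bi ai))
    (eflow_heis mk ai ib ab) kkk h2c (h2a _ ia ib) h4c (h4b _ ia ib) m1 ha hc).
have toc i : I i -> a i -> b -> c i.
  move=> [ia ib] ha hb; have [ai bi] : al != i /\ be != i by rewrite !(eq_sym _ i).
  exact: (heis_arc_fix D (heis_sym (eflow_heis mk bi ia ba)) (eflow_heis mk ab bi ai)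
    (heis_sym (eflow_heis mk ba ai bi)) kkk2 (h6b _ ib) (h6a _ ia ib) (h4b _ ia ib) h4c _ ha hb).
have [l /andP[al_l l_b]] := third al be n3.
have Il : I l by rewrite /I eq_sym.
suff [hb hi] : b /\ forall i, I i -> a i /\ c i.
  by exists m; split=> // [i ia ib|j ja jb]; [case: (hi i)|case: (hi j)].
have [hb|nb] := pselect b.
  split=> // i Ii; have [h|h] := ac i i Ii Ii; first by split => //; exact: toc.
  by split => //; exact: toa.
have ha i : I i -> a i by move=> /bai[].
have hc i : I i -> c i by move=> /cb[].
by case: nb; apply: (tob l Il); [exact: ha|exact: hc].
Qed.

Lemma fixed_nonempty : K0 != 0 -> exists k, [/\ mult k, k != 0 & fixed k !=set0].
Proof.
move=> K00; have mK0 : mult K0 by exists 1; rewrite mulr1.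
have al0 : (0 < n)%N by exact: leq_trans n3.
have be0 : (1 < n)%N by exact: leq_trans n3.
pose al := Ordinal al0; pose be := Ordinal be0.
have ab : al != be by [].
have ba : be != al by [].
have [m [ha hb hc]] := elems_common_fix mK0 K00 ab.
have mk : mult (K0 * 2) by exact: mult_mul.
have k0 : K0 * 2 != 0 by rewrite mulf_neq0.
move: (K0 * 2) mk k0 ha hb hc => k mk k0 ha hb hc.
(* Commutators of the three families reach all pairs involving [al] or [be] at level [k2]; the
   remaining pairs are commutators through [al], at level [k3]. The last square, in [k3 * k3], is
   for [fixed_of_elems]. *)
pose k2 := k * k; pose k3 := k2 * k2.
have mk2 : mult k2 by exact: mult_mul.
have mk3 : mult k3 by exact: mult_mul.
have up p q : p != q -> eflow k2 p q 1 m = m -> eflow k3 p q 1 m = m.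
  by move=> pq h; apply: eflow_fix_mul.
have h2 p q : p != q -> (p == al) || (p == be) || (q == al) || (q == be) -> eflow k2 p q 1 m = m.
  move=> pq; have low : eflow k p q 1 m = m -> eflow k2 p q 1 m = m by exact: eflow_fix_mul.
  have [pa|pa] := eqVneq p al.
    subst p; have [->|qb] := eqVneq q be; first by move=> _; apply: eflow_fix_mul.
    move=> _; apply: (@eflow_fix_comp _ al be) => //; first by rewrite eq_sym.
    by apply: hc; rewrite // eq_sym.
  have [pb|pb] := eqVneq p be.
    subst p; have [qa|qa] := eqVneq q al.
      have [l /andP[al_l l_b]] := third al be n3; subst q => _.
      apply: (@eflow_fix_comp _ be l) => //; first by rewrite eq_sym.
      - by rewrite eq_sym.
      - by apply: hc => //; rewrite eq_sym.
      - by apply: ha => //; rewrite eq_sym.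
    by move=> _; apply: eflow_fix_mul => //; apply: hc => //; rewrite eq_sym.
  move=> /= /orP[]/eqP qq; subst q; first by apply: eflow_fix_mul => //; exact: ha.
  by apply: (@eflow_fix_comp _ p al) => //; exact: ha.
have h3 p q : p != q -> eflow k3 p q 1 m = m.
  move=> pq; case: (boolP ((p == al) || (p == be) || (q == al) || (q == be))) => [h|].
    by apply: up => //; exact: h2.
  rewrite !negb_or -!andbA => /and4P[pa pb qa qb].
  by apply: (@eflow_fix_comp _ p al) => //;
    [rewrite eq_sym|apply: h2; rewrite // eqxx !orbT|apply: h2; rewrite ?eqxx// eq_sym].
exists (k3 * k3); split; [exact: mult_mul|by rewrite !mulf_neq0|exists m].
apply: fixed_of_elems => // i j ij; have := h3 i j ij.
by rewrite /eflow /fam mul1mx invmx1 mulmx1 mulr1.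
Qed.

(** Each one-parameter group returns [y] to itself after at most as many steps as the list of the
    orbit is long; the factorial is a period for all groups at once. *)
Lemma finite_orbit_fixed y : K0 != 0 -> finite_set [set act g y | g in G] ->
  exists k, [/\ mult k, k != 0 & fixed k y].
Proof.
move=> K00 /finite_set_list[s hs]; have mK : mult K0 by exists 1; rewrite mulr1.
exists (K0 * (size s)`!%:Z); split; [exact: mult_mul|by rewrite mulf_neq0// -lt0n fact_gt0|].
move=> g i j Sg ij; have fA := fam_flow mK Sg ij.
have [m|a [b [x [ab bas ha hb]]]] := @pigeonhole_nat _ (fun m x => x = fam g K0 i j m%:Z y) s.
  by exists (fam g K0 i j m%:Z y) => //; apply: hs; eexists; last reflexivity; exact: fam_G.
have hd : fam g K0 i j (b - a)%N%:Z y = y.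
  have : fam g K0 i j b%:Z y = fam g K0 i j a%:Z y by rewrite -ha.
  rewrite -{1}(subnKC (ltnW ab)) PoszD (flowD fA).
  exact: (flow_inj fA).
have d0 : (0 < b - a)%N by rewrite subn_gt0.
have [q ->] := dvdn_factorial d0 bas.
have := flow_fix (flow_scale (b - a)%N%:Z fA) (p := y); rewrite mulr1 => /(_ hd q%:Z).
by rewrite /fam mulr1 PoszM.
Qed.

Lemma chain_min (T : Type) (s : list T) (w : T -> X) y x : x <> y ->
  (forall t, seg y x (w t) /\ w t <> y) ->
  exists z, [/\ z <> y, seg y x z & forall t, List.In t s -> seg y (w t) z].
Proof.
move=> xy hw; elim: s => [|t s [z [zy xz hz]]]; first by exists x; split=> //; exact: seg_r.
have [wx wy] := hw t; have [h|h] := tree_linear D xz wx.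
  exists z; split=> // u [<-|/hz]//.
exists (w t); split=> // u [<-|/hz h']; first exact: seg_r.
exact: (tree_trans D h h').
Qed.

(* Since [y] has finite order, two of the iterates of [x] lie in the same component
   of the complement of [y]. *)
Lemma eflow_same_component k i j y x : mult k -> i != j -> eflow k i j 1 y = y ->
  x <> y -> finite_order y ->
  exists2 N : nat, (0 < N)%N & forall M : nat, (N <= M)%N -> ~ seg x (eflow k i j M`!%:Z x) y.
Proof.
move=> mk ij hy xy /finite_set_list[s hs]; have fA := eflow_flow mk ij.
have Ay c : eflow k i j c y = y := flow_fix fA hy c.
have Axy c : eflow k i j c x <> y by rewrite -(Ay c) => /(flow_inj fA).
have [m|a [b [C [ab bas ha hb]]]] := @pigeonhole_nat _
    (fun m C => C = connected_component (~` [set y]) (eflow k i j m%:Z x)) s.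
  by eexists; last reflexivity; apply: hs; exists (eflow k i j m%:Z x) => //=; exact: Axy.
have d0 : (0 < b - a)%N by rewrite subn_gt0.
have hd : ~ seg x (eflow k i j (b - a)%N%:Z x) y.
  move=> /(flow_seg D a%:Z fA); rewrite -(flowD fA) -PoszD (subnKC (ltnW ab)) Ay.
  apply/(component_seg D); [exact/nesym|exact/nesym|].
  by rewrite -ha hb; apply: connected_component_refl; exact: Axy.
have hq (q : nat) : ~ seg x (eflow k i j ((b - a)%N%:Z * q%:Z) x) y.
  elim: q => [|q IH]; first by rewrite mulr0 (flow0 fA) (segxx D) => /nesym.
  rewrite -addn1 PoszD mulrDr mulr1 (flowD fA).
  move=> /(@seg_tri _ _ D _ _ (eflow k i j ((b - a)%N%:Z * q%:Z) x))[//|].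
  by rewrite -{1}(Ay ((b - a)%N%:Z * q%:Z)) => /(flow_seg D (- ((b - a)%N%:Z * q%:Z)) fA); rewrite !(flowK _ fA).
exists (b - a)%N => // M bM; have [q ->] := dvdn_factorial d0 bM.
by rewrite PoszM.
Qed.

(** For a suitable multiple of each e_ij, [x] and its image lie in the same component off [y], so
    the arcs from [y] to them share an initial part [y, m] with [m <> y]. The preimage [w] of [m]
    lies on [y, x] and is mapped into [y, x]; the least of these finitely many [w] satisfies the
    comparability that [fam_fix_between] asks for. *)
Lemma fixed_germ k y x : mult k -> k != 0 -> fixed k y -> x <> y -> finite_order y ->
  exists k' z, [/\ mult k', k' != 0, fixed k' z, z <> y & seg y x z].
Proof.
move=> mk k0 hy xy fy.
have ry i j : i != j -> eflow k i j 1 y = y by move=> ij; apply: hy => //; exact: SL1.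
pose T : finType := {ij : 'I_n * 'I_n | ij.1 != ij.2}.
have /choice[N hN] : forall t : T, exists N : nat, forall M : nat, (N <= M)%N ->
    ~ seg x (eflow k (val t).1 (val t).2 M`!%:Z x) y.
  by move=> [[i j] ij]; have [N _ hN] := eflow_same_component mk ij (ry _ _ ij) xy fy; exists N.
pose L := (\max_t N t)`!; pose k1 := k * L%:Z.
have mk1 : mult k1 by exact: mult_mul.
have k10 : k1 != 0 by rewrite mulf_neq0// -lt0n fact_gt0.
have ry1 i j : i != j -> eflow k1 i j 1 y = y.
  by move=> ij; apply: eflow_fix_mul => //; exact: ry.
have /choice[w hw] : forall t : T, exists w : X, [/\ seg y x w, w <> y &
    seg y x (eflow k1 (val t).1 (val t).2 1 w)].
  move=> [[i j] /= ij]; have fA := eflow_flow mk1 ij; have Ay := flow_fix fA (ry1 _ _ ij).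
  have [m [m1 m2 m3]] := median_exists D y x (eflow k1 i j 1 x).
  have my : m <> y.
    move=> e; move: m2; rewrite e /k1 -eflow_mul mulr1.
    by apply: (hN (exist _ (i, j) ij)); exact: leq_bigmax.
  exists (eflow k1 i j (- 1) m); split.
  - by apply: (flow_segV D fA); rewrite Ay.
  - by rewrite -(Ay (-1)) => /(flow_inj fA).
  - by rewrite (flowVK 1 fA).
have [z [zy xz hz]] := @chain_min _ (enum T) w y x xy (fun t => let: And3 a b _ := hw t in conj a b).
have inT (t : T) : List.In t (enum T).
  have : t \in enum T by rewrite mem_enum.
  by elim: (enum T) => //= a s IH; rewrite inE => /orP[/eqP->|/IH]; [left|right].
have fz : fixed (k1 * k1) z.
  apply: fixed_of_elems => // i j ij.
  suff : eflow k1 i j 1 z = z by rewrite /eflow /fam mul1mx invmx1 mulmx1 mulr1.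
  apply: (fam_fix_between (o := y)) => // [|p q pq]; first exact: SL1.
  have [_ _ h1] := hw (exist _ (p, q) pq); have fA := eflow_flow mk1 pq.
  have h2 := flow_seg D 1 fA (hz (exist _ (p, q) pq) (inT _)).
  rewrite (ry1 _ _ pq) in h2.
  have h3 : seg y x (eflow k1 p q 1 z) := tree_trans D h2 h1.
  by have [h|h] := tree_linear D xz h3; [right|left].
exists (k1 * k1), z; split=> //; [exact: mult_mul|by rewrite mulf_neq0].
Qed.

(** Representatives of the classes may lie outside [G], where [act] is not constrained, so two
    elements of [G] in one class are compared with each other: they differ by a word in letters that
    act trivially on [fixed k]. *)
Lemma fixed_finite_action k : mult k -> k != 0 ->
  exists (r : seq 'M[int]_n) (c : 'M[int]_n -> 'M[int]_n),
  (forall g, G g -> c g \in r) /\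
  forall g h, G g -> G h -> c g = c h -> forall z, fixed k z -> act g z = act h z.
Proof.
move=> mk k0.
have [k' hk'] : exists k' : nat, k'.+1%:Z = k * sgz k.
  by exists `|k|%N.-1; rewrite prednK ?absz_gt0// abszEsg mulrC.
have mk' : mult k'.+1%:Z by rewrite hk'; exact: mult_mul.
have [r [rS hr]] := SL_quotient_finite n3 k'.
have /choice[c hc] : forall h, exists g, SLZ n h -> g \in r /\ eqv k'.+1%:Z h g.
  move=> h; have [Sh|nh] := pselect (SLZ n h); last by exists 1%:M.
  by have [g gr hg] := hr h Sh; exists g.
exists r, c; split=> [g Gg|g h Gg Gh cgh z hz]; first by case: (hc g (G_SL Gg)).
have [cr [a ga eg]] := hc g (G_SL Gg); have [_ [b gb eh]] := hc h (G_SL Gh).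
have -> : g = h *m (invmx b *m a).
  by rewrite {1}eh mulmxA mulmxK ?SL_unit//; [rewrite -cgh|exact: gen_SL gb].
have [|||Gba ba] := @gen_fix (conjs k'.+1%:Z) (invmx b *m a) z.
- by move=> _ [p [i [j [d [Sp ij ->]]]]]; exact: fam_G.
- move=> _ [p [i [j [d [Sp ij ->]]]]].
  have hz' : fam p k'.+1%:Z i j 1 z = z by rewrite hk'; exact: (fixed_mul (sgz k) mk hz Sp ij).
  exact: (flow_fix (fam_flow mk' Sp ij) hz' d).
- by apply: gen_mul => //; exact: gen_inv.
by rewrite (actM _ Gh Gba) ba.
Qed.

(** Every level divides one of the form k1 i!, so the sequence of these levels exhausts the union of
    all fixed point sets. *)
Lemma fixed_factorial k1 k : mult k -> k != 0 -> fixed k `<=` fixed (k1 * (absz k)`!%:Z).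
Proof.
move=> mk k0; have k'0 : (0 < `|k|)%N by rewrite absz_gt0.
have [q ->] := dvdn_factorial k'0 (leqnn _).
have -> : k1 * (`|k| * q)%N%:Z = k * (sgz k * k1 * q%:Z) by rewrite PoszM abszEsg; ring.
exact: fixed_mul.
Qed.

Lemma fixed_factorial_mono k i j : mult k -> (i <= j)%N ->
  fixed (k * i`!%:Z) `<=` fixed (k * j`!%:Z).
Proof.
move=> mk /subnKC <-; elim: (j - i)%N => [|l IH] x hx; first by rewrite addn0.
have -> : k * (i + l.+1)`!%:Z = k * (i + l)`!%:Z * (i + l).+1%:Z.
  by rewrite addnS factS mulnC PoszM mulrA.
by apply: fixed_mul; [exact: mult_mul|exact: IH].
Qed.

End Action.

(** * First point maps and inverse limits *)

Section Retraction.
Context {R : realType} {X : metricType R}.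
Hypothesis D : is_dendrite [set: X].
Implicit Types (a b c m x y z : X) (Y Z U V : set X).

(** The first point as a universal property, least among the points of [Y] in the order rooted at
    [x]; uniqueness and equivariance become formal. *)
Definition gate Y x m := Y m /\ forall y, Y y -> seg x y m.

Definition retr Y x : X := xget x [set m | gate Y x m].

Lemma gate_unique Y x m m' : gate Y x m -> gate Y x m' -> m = m'.
Proof.
by move=> [Ym hm] [Ym' hm']; apply: (tree_anti D (o := x)); [exact: hm|exact: hm'].
Qed.

Lemma gate_retr Y x m : gate Y x m -> retr Y x = m.
Proof.
by move=> hm; rewrite /retr; case: xgetP => [y _ hy|/(_ m)//]; exact: gate_unique hy hm.
Qed.

Lemma gate_first_point Y x m : gate Y x m -> first_point Y x m.
Proof.
move=> [Ym hm]; split => //; exists (seg x m); split; first exact: (segP D).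
apply/seteqP; split => [z [xz Yz]|_ ->] /=; last by split => //; exact: (seg_r D).
exact: (tree_anti D xz (hm z Yz)).
Qed.

Lemma convex_cover (e : R) : 0 < e -> exists (P : X -> set X) (s : seq X),
  (forall x, [/\ open (P x), P x x, P x `<=` [set y | mdist x y < e] & convex (P x)]) /\
  forall y, exists2 x, x \in s & P x y.
Proof.
move=> e0; have [_ cX _ _ _] := D.
have /choice[P hP] : forall x, exists V,
    [/\ open V, V x, V `<=` [set y | mdist x y < e] & convex V].
  move=> x; have ox := @open_dist_lt _ _ x e.
  have [|V [? ? ? _ ?]] := @convex_nbhd _ _ D x [set y | mdist x y < e] ox.
    by rewrite /= mdistxx.
  by exists V.
have [|s [_ hs]] := @compact_subcover _ _ _ P cX; first by move=> x _; have [] := hP x.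
by exists P, s; split => // y; exact: hs.
Qed.

Section ClosedConvex.
Variable Y : set X.
Hypotheses (cY : closed Y) (vY : convex Y) (Y0 : Y !=set0).

Lemma retrP x : gate Y x (retr Y x).
Proof.
have [y0 Yy0] := Y0; have [m [Ym _ hm]] := gate_exists D x cY Yy0.
suff h : gate Y x m by rewrite (gate_retr h).
split=> // y Yy; have [w [w1 w2 w3]] := median_exists D x m y.
suff <- : w = m by [].
by change ([set m] w); rewrite -hm; split => //; exact: (vY Ym Yy).
Qed.

Lemma retr_in x : Y (retr Y x). Proof. by case: (retrP x). Qed.

Lemma retr_id x : Y x -> retr Y x = x.
Proof. by move=> Yx; apply: gate_retr; split => // y _; exact: seg_l. Qed.

Lemma retr_convex V x y : convex V -> V x -> V y -> Y y -> V (retr Y x).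
Proof. by move=> vV Vx Vy Yy; have [_ h] := retrP x; exact: (vV x y Vx Vy _ (h y Yy)). Qed.

Lemma retr_const V x z : convex V -> V x -> V z -> (forall y, Y y -> ~ V y) ->
  retr Y z = retr Y x.
Proof.
move=> vV Vx Vz VY; apply: gate_retr; have [Ym hm] := retrP x; split => // y Yy.
have [h|//] := @seg_tri _ _ D x y z _ (hm y Yy).
by case: (VY _ Ym); exact: (vV x z Vx Vz).
Qed.

(** A convex neighbourhood of a point of [Y] is mapped into itself, and a convex set that misses [Y]
    is mapped to one point. *)
Lemma retr_continuous : continuous (retr Y).
Proof.
move=> x U /=; rewrite nbhsE => -[U' [oU' Ux] UU'].
have [Yx|Yx] := pselect (Y x).
  rewrite (retr_id Yx) in Ux; have [V [oV Vx VU _ vV]] := convex_nbhd D oU' Ux.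
  rewrite nbhsE /=; exists V => // z Vz; apply: UU'; apply: VU.
  exact: (retr_convex vV Vz Vx Yx).
have [V [oV Vx VU _ vV]] := convex_nbhd D (closed_openC cY) Yx.
rewrite nbhsE /=; exists V => // z Vz /=; rewrite (retr_const vV Vx Vz); first exact: UU'.
by move=> y Yy /VU.
Qed.

Lemma retr_equivariant (g : X -> X) x : continuous g -> injective g ->
  (forall y, Y y -> Y (g y)) -> (forall y, Y y -> exists2 y', Y y' & g y' = y) ->
  retr Y (g x) = g (retr Y x).
Proof.
move=> gc gi gY gY'; apply: gate_retr; have [Ym hm] := retrP x; split; first exact: gY.
by move=> _ /gY'[y Yy <-]; apply: (seg_map D gc gi); exact: hm.
Qed.

Lemma retr_image : retr Y @` setT = Y.
Proof.
apply/seteqP; split=> [_ [x _ <-]|y Yy]; first exact: retr_in.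
by exists y => //; exact: retr_id.
Qed.

Lemma convex_inter_connected V : connected V -> convex V -> connected (V `&` Y).
Proof.
move=> cV vV; have [[y [Vy Yy]]|no] := pselect (V `&` Y !=set0); last first.
  have -> : V `&` Y = set0 by apply/seteqP; split => // y h; case: no; exists y.
  exact: connected0.
have -> : V `&` Y = retr Y @` V.
  apply/seteqP; split=> [z [Vz Yz]|_ [z Vz <-]]; first by exists z => //; exact: retr_id.
  by split; [exact: (retr_convex vV Vz Vy Yy)|exact: retr_in].
apply: connected_continuous_connected => //.
exact: continuous_subspaceT retr_continuous.
Qed.

Lemma convex_dendrite : is_dendrite Y.
Proof.
have [_ cX conX _ nscc] := D; split => //.
- exact: (subclosed_compact cY cX).
- by rewrite -[Y]setTI; exact: convex_inter_connected.
- move=> x Yx U oU Ux; have [V [oV Vx VU cV vV]] := convex_nbhd D oU Ux.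
  exists V; split => //; first by move=> z [/VU].
  exact: convex_inter_connected.
- by move=> [f [f1 [f2 _]]]; apply: nscc; exists f.
Qed.

(** Cover by finitely many small convex sets. In one that meets [Y], points stay in it under
    [retr Y]; one that misses [Y] has a single image, and these images make up the exceptional
    list. *)
Lemma small_fibers (e : R) : 0 < e -> exists s : seq X, forall x, ~ retr Y x \in s ->
  mdist (retr Y x) x < e.
Proof.
move=> e0; have e2 : 0 < e / 2 by rewrite divr_gt0.
have [P [s [hP hs]]] := convex_cover e2.
exists [seq retr Y x | x <- s] => x hx.
have [w ws Pw] := hs x; have [_ Pww PU vP] := hP w.
have [[y [Yy Py]]|no] := pselect (exists y, Y y /\ P w y).
  have h := PU _ (retr_convex vP Pw Py Yy).
  rewrite (le_lt_trans (metric_triangle _ w _))// [ltRHS]splitr ltrD//; last exact: PU.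
  by rewrite metric_sym.
case: hx; rewrite (retr_const vP Pww Pw); first by apply/mapP; exists w.
by move=> y Yy Py; apply: no; exists y.
Qed.

End ClosedConvex.
End Retraction.

(** * Inverse limits of subdendrites *)

Section Subspace.
Context {R : realType} {X : metricType R}.

(** A named subtype that carries the restricted metric, since the terms of an inverse system have to
    be metric types. *)
Definition subm (S : set X) := {x : X | S x}.

Variable S : set X.

HB.instance Definition _ := gen_eqMixin (subm S).
HB.instance Definition _ := gen_choiceMixin (subm S).

Lemma subm_eq (x y : subm S) : sval x = sval y -> x = y.
Proof. by case: x y => [x hx] [y hy] /= xy; exact: eq_exist. Qed.

Let subm_dist (x y : subm S) := mdist (sval x) (sval y).

Let subm_dist_positivity x y : subm_dist x y = 0 -> x = y.
Proof. by move=> /mdist_positivity/subm_eq. Qed.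

HB.instance Definition _ := isMetric.Build R (subm S)
  (fun x => mdistxx (sval x)) subm_dist_positivity
  (fun x y => metric_sym (sval x) (sval y))
  (fun y x z => metric_triangle (sval x) (sval y) (sval z)).

Lemma subm_mdist (x y : subm S) : mdist x y = mdist (sval x) (sval y).
Proof. by []. Qed.

Lemma subm_compact : compact S -> compact [set: subm S].
Proof.
move=> cS; have [[x0 Sx0]|no] := pselect (S !=set0); last first.
  have -> : [set: subm S] = set0 by apply/seteqP; split => // -[x Sx]; case: no; exists x.
  exact: compact0.
pose f (x : X) : subm S := if pselect (S x) is left h then exist _ x h else exist _ x0 Sx0.
have -> : [set: subm S] = f @` S.
  apply/seteqP; split => // -[x Sx] _; exists x => //; rewrite /f.
  by case: pselect => // h; exact: subm_eq.
apply: continuous_compact => //; apply/within_mdistP => x e Sx e0; exists e => // y Sy.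
by rewrite /f; case: pselect => // hx; case: pselect.
Qed.

End Subspace.

Lemma prod_continuous (T : topologicalType) (I : Type) (Z : I -> topologicalType)
    (f : T -> prod_topology Z) :
  (forall i, continuous (fun x => f x i)) -> continuous f.
Proof.
move=> hf x; apply/cvg_sup => i U [_ [[V oV <-] Vfx]] /filterS; apply.
by apply: (hf i x); apply: open_nbhs_nbhs.
Qed.

Section Approximation.
Context {R : realType} {X : metricType R}.
Hypothesis D : is_dendrite [set: X].
Implicit Types (x y z : X) (Y V : set X) (Z : nat -> set X).

Lemma retr_comp Y Y' x : closed Y -> convex Y -> Y !=set0 -> closed Y' -> convex Y' ->
  Y `<=` Y' -> retr Y (retr Y' x) = retr Y x.
Proof.
move=> cY vY Y0 cY' vY' YY'; have Y0' : Y' !=set0 by have [y /YY'] := Y0; exists y.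
apply/esym/gate_retr => //; have [h1 h2] := retrP D cY vY Y0 (retr Y' x).
split=> // y Yy; have [h3 h4] := retrP D cY' vY' Y0' x.
exact: (seg_subr D (h4 y (YY' _ Yy)) (h2 y Yy)).
Qed.

(** A point of [a, b] off the closure of [Y] still separates points of [Y] close to [a] and [b], so
    it would lie in [Y]. *)
Lemma closure_convex Y : convex Y -> convex (closure Y).
Proof.
move=> vY a b ha hb c abc; apply: contrapT => nc.
have oC : open (~` closure Y) by apply: closed_openC; exact: closed_closure.
have nca : c <> a by move=> e; rewrite e in nc.
have ncb : c <> b by move=> e; rewrite e in nc.
have near d : closure Y d -> c <> d -> exists2 d', Y d' & ~ seg d d' c.
  move=> hd cd; have [||V [oV Vd Vc _ vV]] := @convex_nbhd _ _ D d (~` [set c]).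
  - by apply: closed_openC; apply: compact_closed_metric; exact: compact_set1.
  - by move=> /= /esym.
  have [d' [Yd' Vd']] : (Y `&` V) !=set0 by apply: hd; exact: open_nbhs_nbhs.
  by exists d' => // h; exact: (Vc c (vV d d' Vd Vd' c h)).
have [a' Ya' ha'] := near a ha nca; have [b' Yb' hb'] := near b hb ncb.
have [//|h1] := @seg_tri _ _ D a b a' c abc.
have [h2|h2] := @seg_tri _ _ D a' b b' c h1; last by rewrite (segC D) in hb'.
by apply: nc; apply: subset_closure; exact: (vY a' b').
Qed.

(** Of finitely many small convex sets covering the space, each that meets the closure meets some
    [Z i], and from then on its points stay in it under retraction. *)
Lemma retr_uniform Z (e : R) : (forall i, closed (Z i)) -> (forall i, convex (Z i)) ->
  (forall i, Z i !=set0) -> (forall i j, (i <= j)%N -> Z i `<=` Z j) -> 0 < e ->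
  exists N, forall i x, (N <= i)%N -> closure (\bigcup_i Z i) x -> mdist x (retr (Z i) x) < e.
Proof.
move=> cZ vZ Z0 mZ e0; have e2 : 0 < e / 2 by rewrite divr_gt0.
have [P [s [hP hs]]] := convex_cover D e2.
have /choice[N hN] : forall x, exists N : nat, forall i, (N <= i)%N ->
    (closure (\bigcup_i Z i) `&` P x !=set0) -> exists2 y, Z i y & P x y.
  move=> x; have [[y [hy Py]]|no] := pselect (closure (\bigcup_i Z i) `&` P x !=set0); last first.
    by exists 0%N => i _ /no.
  have [oP _ _ _] := hP x.
  have [z [[N _ ZNz] Pz]] : (\bigcup_i Z i) `&` P x !=set0 by apply: hy; exact: open_nbhs_nbhs.
  by exists N => i Ni _; exists z => //; exact: mZ Ni _ ZNz.
exists (\max_(x <- s) N x)%N => i x Ni Yx.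
have [w ws Pw] := hs x; have [_ _ PU vP] := hP w.
have [|y Zy Py] := hN w i _ (ex_intro _ x (conj Yx Pw)).
  by apply: leq_trans Ni; exact: leq_bigmax_seq.
have h := PU _ (retr_convex D (cZ i) (vZ i) (Z0 i) vP Pw Py Zy).
rewrite (le_lt_trans (metric_triangle _ w _))// [ltRHS]splitr ltrD//.
by rewrite metric_sym; exact: PU.
Qed.

End Approximation.

Section InverseLimit.
Context {R : realType} {X : metricType R}.
Variables (n : nat) (G : set 'M[int]_n) (act : 'M[int]_n -> X -> X).
Hypothesis D : is_dendrite [set: X].
Hypothesis Gfi : finite_index_subgroup_SLZ G.
Hypothesis Gact : is_action G act.
Variable Z : nat -> set X.
Hypotheses (cZ : forall i : nat, closed (Z i)) (vZ : forall i, convex (Z i)) (Z0 : forall i, Z i !=set0).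
Hypothesis mZ : forall i j, (i <= j)%N -> Z i `<=` Z j.
Hypothesis iZ : forall i g z, G g -> Z i z -> Z i (act g z).
Hypothesis finZ : forall i, exists (r : seq 'M[int]_n) (c : 'M[int]_n -> 'M[int]_n),
  (forall g, G g -> c g \in r) /\
  forall g g', G g -> G g' -> c g = c g' -> forall z, Z i z -> act g z = act g' z.

Let Y := closure (\bigcup_i Z i).
Let W i : metricType R := subm (Z i).
Let P i := retr (Z i).

(* The identity for [g] outside [G], where [act g] need not preserve [Z i]. *)
Definition sub_act i g : W i -> W i := if pselect (G g) is left Gg
  then fun x => exist _ (act g (sval x)) (iZ Gg (svalP x)) else id.

Lemma sub_actE i g x : G g -> sval (sub_act g x : W i) = act g (sval x).
Proof. by rewrite /sub_act; case: pselect. Qed.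

Definition sub_retr i (x : X) : W i := exist _ (P i x) (retr_in D (@cZ i) (@vZ i) (Z0 i) x).

Lemma sub_action i : is_action G (@sub_act i) /\ finite_action G (@sub_act i).
Proof.
have cont g : G g -> continuous (@sub_act i g).
  move=> Gg; apply/continuous_mdistP => x e e0.
  have [d d0 hd] := (continuous_mdistP _).1 (act_cont Gact Gg) (sval x) e e0.
  by exists d => // y xy; rewrite !subm_mdist !sub_actE//; exact: hd.
split.
  split=> // [g Gg|x|g h x Gg Gh].
  - exists (@sub_act i (invmx g)); first by apply: cont; exact: GV.
    have GVg := GV Gfi Gg.
    by split=> x; apply: subm_eq; rewrite !sub_actE//; [exact: (actK Gfi Gact)|exact: (actVK Gfi Gact)].
  - by apply: subm_eq; rewrite sub_actE ?(act1 Gact)//; case: Gfi => [[]].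
  - by apply: subm_eq; rewrite !sub_actE ?(actM Gact)//; exact: (GM Gfi).
have [r [c [cr hc]]] := finZ i.
(* One map is chosen for each class, so finitely many classes leave finitely many maps. *)
pose F m : W i -> W i := @xget {classic (W i -> W i)} id [set f | exists2 g, G g & c g = m /\ f = @sub_act i g].
apply: (@sub_finite_set _ _ (F @` [set` r])); last exact: finite_image.
move=> _ [g Gg <-]; exists (c g); first exact: cr.
rewrite /F; case: xgetP => [f _ [h Gh [ch ->]]|/(_ (@sub_act i g))[]]; last by exists g.
by apply/funext => x; apply: subm_eq; rewrite !sub_actE//; apply: hc => //; exact: svalP.
Qed.

Lemma closure_invariant g y : G g -> Y y -> Y (act g y).
Proof.
move=> Gg /closure_mdistP hy; apply/closure_mdistP => e e0.
have [d d0 hd] := (continuous_mdistP _).1 (act_cont Gact Gg) y e e0.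
have [z [i _ Ziz] yz] := hy d d0; exists (act g z); last exact: hd.
by exists i => //; exact: iZ.
Qed.

Lemma retr_act i g x : G g -> P i (act g x) = act g (P i x).
Proof.
move=> Gg; apply: (retr_equivariant D (@cZ i) (@vZ i) (Z0 i)); first exact: (act_cont Gact).
- exact: (act_inj Gfi Gact).
- by move=> y; exact: iZ.
move=> y Zy; exists (act (invmx g) y); last exact: (actVK Gfi Gact).
by apply: iZ => //; exact: GV.
Qed.

(** The bonding maps are the first point maps. A thread is recovered as a cluster point of its
    coordinates: its retractions are these coordinates, and uniform convergence of the retractions
    makes it unique and continuous in the thread. *)
Lemma inverse_limit_almost_finite : almost_finite G act Y.
Proof.
have cX : compact [set: X] by case: D.
exists W, sub_act, (fun i x => sub_retr i (sval x)); split.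
- by move=> i; apply: subm_compact; exact: (subclosed_compact (@cZ i) cX).
- exact: sub_action.
- move=> i; split=> [|w].
    apply/continuous_mdistP => x e e0.
    have [d d0 hd] := (continuous_mdistP _).1 (retr_continuous D (@cZ i) (@vZ i) (Z0 i)) (sval x) e e0.
    by exists d => // y xy; exact: hd.
  exists (exist _ (sval w) (mZ (leqnSn i) (svalP w))); apply: subm_eq => /=.
  by apply: (retr_id D); exact: svalP.
- by move=> i g z Gg; apply: subm_eq; rewrite /= !sub_actE//=; exact: retr_act.
move=> L; pose T := prod_topology (fun i => W i : topologicalType).
pose cl (z : T) (p : X) := forall (e : R) N, 0 < e -> exists2 m, (N <= m)%N & mdist p (sval (z m)) < e.
have /choice[k hk] : forall z : T, exists p, cl z p.
  by move=> z; have [p _ hp] := compact_seq_cluster cX (fun m => I : [set: X] (sval (z m))); exists p.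
have Pcont i := (continuous_mdistP _).1 (retr_continuous D (@cZ i) (@vZ i) (Z0 i)).
have PP i j x : (i <= j)%N -> P i (P j x) = P i x.
  by move=> ij; apply: (retr_comp D) => //; exact: mZ.
have Lz z i m : L z -> (i <= m)%N -> P i (sval (z m)) = sval (z i).
  move=> Lz /subnKC <-; elim: (m - i)%N => [|j IH]; first by rewrite addn0 /P (retr_id D)//; exact: svalP.
  rewrite -IH -(Lz (i + j)%N) addnS /= -/(P _) PP//; exact: leq_addr.
have Pk z i : L z -> P i (k z) = sval (z i).
  move=> hz; apply: mdist_lt_eq => e e0; have [d d0 hd] := Pcont i (k z) e e0.
  have [m im hm] := hk z d i d0; have := hd _ hm.
  by rewrite -/(P i) Lz// => /ltW.
have Yk z : Y (k z).
  apply/closure_mdistP => e e0; have [m _ hm] := hk z e 0%N e0.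
  by exists (sval (z m)) => //; exists m => //; exact: svalP.
have unif (e : R) : 0 < e -> exists N, forall i x, (N <= i)%N -> Y x -> mdist x (P i x) < e.
  by move=> e0; apply: retr_uniform.
exists (fun y => (fun i => sub_retr i y) : T), k; split.
- apply: continuous_subspaceT; apply: prod_continuous => i.
  apply/continuous_mdistP => x e e0; have [d d0 hd] := Pcont i x e e0.
  by exists d => // y xy; exact: hd.
- apply/subspace_continuousP => z hz B /nbhs_mdistE[e e0 eB].
  have e3 : 0 < e / 3 by rewrite divr_gt0.
  have [N hN] := unif _ e3.
  (* By uniform convergence the coordinate [N] alone determines the point up to e/3. *)
  have hn : nbhs z [set z' : T | mdist (z N) (z' N) < e / 3].
    have := @proj_continuous nat (fun i => W i : topologicalType) N z [set w | mdist (z N) w < e / 3].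
    apply.
    by apply/nbhs_mdistE; exists (e / 3).
  apply: filterS hn => z' zz' hz'; apply: eB.
  rewrite (le_lt_trans (metric_triangle _ (sval (z N)) _))//.
  have := hN N _ (leqnn N) (Yk z); rewrite Pk// => h1.
  have := hN N _ (leqnn N) (Yk z'); rewrite Pk// => h2.
  have h3 := metric_triangle (sval (z N)) (sval (z' N)) (k z').
  rewrite metric_sym in h2; rewrite /= subm_mdist in zz'.
  lra.
- move=> y Yy; have hL : L (fun i => sub_retr i y).
    by move=> i; apply: subm_eq; rewrite /= -/(P _) PP.
  split => //; apply: mdist_lt_eq => e e0; have e2 : 0 < e / 2 by rewrite divr_gt0.
  have [N hN] := unif _ e2; have h1 := hN N _ (leqnn N) Yy.
  have := hN N _ (leqnn N) (Yk (fun i => sub_retr i y)); rewrite Pk//= => h2.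
  rewrite metric_sym in h1.
  rewrite (le_trans (metric_triangle _ (P N y) _))// [leRHS]splitr lerD// ltW//.
- move=> z hz; split; first exact: Yk.
  by apply: functional_extensionality_dep => i; apply: subm_eq; exact: Pk.
- move=> g y Gg Yy; apply: functional_extensionality_dep => i; apply: subm_eq.
  by rewrite sub_actE//=; exact: retr_act.
Qed.

End InverseLimit.

(** * Contracting the fibres over the closure of the fixed points *)

Theorem theorem1p2 (R : realType) (X : metricType R) (n : nat)
  (G : set 'M[int]_n) (act : 'M[int]_n -> X -> X) :
  (3 <= n)%N ->
  is_dendrite [set: X] -> nondeg [set: X] ->
  (forall x : X, finite_order x) ->
  finite_index_subgroup_SLZ G ->
  is_action G act ->
  exists Y : set X,
    [/\ is_dendrite Y, nondeg Y, G_invariant G act Y,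
        almost_finite G act Y &
        exists r : X -> X, (forall x, first_point Y x (r x)) /\
                           contractible_extension G act Y r].
Proof.
move=> n3 D [a [b [_ _ ab]]] ford Gfi Gact.
have [K [K_gt0 K0G]] := finite_index_param Gfi; pose K0 : int := K%:Z.
have K00 : K0 != 0 by rewrite /K0 -lt0n.
have [k1 [mk1 k10 [y0 hy0]]] := fixed_nonempty n3 D Gfi Gact K0G K00.
pose Z (i : nat) := fixed act (k1 * i`!%:Z).
have mZk i : mult K0 (k1 * i`!%:Z) by exact: mult_mul.
have Zk0 (i : nat) : k1 * i`!%:Z != 0 by rewrite mulf_neq0// -lt0n fact_gt0.
have cZ i : closed (Z i) by exact: (fixed_closed Gact K0G).
have vZ i : convex (Z i) by exact: (fixed_convex n3 D Gfi Gact K0G).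
have mZ i j : (i <= j)%N -> Z i `<=` Z j by exact: (fixed_factorial_mono Gact K0G).
have iZ i g z : G g -> Z i z -> Z i (act g z) by exact: (fixed_invariant Gfi Gact K0G).
have Z00 : Z 0%N y0 by rewrite /Z fact0 mulr1.
have Z0 i : Z i !=set0 by exists y0; exact: mZ Z00.
have finZ i := fixed_finite_action n3 Gfi Gact K0G (mZk i) (Zk0 i).
pose F := \bigcup_i Z i; pose Y := closure F.
have fixF k : mult K0 k -> k != 0 -> fixed act k `<=` F.
  by move=> mk k0 x hx; exists `|k|%N => //; exact: (fixed_factorial Gact K0G).
have vF : convex F.
  move=> x y [i _ hx] [j _ hy] z xyz; exists (maxn i j) => //.
  by apply: vZ xyz; [exact: mZ (leq_maxl i j) _ hx|exact: mZ (leq_maxr i j) _ hy].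
have germ y x : F y -> x <> y -> exists z, [/\ F z, z <> y & seg y x z].
  move=> [i _ hy] xy; have [k [z [mk k0 hz zy xz]]] :=
    fixed_germ n3 D Gfi Gact K0G (mZk i) (Zk0 i) hy xy (ford y).
  by exists z; split => //; exact: (fixF k).
have cY : closed Y by exact: closed_closure.
have vY : convex Y by exact: closure_convex.
have FY : F `<=` Y by exact: subset_closure.
have Fy0 : F y0 by exists 0%N.
have Y0 : Y !=set0 by exists y0; exact: FY.
have iY g y : G g -> Y y -> Y (act g y) by exact: (closure_invariant Gact).
have gr := retrP D cY vY Y0.
have equi g x : G g -> retr Y (act g x) = act g (retr Y x).
  move=> Gg; apply: (retr_equivariant D cY vY Y0).
  - exact: (act_cont Gact).
  - exact: (act_inj Gfi Gact).
  - by move=> y; exact: iY.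
  - move=> y Yy; exists (act (invmx g) y); last exact: (actVK Gfi Gact).
    by apply: iY => //; exact: GV.
exists Y; split.
- exact: convex_dendrite.
- have [x xy0] : exists x, x <> y0.
    by have [e|] := pselect (a = y0); [exists b; rewrite -e; exact/nesym|exists a].
  have [z [Fz zy0 _]] := germ y0 x Fy0 xy0.
  by exists z, y0; split => //; exact: FY.
- by move=> g y; exact: iY.
- exact: inverse_limit_almost_finite.
exists (retr Y); split; first by move=> x; exact: (gate_first_point D).
split; [exact: retr_continuous|exact: retr_image|by move=> g x; exact: equi|].
move=> y Yy; have [Fy|nFy] := pselect (F y).
  exists (fun=> 1%:M); split=> [_|e e0]; first by case: Gfi => [[]].
  (* Another point [x] of the fibre would have a point of [F] on ]y, x], before its first point
     [y]. *)
  have fib x : retr Y x = y -> x = y.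
    move=> xy; apply: contrapT => nxy; have [z [Fz zy yxz]] := germ y x Fy nxy.
    apply: zy; rewrite (segC D) in yxz; have [_ h] := gr x; rewrite xy in h.
    exact: (tree_anti D yxz (h z (FY _ Fz))).
  by apply: nearW => i p q [x /fib -> <-] [x' /fib -> <-]; rewrite mdistxx ltW.
have orbit (s : seq X) : exists2 g, G g & ~ (act g y \in s).
  apply: contrapT => no; apply: nFy.
  have [|k [mk k0 hk]] := finite_orbit_fixed Gact K0G K00 (y := y); last exact: (fixF k).
  apply: (@sub_finite_set _ _ [set` s]); last exact: finite_seq.
  by move=> _ [g Gg <-] /=; apply: contrapT => h; apply: no; exists g.
(* Half of 1/(i+1), because two points of the fibre are compared through its base point. *)
have /choice[u hu] : forall i : nat, exists g, G g /\
    forall p, retr Y p = act g y -> mdist (act g y) p < (i.+1%:R^-1 / 2 : R).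
  move=> i; have e0 : 0 < (i.+1%:R^-1 / 2 : R) by rewrite divr_gt0.
  have [s hs] := small_fibers D cY vY Y0 e0; have [g Gg gs] := orbit s.
  by exists g; split => // p hp; rewrite -hp; apply: hs; rewrite hp.
exists u; split=> [i|e e0]; first by case: (hu i).
near=> i => p q [x /= xy <-] [x' /= xy' <-]; have [Gu h] := hu i.
have h1 := h (act (u i) x); have h2 := h (act (u i) x').
rewrite !equi// xy xy' in h1 h2; rewrite metric_sym in h1.
have {}h1 := h1 erefl; have {}h2 := h2 erefl.
rewrite (le_trans (metric_triangle _ (act (u i) y) _))//.
rewrite (@le_trans _ _ (i.+1%:R^-1))//; first by rewrite [leRHS]splitr lerD// ltW.
by apply: ltW; near: i; exact: (near_infty_natSinv_lt (PosNum e0)).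
Unshelve. all: by end_near.
Qed.
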